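(* Let $n\ge 1$, $\beta>0$, $M>0$, $0\le \tau<T$, and let $\omega\subseteq\mathbb{R}^n$ be an open set such that $\mathbb{R}^n\setminus\omega$ is compact. Then there exist constants $\kappa\in(0,1)$ and $C_1=C_1(M,\beta,\tau,T,\omega)>0$ such that the following holds. For every $u_0\in\mathcal{A}_{\beta,M}$, with $u$ the solution of the heat equation in $\mathbb{R}^n\times(0,T)$ with initial condition $u_0$, if $\|u\|_{L^2(\omega\times(\tau,T))}<1$, then $$\|u_0\|_{L^2(\mathbb{R}^n)}\le C_1\left(-\log\|u\|_{L^2(\omega\times(\tau,T))}\right)^{-\kappa}.$$
   Context: The heat equation problem with initial condition $u_0$ is $$u_t-\Delta u=0 \text{ in }\mathbb{R}^n\times(0,T),\qquad u(y,0)=u_0(y)\text{ in }\mathbb{R}^n,\qquad \lim_{|y|\to\infty}u(y,t)=0 \text{ for } t\in(0,T),$$ and its solution is $u(\cdot,t)=e^{t\Delta}u_0$, i.e. $u(y,t)=\int_{\mathbb{R}^n}u_0(r)(4\pi t)^{-n/2}e^{-|y-r|^2/(4t)}\,dr$ for $t>0$. The admissible set is $\mathcal{A}_{\beta,M}:=\{a\in H^{2\beta}(\mathbb{R}^n): \|a\|_{H^{2\beta}(\mathbb{R}^n)}\le M\}$. If $\|u\|_{L^2(\omega\times(\tau,T))}=0$, the right-hand side is understood as $0$. *)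

(* Defs.v *)
From HB Require Import structures.
From mathcomp Require Import all_boot all_order all_algebra.
From mathcomp Require Import all_classical all_reals all_analysis.

Set Implicit Arguments.
Unset Strict Implicit.
Unset Printing Implicit Defensive.

Import Order.TTheory GRing.Theory Num.Theory.
Import numFieldNormedType.Exports.

Local Open Scope classical_set_scope.
Local Open Scope ring_scope.

(* R^n is 'rV[R]_n with the library's topology. Its sigma-algebra is generated
   by the coordinates (as the library does for n.-tuple); for T = R these are
   the Borel sets. *)
Section rV_measurable.
Context {d} {T : sigmaRingType d} (n : nat).

Let coord : 'I_n -> 'rV[T]_n -> T := fun i x => x ord0 i.

Let rV_set0 : g_sigma_preimage coord set0.
Proof. exact: sigma_algebra0. Qed.

Let rV_setC A : g_sigma_preimage coord A -> g_sigma_preimage coord (~` A).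
Proof. exact: sigma_algebraC. Qed.

Let rV_bigcup (F : (set 'rV[T]_n)^nat) :
  (forall i, g_sigma_preimage coord (F i)) ->
  g_sigma_preimage coord (\bigcup_i F i).
Proof. exact: sigma_algebra_bigcup. Qed.

HB.instance Definition _ := @isMeasurable.Build (measure_tuple_display d)
  'rV[T]_n (g_sigma_preimage coord) rV_set0 rV_setC rV_bigcup.

End rV_measurable.

Lemma measurable_rV d (T : sigmaRingType d) n (i : 'I_n) :
  measurable_fun [set: 'rV[T]_n] (fun x => x ord0 i).
Proof.
move=> _ Y mY; rewrite setTI; apply: sub_sigma_algebra => /=.
rewrite -bigcup_seq/=; exists i => /=; first by rewrite mem_index_enum.
by exists Y => //; rewrite setTI.
Qed.

Lemma measurable_fun_rVP d1 d2 (T1 : measurableType d1)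
    (T2 : measurableType d2) n (f : T1 -> 'rV[T2]_n) :
  measurable_fun [set: T1] f <->
  forall i, measurable_fun [set: T1] (fun x => f x ord0 i).
Proof.
split=> [mf i|mf].
  exact: (measurableT_comp (@measurable_rV _ T2 n i) mf).
have sm : g_sigma_preimage (fun i x => f x ord0 i) `<=` measurable.
  apply: smallest_sub; first exact: sigma_algebra_measurable.
  rewrite -bigcup_seq; apply: bigcup_sub => i _ _ [B mB <-].
  exact: mf.
move=> _ A mA; apply: sm.
rewrite (@g_sigma_preimage_comp _ T2 n 'rV[T2]_n
  (fun i (x : 'rV[T2]_n) => x ord0 i) _ f).
by exists A.
Qed.

Section lebesgue_rV.
Context {R : realType}.

Definition rV_cons n (p : 'rV[R]_n * R) : 'rV[R]_n.+1 :=
  \row_i (if unlift ord0 i is Some j then p.1 ord0 j else p.2).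

Lemma measurable_rV_cons n : measurable_fun setT (@rV_cons n).
Proof.
apply/measurable_fun_rVP => i.
rewrite /rV_cons; under eq_fun do rewrite mxE.
case: (unlift _ _) => [j|]; last exact: measurable_snd.
exact: (measurableT_comp (@measurable_rV _ R n j) measurable_fst).
Qed.

Definition lebesgue_cons n (m : {measure set 'rV[R]_n -> \bar R}) :=
  pushforward (m \x lebesgue_measure)%E (@rV_cons n).

Section lebesgue_cons_measure.
Variables (n : nat) (m : {measure set 'rV[R]_n -> \bar R}).
Local Open Scope ereal_scope.

Let ml := measure_function_pushforward__canonical__measure_function_Measure
  [the measure _ _ of (m \x lebesgue_measure)%E] (@measurable_rV_cons n).

Let lebesgue_cons0 : lebesgue_cons m set0 = 0.
Proof. exact: (measure0 ml). Qed.

Let lebesgue_cons_ge0 A : 0 <= lebesgue_cons m A.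
Proof. exact: (measure_ge0 ml). Qed.

Let lebesgue_cons_sigma_additive : semi_sigma_additive (lebesgue_cons m).
Proof. exact: (@measure_semi_sigma_additive _ _ _ ml). Qed.

HB.instance Definition _ := isMeasure.Build _ _ _ (lebesgue_cons m)
  lebesgue_cons0 lebesgue_cons_ge0 lebesgue_cons_sigma_additive.

End lebesgue_cons_measure.

(* n-dimensional Lebesgue measure *)
Fixpoint lebesgue_rV (n : nat) : {measure set 'rV[R]_n -> \bar R} :=
  if n is m.+1 then [the measure _ _ of lebesgue_cons (lebesgue_rV m)]
  else [the measure _ _ of dirac (0 : 'rV[R]_0)].

Lemma lebesgue_rV_box n (A : 'I_n -> set R) :
  (forall i, measurable (A i)) ->
  lebesgue_rV n [set x | forall i, A i (x ord0 i)] =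
  (\prod_(i < n) lebesgue_measure (A i))%E.
Proof.
elim: n A => [|n IH] A mA.
  by rewrite big_ord0 /= diracE mem_set//= => -[].
rewrite big_ord_recl /= /lebesgue_cons /pushforward.
rewrite (_ : _ @^-1` _ =
  [set x : 'rV[R]_n | forall i, A (lift ord0 i) (x ord0 i)] `*` A ord0);
  last first.
  apply/seteqP; split => -[x y] /=.
    move=> H; split.
      by move=> i; have := H (lift ord0 i); rewrite /rV_cons mxE liftK.
    by have := H ord0; rewrite /rV_cons mxE unlift_none.
  move=> [H1 H2] i; rewrite /rV_cons mxE.
  by case: unliftP => [j ->|->] /=.
rewrite product_measure1E//; last exact: mA.
  by rewrite (IH (fun i => A (lift ord0 i)))// muleC.
rewrite (_ : mkset _ = \bigcap_(i in [set: 'I_n])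
  ([set: 'rV[R]_n] `&` ((fun x => x ord0 i) @^-1` A (lift ord0 i)))); last first.
  apply/seteqP; split => x /= H i; first by move=> _; split => //; exact: H.
  by have [] := H i I.
apply: fin_bigcap_measurable; first exact: finite_finset.
by move=> i _; apply: (@measurable_rV _ R n i) => //; exact: mA.
Qed.

End lebesgue_rV.

Section definitions.
Context {R : realType} {n : nat}.
Implicit Types (x y xi : 'rV[R]_n) (f u : 'rV[R]_n -> R).

Let mu : {measure set 'rV[R]_n -> \bar R} := lebesgue_rV n.

Definition dotrV x y : R := \sum_(i < n) x ord0 i * y ord0 i.

(* squared Euclidean norm; the library's `|x| on 'rV[R]_n is the sup norm *)
Definition sqnormrV x : R := dotrV x x.

(* e^{t Delta} u0 for t > 0 *)
Definition heat_flow u y (t : R) : R :=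
  (\int[mu]_r (u r * (4 * pi * t) `^ (- (n%:R / 2)) *
               expR (- sqnormrV (y - r) / (4 * t))))%R.

(* Real and imaginary parts of
     (2 pi)^{-n/2} \int_{|x| <= k} f(x) e^{-i x . xi} dx. *)
Definition ball_fourier f (k : nat) : ('rV[R]_n -> R) * ('rV[R]_n -> R) :=
  let B := [set x | sqnormrV x <= k%:R ^+ 2] in
  let c := (2 * pi) `^ (- (n%:R / 2)) in
  (fun xi => c * (\int[mu]_(x in B) (f x * cos (dotrV x xi)))%R,
   fun xi => - c * (\int[mu]_(x in B) (f x * sin (dotrV x xi)))%R).

(* [L2_fourier f g] : g.1 + i g.2 is (a representative of) the Fourier-Plancherel
   transform of f in L^2, i.e. the L^2 limit of the transforms of f restricted
   to the balls of radius k. *)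
Definition L2_fourier f (g : ('rV[R]_n -> R) * ('rV[R]_n -> R)) : Prop :=
  [/\ g.1 \in Lfun mu 2%:E, g.2 \in Lfun mu 2%:E,
      'N[mu]_2%:E[EFin \o ((ball_fourier f k).1 \- g.1)%R]%E @[k --> \oo] --> 0%E &
      'N[mu]_2%:E[EFin \o ((ball_fourier f k).2 \- g.2)%R]%E @[k --> \oo] --> 0%E].

Definition weighted_norm (s : R) (g : ('rV[R]_n -> R) * ('rV[R]_n -> R)) :
    \bar R :=
  ((\int[mu]_xi ((1 + sqnormrV xi) `^ s * (g.1 xi ^+ 2 + g.2 xi ^+ 2))%:E)
     `^ 2^-1)%E.

(* || (1 + |xi|^2)^{s/2} f^ ||_{L^2}. All the transforms of f agree almost
   everywhere, so the infimum is over at most one value. *)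
Definition sobolev_norm (s : R) f : \bar R :=
  ereal_inf [set weighted_norm s g | g in L2_fourier f].

(* H^s(R^n) for s >= 0, real-valued functions *)
Definition sobolev_space (s : R) : set ('rV[R]_n -> R) :=
  [set f | f \in Lfun mu 2%:E /\ (sobolev_norm s f < +oo)%E].

Definition admissible (beta M : R) : set ('rV[R]_n -> R) :=
  [set a | sobolev_space (2 * beta) a /\ (sobolev_norm (2 * beta) a <= M%:E)%E].

Definition L2norm f : \bar R := ('N[mu]_2%:E[EFin \o f])%E.

(* L^2 norm over omega x (tau, T) of a function of (space, time) *)
Definition L2norm_cylinder (omega : set 'rV[R]_n) (tau T : R)
    (u : 'rV[R]_n -> R -> R) : \bar R :=
  ('N[mu \x lebesgue_measure]_2%:E
    [(fun p : 'rV[R]_n * R => (u p.1 p.2)%:E) \_ (omega `*` `]tau, T[)])%E.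

End definitions.

(* (- log N)^{-kappa}, understood as 0 for N = 0 *)
Definition log_modulus {R : realType} (kappa N : R) : R :=
  if N == 0 then 0 else (- ln N) `^ (- kappa).

(* Main.v *)
(* Write P_t for the heat semigroup and S for the translation by h in the first
   coordinate.  Since ||(1 - S) P_s|| <= h / sqrt(2 s), cutting t / k into m equal
   steps shows that (1 - S)^m P_{t/k} has norm at most e^{-2 m} when h = 2 r / k and
   k = c m with c large, so P_t u0 is well approximated by (1 - (1 - S)^m)^k P_t u0.
   Each of the k factors is divisible by S and k h = 2 r, so the values of the
   latter on {x_1 > -r} only involve those of P_t u0 on {x_1 > r}.  As
   {|x_1| >= r} lies in omega for large r, this gives, for every m >= 1,
     ||P_T u0|| <= C (2^{c m^2} ||u||_{L^2(omega x (tau, T))} + m e^{-2 m} ||u0||).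
   On the Fourier side P_T u0 controls the frequencies |xi|^2 <= l of u0 at the
   cost of e^{T l}, and the Sobolev bound controls the others:
     ||u0|| <= e^{T l} ||P_T u0|| + (1 + l)^{-beta} (M + 1).
   Choosing l = m / T and m^2 proportional to - log ||u|| gives the estimate.  The
   Plancherel identity ||P_t f|| = ||e^{- t |xi|^2} f^|| is obtained from the
   Fourier transform of Gaussians, and ||P_t f|| -> ||f|| as t -> 0 from the
   Dirichlet forms of indicators of boxes. *)
Require Import Defs.
From HB Require Import structures.
From mathcomp Require Import all_boot all_order all_algebra.
From mathcomp Require Import all_classical all_reals all_analysis.
From mathcomp Require Import measurable_realfun ring lra.

Set Implicit Arguments.
Unset Strict Implicit.
Unset Printing Implicit Defensive.

Import Order.TTheory GRing.Theory Num.Theory.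
Import numFieldNormedType.Exports.

Local Open Scope classical_set_scope.
Local Open Scope ring_scope.

(** No Carleman weight or analytic continuation recovers the values on the compact set: smoothing
    makes high differences of [P_t u0] small, so [1 - (1 - S)^m] is nearly the identity there. Two
    rates decide the result. Each of the k = c m factors costs [2^m] on a half-space; the total
    [2^(c m^2)] limits m to the square root of [- log ||u||], which halves the exponent. The error
    [e^(-2m)] must beat the price [e^(T l) = e^m] of inverting the flow on low frequencies, so its
    rate has to exceed 1. The transform of [u0] is given only as an L^2 limit. Plancherel's identity
    is therefore proved under a Gaussian weight, where all exchanges of integrals converge
    absolutely, and strong continuity at time 0 removes the weight. Dirichlet forms suit this
    because a pointwise bound between increments passes to them. The Sobolev norm is an infimum,
    from which a transform of weighted norm below [M + 1] is picked. A vanishing observation is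
    treated as a limit: the inequalities then hold with every positive value in its place. *)

Section sigma_finite_fubini.
Context d1 d2 (X : measurableType d1) (Y : measurableType d2) (R : realType).

(** Iterated-integral theorems take sigma-finiteness as a structure, while [lebesgue_rV n] is built
    by recursion as a bare measure. The same function is repacked, so that a rewrite moves from one
    to the other. *)
Lemma sigma_finite_measureE d (T : measurableType d)
    (m : {measure set T -> \bar R}) : sigma_finite setT m ->
  exists m' : {sigma_finite_measure set T -> \bar R},
    m = m' :> {measure set T -> \bar R}.
Proof.
case: m => f c sf.
pose fm : {measure set T -> \bar R} := Measure.Pack c.
pose m' : {sigma_finite_measure set T -> \bar R} := HB.pack f c
   (@Measure_isSigmaFinite.Build _ _ _ fm sf).
by exists m'.
Qed.

Variables (m1 : {measure set X -> \bar R}) (m2 : {measure set Y -> \bar R}).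
Hypotheses (s1 : sigma_finite setT m1) (s2 : sigma_finite setT m2).

Section nonneg.
Variable f : X * Y -> \bar R.
Hypotheses (mf : measurable_fun [set: X * Y] f) (f0 : forall z, (0 <= f z)%E).

Lemma measurable_tonelliF : measurable_fun setT (fun x => \int[m2]_y f (x, y))%E.
Proof.
have [m' ->] := sigma_finite_measureE s2.
exact: measurable_fun_fubini_tonelli_F.
Qed.

Lemma measurable_tonelliG : measurable_fun setT (fun y => \int[m1]_x f (x, y))%E.
Proof.
have [m' ->] := sigma_finite_measureE s1.
exact: measurable_fun_fubini_tonelli_G.
Qed.

Lemma tonelli :
  (\int[m1]_x \int[m2]_y f (x, y) = \int[m2]_y \int[m1]_x f (x, y))%E.
Proof.
have [m1' ->] := sigma_finite_measureE s1.
have [m2' ->] := sigma_finite_measureE s2.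
exact: fubini_tonelli.
Qed.

End nonneg.

Section signed.
Variable f : X * Y -> R.
Hypotheses (mf : measurable_fun [set: X * Y] f)
  (intf : (\int[m1]_x \int[m2]_y `|f (x, y)|%:E < +oo)%E).

Let mF : measurable_fun [set: X * Y] (EFin \o f).
Proof. exact/measurable_EFinP. Qed.

Lemma fubini_swap : (\int[m1]_x \int[m2]_y (f (x, y))%:E =
  \int[m2]_y \int[m1]_x (f (x, y))%:E)%E.
Proof.
move: intf; have [m1' ->] := sigma_finite_measureE s1.
have [m2' ->] := sigma_finite_measureE s2 => intf'.
exact: (Fubini ((integrable12ltyP _ _ mF).2 intf')).
Qed.

Hypothesis int1 : forall x, m2.-integrable setT (fun y => (f (x, y))%:E).

Lemma Rintegral_EFin (x : X) :
  (Rintegral m2 setT (fun y => f (x, y)))%:E = (\int[m2]_y (f (x, y))%:E)%E.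
Proof. by rewrite /Rintegral fineK//; exact: integrable_fin_num. Qed.

Hypothesis int2 : forall y, m1.-integrable setT (fun x => (f (x, y))%:E).

(** Integrability of every section, and not just of almost every one, lets [fine] be removed
    pointwise. *)
Lemma Rfubini :
  \int[m1]_x \int[m2]_y f (x, y) = \int[m2]_y \int[m1]_x f (x, y).
Proof.
rewrite {1 3}/Rintegral; congr fine.
under eq_integral do rewrite Rintegral_EFin.
rewrite fubini_swap; apply: eq_integral => y _.
by rewrite /Rintegral fineK//; exact: integrable_fin_num.
Qed.

End signed.
End sigma_finite_fubini.

(** * Integration on R^n *)

Section lebesgue_rV_theory.
Context {R : realType}.
Local Notation leb := (@lebesgue_measure R).

Lemma measurable_rV_forall n (A : 'I_n -> set R) :
  (forall i, measurable (A i)) ->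
  measurable [set x : 'rV[R]_n | forall i, A i (x ord0 i)].
Proof.
move=> mA.
rewrite (_ : mkset _ = \bigcap_(i in [set: 'I_n])
  ([set: 'rV[R]_n] `&` ((fun x => x ord0 i) @^-1` A i))); last first.
  apply/seteqP; split => x /= H i; first by move=> _; split => //; exact: H.
  by have [] := H i I.
apply: fin_bigcap_measurable; first exact: finite_finset.
by move=> i _; apply: (@measurable_rV _ R n i) => //; exact: mA.
Qed.

Definition cube n k : set 'rV[R]_n := [set x | forall i, `[- k%:R, k%:R]%classic (x ord0 i)].
Arguments cube : clear implicits.

Lemma measurable_cube n k : measurable (cube n k).
Proof. exact: (@measurable_rV_forall n (fun=> `[- k%:R, k%:R]%classic)). Qed.

Lemma lebesgue_rV_box_ltoo n (A : 'I_n -> set R) : (forall i, measurable (A i)) ->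
  (forall i, leb (A i) < +oo)%E ->
  (lebesgue_rV n [set x | forall i, A i (x ord0 i)] < +oo)%E.
Proof.
move=> mA Aoo; rewrite lebesgue_rV_box//.
suff /andP[//] : ((0 <= \prod_(i < n) leb (A i)) && (\prod_(i < n) leb (A i) < +oo))%E.
apply: (big_ind (fun x : \bar R => (0 <= x) && (x < +oo))%E).
- by rewrite lee01 ltry.
- move=> x y /andP[x0 xoo] /andP[y0 yoo].
  by rewrite mule_ge0// lte_mul_pinfty// ge0_fin_numE.
- by move=> i _; rewrite Aoo measure_ge0.
Qed.

Lemma cube_ltoo n k : (lebesgue_rV n (cube n k) < +oo)%E.
Proof.
apply: (@lebesgue_rV_box_ltoo n (fun=> `[- k%:R, k%:R]%classic)) => // i.
by rewrite lebesgue_measure_itv/=; case: ifP => // _; rewrite ltry.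
Qed.

Lemma bigcup_cube n : \bigcup_k cube n k = setT.
Proof.
apply/seteqP; split => // x _.
pose M := (\sum_(i < n) `|x ord0 i|)%R.
exists (Num.truncn M).+1 => //= i.
rewrite /= in_itv/= -ler_norml.
apply: (@le_trans _ _ M); last exact/ltW/truncnS_gt.
by rewrite /M (bigD1 i)//= lerDl sumr_ge0.
Qed.

Lemma lebesgue_rV_sigma_finite n : sigma_finite setT (@lebesgue_rV R n).
Proof.
exists (cube n); first by rewrite bigcup_cube.
by move=> k; split; [exact: measurable_cube|exact: cube_ltoo].
Qed.

Lemma ge0_integral_rVS n (f : 'rV[R]_n.+1 -> \bar R) :
  measurable_fun setT f -> (forall x, 0 <= f x)%E ->
  (\int[lebesgue_rV n.+1]_x f x =
   \int[lebesgue_rV n]_x \int[leb]_a f (rV_cons (x, a)))%E.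
Proof.
move=> mf f0.
have mc := @measurable_rV_cons R n.
transitivity (\int[(lebesgue_rV n \x leb)%E]_p (f \o @rV_cons R n) p)%E.
  rewrite -[in RHS](preimage_setT (@rV_cons R n)).
  exact: ge0_integral_pushforward.
have [m' ->] := sigma_finite_measureE (lebesgue_rV_sigma_finite n).
have mfc : measurable_fun [set: 'rV[R]_n * measurableTypeR R] (f \o @rV_cons R n).
  exact: measurableT_comp.
apply: (@fubini_tonelli1 _ _ _ _ _ m' (@lebesgue_measure R) (f \o @rV_cons R n)) => //.
by move=> z; exact: f0.
Qed.

Lemma lebesgue_sigma_finite : sigma_finite setT leb.
Proof. exact: sigma_finiteT. Qed.

Lemma rV_consE0 n (x : 'rV[R]_n) a : rV_cons (x, a) ord0 ord0 = a.
Proof. by rewrite mxE unlift_none. Qed.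

Lemma rV_consE n (x : 'rV[R]_n) a i : rV_cons (x, a) ord0 (lift ord0 i) = x ord0 i.
Proof. by rewrite mxE liftK. Qed.

Lemma integral_rV_prod n (f : 'I_n -> R -> R) :
  (forall i, measurable_fun setT (f i)) -> (forall i x, 0 <= f i x) ->
  (\int[lebesgue_rV n]_x (\prod_(i < n) f i (x ord0 i))%:E =
   \prod_(i < n) \int[leb]_a (f i a)%:E)%E.
Proof.
elim: n f => [|n IH] f mf f0.
  under eq_integral do rewrite big_ord0.
  by rewrite big_ord0 integral_cst//= diracT mul1e.
have mprod k (g : 'I_k -> R -> R) : (forall i, measurable_fun setT (g i)) ->
  measurable_fun setT (fun x : 'rV[R]_k => \prod_(i < k) g i (x ord0 i)).
  move=> mg; apply: measurable_prod => i _.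
  exact: (measurableT_comp (mg i) (@measurable_rV _ R k i)).
have mfE i : measurable_fun [set: R] (fun a : R => (f i a)%:E).
  by apply/measurable_EFinP; exact: mf.
rewrite ge0_integral_rVS; first last.
- by move=> x; rewrite lee_fin prodr_ge0.
- by apply/measurable_EFinP; exact: (mprod n.+1 f mf).
rewrite big_ord_recl muleC -IH//.
transitivity (\int[lebesgue_rV n]_x ((\prod_(i < n) f (lift ord0 i) (x ord0 i))%:E * \int[leb]_a (f ord0 a)%:E))%E.
  apply: eq_integral => x _.
  rewrite -ge0_integralZl//=; first last.
  - by rewrite lee_fin prodr_ge0.
  - by move=> a _; rewrite lee_fin.
  - exact: mfE.
  apply: eq_integral => a _.
  rewrite big_ord_recl rV_consE0 mulrC EFinM; congr (_%:E * _)%E.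
  by apply: eq_bigr => i _; rewrite rV_consE.
rewrite ge0_integralZr//.
- apply/measurable_EFinP; exact: (mprod n (fun i => f (lift ord0 i)) (fun i => mf _)).
- by move=> x _; rewrite lee_fin prodr_ge0.
- by apply: integral_ge0 => a _; rewrite lee_fin.
Qed.

(** The translated measure agrees with Lebesgue measure on half-open intervals, and these determine
    it. *)
Lemma lebesgue_pushforwardD (h : R) (A : set R) : measurable A ->
  pushforward leb (fun x : measurableTypeR R => x + h : measurableTypeR R) A = leb A.
Proof.
have mh : measurable_fun setT (fun x : measurableTypeR R => x + h : measurableTypeR R).
  exact: measurable_funD.
pose ml := measure_function_pushforward__canonical__measure_function_Measure leb mh.
move=> mA; apply/esym/(@lebesgue_measure_unique R ml) => //= _ [[a b]] _ <-.
rewrite /pushforward/=.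
rewrite (_ : _ @^-1` _ = `](a - h), (b - h)]%classic); last first.
  by apply/seteqP; split => x /=; rewrite !in_itv/= ltrBlDr lerBrDr.
rewrite !lebesgue_measure_itv/= !lte_fin ltrD2r; case: ifP => // _.
by rewrite -!EFinD; congr (_%:E); ring.
Qed.

Lemma ge0_integral_shift (h : R) (f : R -> \bar R) : measurable_fun setT f ->
  (forall x, 0 <= f x)%E -> (\int[leb]_x f (x + h)%R = \int[leb]_x f x)%E.
Proof.
move=> mf f0.
have mh : measurable_fun setT (fun x : measurableTypeR R => x + h : measurableTypeR R).
  exact: measurable_funD.
rewrite -[in LHS](preimage_setT (fun x : measurableTypeR R => x + h : measurableTypeR R)).
rewrite -(ge0_integral_pushforward mh leb measurableT)//.
by apply: eq_measure_integral => A mA _; exact: lebesgue_pushforwardD.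
Qed.

Definition shiftv n (h : R) : 'rV[R]_n.+1 := \row_i (if i == ord0 then h else 0).

(** [rV_cons] places coordinate [ord0] in the innermost integral, so invariance on the line applies
    with the other coordinates fixed. *)
Lemma ge0_integral_rV_shift n (h : R) (f : 'rV[R]_n.+1 -> \bar R) :
  measurable_fun setT f -> (forall x, 0 <= f x)%E ->
  (\int[lebesgue_rV n.+1]_x f (x + shiftv n h)%R = \int[lebesgue_rV n.+1]_x f x)%E.
Proof.
move=> mf f0.
have msh : measurable_fun setT (fun x : 'rV[R]_n.+1 => x + shiftv n h).
  apply/measurable_fun_rVP => i; under eq_fun do rewrite mxE.
  apply: measurable_funD => //; exact: measurable_rV.
rewrite (ge0_integral_rVS mf f0) (ge0_integral_rVS (measurableT_comp mf msh) (fun x => f0 _)).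
apply: eq_integral => x _.
rewrite -[RHS](@ge0_integral_shift h)//.
  apply: eq_integral => a _; congr f.
  apply/rowP => i; rewrite !mxE; case: unliftP => [j ->|->]/=; rewrite ?addr0//.
apply: measurableT_comp => //.
apply: (@measurableT_comp _ _ _ _ _ _ (@rV_cons R n)).
  exact: measurable_rV_cons.
exact: pair1_measurable.
Qed.

End lebesgue_rV_theory.

(** * Gaussian kernels *)

Section gauss1.
Context {R : realType}.
Local Notation leb := (@lebesgue_measure R).
Implicit Types (s t a b x : R).

(** The heat kernel on the line at time [s], that is the centred normal density of variance
    [2 s]. *)
Definition gauss1 s a : R := (4 * pi * s) `^ (- 2^-1) * expR (- a ^+ 2 / (4 * s)).

Lemma gauss1_ge0 s a : 0 <= gauss1 s a.
Proof. by rewrite mulr_ge0 ?powR_ge0 ?expR_ge0. Qed.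

Lemma measurable_gauss1 s : measurable_fun setT (gauss1 s).
Proof.
apply: measurable_funM => //; apply: measurableT_comp => //.
apply: measurable_funM => //; apply: measurableT_comp => //.
Qed.

Lemma gauss1_normal s a x : 0 < s -> gauss1 s (a - x) = normal_pdf a (Num.sqrt (2 * s)) x.
Proof.
move=> s0; rewrite normal_pdfE; last by rewrite gt_eqF// sqrtr_gt0 mulr_gt0.
rewrite /normal_peak /normal_fun sqr_sqrtr; last by rewrite mulr_ge0// ltW.
rewrite /gauss1; congr (_ * expR _).
  rewrite powRN -[in RHS]powR12_sqrt; last first.
    by rewrite mulrn_wge0// mulr_ge0 ?pi_ge0// mulr_ge0// ltW.
  congr (_ `^ _)^-1. rewrite -mulr_natr; ring.
by rewrite -mulr_natr -sqrrN opprB; congr (- _ * _^-1); ring.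
Qed.

Lemma integral_gauss1 s a : 0 < s -> (\int[leb]_x (gauss1 s (a - x))%:E = 1)%E.
Proof.
move=> s0; under eq_integral do rewrite gauss1_normal//.
exact: integral_normal_pdf.
Qed.

Lemma gauss1N s a : gauss1 s (- a) = gauss1 s a.
Proof. by rewrite /gauss1 sqrrN. Qed.

(** Completing the square in [x]: the second factor is again a kernel, at time [s t / (s + t)], and
    integrates to 1 in [gauss1_semigroup]. *)
Lemma gauss1M s t a b x : 0 < s -> 0 < t ->
  gauss1 s (a - x) * gauss1 t (x - b) =
  gauss1 (s + t) (a - b) * gauss1 (s * t / (s + t)) ((t * a + s * b) / (s + t) - x).
Proof.
move=> s0 t0; rewrite /gauss1.
have st0 : 0 < s + t by rewrite addr_gt0.
have pi0 := @pi_gt0 R.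
have p4 (u : R) : 0 < u -> 0 <= 4 * pi * u by move=> u0; apply: ltW; apply: mulr_gt0 => //; apply: mulr_gt0.
have stt : 0 < s * t / (s + t) by rewrite divr_gt0// mulr_gt0.
rewrite mulrACA -expRD [RHS]mulrACA -expRD -!powRM ?p4//.
congr (_ `^ _ * expR _); field; rewrite ?gt_eqF//.
Qed.

Lemma gauss1_semigroup s t a b : 0 < s -> 0 < t ->
  (\int[leb]_x (gauss1 s (a - x) * gauss1 t (x - b))%:E = (gauss1 (s + t) (a - b))%:E)%E.
Proof.
move=> s0 t0; under eq_integral do rewrite gauss1M// EFinM.
have ? : 0 < s * t / (s + t) by rewrite divr_gt0 ?mulr_gt0 ?addr_gt0.
rewrite ge0_integralZl//; first by rewrite integral_gauss1// mule1.
- apply/measurable_EFinP.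
  apply: (@measurableT_comp _ _ _ _ _ _ (gauss1 (s * t / (s + t)))).
    exact: measurable_gauss1.
  exact: measurable_funB.
- by move=> x _; rewrite lee_fin gauss1_ge0.
- by rewrite lee_fin gauss1_ge0.
Qed.

(** * Fourier transform of the Gaussian on the line *)

Section gauss_fourier.
Variables (s : R) (s0 : 0 < s).
Let w x : R := expR (- (s * x ^+ 2)).

Let mw : measurable_fun setT w.
Proof. by apply: measurableT_comp => //; apply: measurableT_comp => //; apply: measurable_funM. Qed.

Let w_gauss1 x : w x = Num.sqrt (pi / s) * gauss1 (4 * s)^-1 (0 - x).
Proof.
rewrite /gauss1 /w powRN powR12_sqrt; last by rewrite !mulr_ge0 ?pi_ge0 ?invr_ge0 ?mulr_ge0 ?ltW.
rewrite (_ : 4 * pi * (4 * s)^-1 = pi / s); last by field; rewrite gt_eqF.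
rewrite [RHS]mulrA divff ?mul1r; last by rewrite gt_eqF// sqrtr_gt0 divr_gt0 ?pi_gt0.
by congr expR; field; rewrite gt_eqF.
Qed.

Lemma int_gauss_weight : (\int[leb]_x (w x)%:E = (Num.sqrt (pi / s))%:E)%E.
Proof.
under eq_integral do rewrite w_gauss1 EFinM.
rewrite ge0_integralZl//; first by rewrite integral_gauss1 ?mule1// invr_gt0 mulr_gt0.
- apply/measurable_EFinP; apply: (@measurableT_comp _ _ _ _ _ _ (gauss1 (4 * s)^-1)).
    exact: measurable_gauss1.
  exact: measurable_funB.
- by move=> x _; rewrite lee_fin gauss1_ge0.
Qed.

Lemma integrable_gauss_weight : leb.-integrable setT (EFin \o w).
Proof.
apply/integrableP; split; first exact/measurable_EFinP.
under eq_integral do rewrite /= ger0_norm ?expR_ge0//.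
by rewrite int_gauss_weight ltry.
Qed.

End gauss_fourier.

(** Half of the exponent absorbs [|x|] through [1 + y <= exp y]. This is the dominating function for
    differentiating [cos (a x)] times the weight in [a]. *)
Lemma integrable_normr_gauss_weight s : 0 < s ->
  leb.-integrable setT (fun x => (`|x| * expR (- (s * x ^+ 2)))%:E).
Proof.
move=> s0; have s20 : 0 < s / 2 by rewrite divr_gt0.
have := @integrableZl _ _ _ leb _ measurableT (1 + 2 / s)  _ (integrable_gauss_weight s20).
have mx : measurable_fun [set: R] (fun x => `|x| * expR (- (s * x ^+ 2))).
  apply: measurable_funM => //.
  by apply: measurableT_comp => //; apply: measurableT_comp => //; apply: measurable_funM.
apply: le_integrable => //; first by move/measurable_EFinP : mx.
suff key (x : R) : `| `|x| * expR (- (s * x ^+ 2))| <= `|(1 + 2 / s) * expR (- (s / 2 * x ^+ 2))|.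
  by move=> x _; rewrite lee_fin; exact: key.
have c0 : 0 < 1 + 2 / s by rewrite addr_gt0// divr_gt0.
rewrite !normrM normr_id !(ger0_norm (expR_ge0 _)) (ger0_norm (ltW c0)).
rewrite (_ : expR (- (s * x ^+ 2)) = expR (- (s / 2 * x ^+ 2)) * expR (- (s / 2 * x ^+ 2))); last first.
  by rewrite -expRD; congr expR; field.
rewrite mulrA ler_wpM2r ?expR_ge0//.
rewrite expRN ler_pdivrMr ?expR_gt0//.
(* With the factor [1 + 2 / s] the product contains [1 + x^2], which exceeds [|x|]. *)
apply: (@le_trans _ _ ((1 + 2 / s) * (1 + s / 2 * x ^+ 2))); last first.
  by rewrite ler_wpM2l ?expR_ge1Dx// ltW.
have -> : (1 + 2 / s) * (1 + s / 2 * x ^+ 2) = 1 + x ^+ 2 + (2 / s + s / 2 * x ^+ 2) by field; rewrite gt_eqF.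
rewrite -real_normK ?num_real//.
have : 0 <= 2 / s + s / 2 * `|x| ^+ 2.
  by apply: addr_ge0; [exact: divr_ge0 (ler0n _ _) (ltW s0) | exact: mulr_ge0 (ltW s20) (sqr_ge0 _)].
have := sqr_ge0 (`|x| - 1); have := normr_ge0 x; nra.
Qed.

Section gauss_cos.
Variables (s : R) (s0 : 0 < s).
Let w x : R := expR (- (s * x ^+ 2)).
Let mw : measurable_fun setT w.
Proof. by apply: measurableT_comp => //; apply: measurableT_comp => //; apply: measurable_funM. Qed.

Let mcos a : measurable_fun [set: R] (fun x => cos (a * x)).
Proof.
apply: measurableT_comp; first by apply: continuous_measurable_fun; exact: continuous_cos.
exact: measurable_funM.
Qed.

Let msin a : measurable_fun [set: R] (fun x => sin (a * x)).
Proof.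
apply: measurableT_comp; first by apply: continuous_measurable_fun; exact: continuous_sin.
exact: measurable_funM.
Qed.

Lemma integrable_cos_gauss a : leb.-integrable setT (fun x => (cos (a * x) * w x)%:E).
Proof.
apply: le_integrable (integrable_gauss_weight s0) => //.
  have : measurable_fun [set: R] (fun x => cos (a * x) * w x) by exact: (measurable_funM (mcos a) mw).
  by move/measurable_EFinP.
move=> x _ /=; rewrite lee_fin normrM ler_piMl//.
by rewrite ler_norml cos_le1 cos_geN1.
Qed.

Lemma integrable_sin_gauss a : leb.-integrable setT (fun x => (sin (a * x) * w x)%:E).
Proof.
apply: le_integrable (integrable_gauss_weight s0) => //.
  have : measurable_fun [set: R] (fun x => sin (a * x) * w x) by exact: (measurable_funM (msin a) mw).
  by move/measurable_EFinP.
move=> x _ /=; rewrite lee_fin normrM ler_piMl//.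
by rewrite ler_norml sin_le1 sin_geN1.
Qed.

Lemma integrable_xsin_gauss a : leb.-integrable setT (fun x => (x * sin (a * x) * w x)%:E).
Proof.
apply: le_integrable (integrable_normr_gauss_weight s0) => //.
  have : measurable_fun [set: R] (fun x => x * sin (a * x) * w x).
    by apply: measurable_funM => //; apply: measurable_funM.
  by move/measurable_EFinP.
move=> x _ /=; rewrite lee_fin !normrM normr_id ler_wpM2r// ler_piMr//.
by rewrite ler_norml sin_le1 sin_geN1.
Qed.

(* [Phi' a = - a / (2 s) * Phi a], by differentiating under the integral and
   integrating by parts. *)
Let Phi a : R := (\int[leb]_x (cos (a * x) * w x))%R.

Lemma is_derive_sin_gauss a x : is_derive x 1 (fun x => sin (a * x) * w x)
  ((a * cos (a * x) - 2 * s * (x * sin (a * x))) * w x).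
Proof.
apply: trigger_derive.
rewrite /w /= /GRing.scale/=; ring.
Qed.

Lemma Phi_deriv a : is_derive a 1 Phi (- \int[leb]_x (x * sin (a * x) * w x)).
Proof.
have dcos x (b : R) : is_derive b 1 (fun b => cos (b * x) * w x) (- (x * sin (b * x) * w x)).
  apply: trigger_derive; rewrite /w /= /GRing.scale/=; ring.
have h1 : forall b, `](a - 1), (a + 1)[%classic b -> leb.-integrable setT (EFin \o (fun x => cos (b * x) * w x)).
  by move=> b _; exact: integrable_cos_gauss.
have aI : `](a - 1), (a + 1)[%classic a.
  by rewrite /= in_itv/=; apply/andP; split; lra.
have h2 : forall b x, `](a - 1), (a + 1)[%classic b -> setT x -> derivable (fun b => cos (b * x) * w x) b 1.
  by move=> b x _ _; exact: ex_derive.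
have h3 : forall b x, `](a - 1), (a + 1)[%classic b -> setT x -> 
   `|partial1of2 (fun b x => cos (b * x) * w x) b x| <= `|x| * w x.
  move=> b x _ _; rewrite partial1of2E derive_val normrN !normrM (ger0_norm (expR_ge0 _)).
  by rewrite ler_wpM2r ?expR_ge0// ler_piMr// ler_norml sin_le1 sin_geN1.
have h0 x : 0 <= `|x| * w x by rewrite mulr_ge0 ?expR_ge0.
have D := derivable_under_integral measurableT aI h1 h2 h0 (integrable_normr_gauss_weight s0) h3.
have E := differentiation_under_integral measurableT aI h1 h2 h0 (integrable_normr_gauss_weight s0) h3.
apply: DeriveDef; first exact: D.
rewrite -derive1E E.
rewrite -mulN1r -RintegralZl//; last exact: integrable_xsin_gauss.
apply: eq_Rintegral => x _; rewrite partial1of2E derive_val; ring.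
Qed.

Let int_dG a : leb.-integrable setT (fun x => ((a * cos (a * x) - 2 * s * (x * sin (a * x))) * w x)%:E).
Proof.
apply: eq_integrable (integrableB measurableT (integrableZl measurableT a (integrable_cos_gauss a)) (integrableZl measurableT (2 * s) (integrable_xsin_gauss a))) => //.
by move=> x _ /=; rewrite -!EFinM -EFinB; congr (_%:E); ring.
Qed.

Let w_cvg0 : w n%:R @[n --> \oo] --> (0 : R).
Proof.
suff h : (s * n%:R ^+ 2 : R) @[n --> \oo] --> +oo by exact: (cvg_comp _ _ h (@cvgr_expR R)).
have /cvgryPge h2 : (n%:R ^+ 2 : R) @[n --> \oo] --> +oo.
  exact: (cvg_comp (fun n : nat => n%:R : R) (fun x : R => x ^+ 2) cvgr_idn cvgr_expr2).
apply/cvgryPge => A; apply: filterS (h2 (A / s)) => n.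
by rewrite ler_pdivrMr// mulrC.
Qed.

Let cvg_integral_itv (h : R -> R) : leb.-integrable setT (EFin \o h) ->
  (\int[leb]_(x in `[(- n.+1%:R)%R, n.+1%:R]%classic) (h x)%:E)%E @[n --> \oo] -->
  (\int[leb]_x (h x)%:E)%E.
Proof.
move=> ih.
have mA (n : nat) : measurable (`[(- n.+1%:R)%R, n.+1%:R]%classic : set R) by [].
pose h_ (n : nat) := (EFin \o h) \_ (`[(- n.+1%:R)%R, n.+1%:R]%classic : set R).
rewrite (_ : (fun n : nat => _) = (fun n => \int[leb]_x h_ n x)%E); last first.
  by apply/funext => n; rewrite integral_mkcond.
apply: (@dominated_cvg _ _ _ leb setT _ h_ (EFin \o h) (abse \o (EFin \o h))) => //.
- move=> n; apply/(measurable_restrictT _ (mA n)).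
  apply: measurable_funTS; exact: measurable_int ih.
- move=> x _; apply: cvg_near_cst.
  near=> n; rewrite /h_ /patch ifT// inE/= in_itv/= -ler_norml.
  rewrite (@le_trans _ _ n%:R)//; last by rewrite ler_nat.
  near: n; exact: nbhs_infty_ger.
- exact: integrable_abse.
- move=> n x _; rewrite /h_ /patch; case: ifP => // _.
  by rewrite abse0 abse_ge0.
Unshelve. all: by end_near. Qed.

(** The integrand is the derivative of [sin (a x) w x], which tends to 0 at both ends; dominated
    convergence identifies the limit over growing intervals with the full integral. *)
Lemma gauss_by_parts a : \int[leb]_x ((a * cos (a * x) - 2 * s * (x * sin (a * x))) * w x) = 0.
Proof.
set dG := fun x => _; pose G x := sin (a * x) * w x.
(* [n.+1] keeps the interval nondegenerate, as the fundamental theorem of calculus asks. *)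
pose A n := `[(- n.+1%:R : R), n.+1%:R]%classic.
have FTC n : (\int[leb]_(x in A n) (dG x)%:E = (G n.+1%:R - G (- n.+1%:R))%:E)%E.
  rewrite EFinB; apply: continuous_FTC2.
  - by rewrite (@lt_trans _ _ 0)// ?oppr_lt0.
  - apply: continuous_subspaceT => x.
    apply: differentiable_continuous; apply/derivable1_diffP; rewrite /dG /w. exact: ex_derive.
  - split.
    + by move=> x _; have := is_derive_sin_gauss a x => ?; exact: ex_derive.
    + apply: cvg_at_right_filter; apply: differentiable_continuous; apply/derivable1_diffP.
      by have := is_derive_sin_gauss a (- n.+1%:R) => ?; exact: ex_derive.
    + apply: cvg_at_left_filter; apply: differentiable_continuous; apply/derivable1_diffP.
      by have := is_derive_sin_gauss a n.+1%:R => ?; exact: ex_derive.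
  - by move=> x _; rewrite derive1E; have := is_derive_sin_gauss a x => ?; rewrite derive_val.
have c1 := cvg_integral_itv (int_dG a).
have c2 : (\int[leb]_(x in A n) (dG x)%:E)%E @[n --> \oo] --> 0%E.
  under eq_fun do rewrite FTC.
  apply: cvg_EFin; first exact: nearW.
  apply/norm_cvg0P.
  have w2 : w (n.+1%:R) + w (n.+1%:R) @[n --> \oo] --> (0 : R).
    rewrite -[X in _ --> X]addr0.
    have : w n.+1%:R @[n --> \oo] --> (0 : R) by have := w_cvg0; rewrite -(cvg_shiftS (fun n => w n%:R)).
    by move=> ?; exact: cvgD.
  apply: (@squeeze_cvgr _ _ _ _ (fun=> 0) (fun n : nat => w (n.+1%:R) + w (n.+1%:R))) => //.
    apply: nearW => n /=; rewrite normr_ge0/= (le_trans (ler_normB _ _))//.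
    have Gw x : `|G x| <= w x.
      by rewrite /G normrM (ger0_norm (expR_ge0 _)) ler_piMl ?expR_ge0// ler_norml sin_le1 sin_geN1.
    by apply: lerD; rewrite (le_trans (Gw _))// /w sqrrN.
  exact: cvg_cst.
by rewrite /Rintegral (cvg_unique _ c1 c2).
Qed.

Lemma integral_cos_gauss a :
  \int[leb]_x (cos (a * x) * w x) = Num.sqrt (pi / s) * expR (- a ^+ 2 / (4 * s)).
Proof.
have D b : is_derive b 1 Phi (- (b / (2 * s)) * Phi b).
  suff -> : - (b / (2 * s)) * Phi b = - \int[leb]_x (x * sin (b * x) * w x) by exact: Phi_deriv.
  have := gauss_by_parts b.
  under eq_Rintegral do rewrite mulrBl -[b * _ * _]mulrA -[2 * s * _ * _]mulrA.
  rewrite RintegralB//; last 2 first.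
  - exact: (integrableZl measurableT b (integrable_cos_gauss b)).
  - exact: (integrableZl measurableT (2 * s) (integrable_xsin_gauss b)).
  rewrite RintegralZl//; last exact: integrable_cos_gauss.
  rewrite RintegralZl//; last exact: integrable_xsin_gauss.
  rewrite -/(Phi b) => /eqP; rewrite subr_eq0 => /eqP e.
  by rewrite mulNr -mulrA mulrCA mulrC e; field; rewrite gt_eqF.
(* An integrating factor: the differential equation for [Phi] makes [H] constant, and [H 0] is the
   Gaussian integral. *)
pose H b := Phi b * expR (b ^+ 2 / (4 * s)).
have dH b : is_derive b 1 H 0.
  have := D b => Db.
  apply: trigger_derive; rewrite /GRing.scale/=; field; by rewrite gt_eqF.
have HE : H a = H 0 by exact: is_derive_0_is_cst.
have H0 : H 0 = Num.sqrt (pi / s).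
  rewrite /H expr0n mul0r expR0 mulr1 /Phi.
  under eq_Rintegral do rewrite mul0r cos0 mul1r.
  by rewrite /Rintegral int_gauss_weight.
rewrite -H0 -HE /H -mulrA -expRD mulNr subrr expR0 mulr1//.
Qed.

End gauss_cos.
End gauss1.

(** * The heat kernel in dimension n *)

Section heat_kernel.
Context {R : realType}.
Local Notation leb := (@lebesgue_measure R).
Local Notation mu n := (@lebesgue_rV R n).
Implicit Types (s t : R).

Lemma measurable_dotrV d (T : measurableType d) n (f g : T -> 'rV[R]_n) :
  measurable_fun setT f -> measurable_fun setT g ->
  measurable_fun setT (fun x => dotrV (f x) (g x)).
Proof.
move=> /measurable_fun_rVP mf /measurable_fun_rVP mg.
by apply: measurable_sum => i; exact: measurable_funM.
Qed.

Lemma measurable_rVD d (T : measurableType d) n (f g : T -> 'rV[R]_n) :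
  measurable_fun setT f -> measurable_fun setT g ->
  measurable_fun setT (fun x => f x + g x).
Proof.
move=> /measurable_fun_rVP mf /measurable_fun_rVP mg.
apply/measurable_fun_rVP => i; under eq_fun do rewrite mxE.
exact: measurable_funD.
Qed.

Lemma measurable_rVB d (T : measurableType d) n (f g : T -> 'rV[R]_n) :
  measurable_fun setT f -> measurable_fun setT g ->
  measurable_fun setT (fun x => f x - g x).
Proof.
move=> /measurable_fun_rVP mf /measurable_fun_rVP mg.
apply/measurable_fun_rVP => i; under eq_fun do rewrite !mxE.
exact: measurable_funB.
Qed.

Lemma measurable_funV d (T : measurableType d) (f : T -> R) :
  measurable_fun setT f -> measurable_fun setT (fun x => (f x)^-1).
Proof.
move=> mf.
(* At a zero of [f] both sides vanish because of the factor [f x], so the power [-1] can be used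
   everywhere. *)
rewrite (_ : (fun _ => _) = (fun x => f x * (f x ^+ 2) `^ (-1))).
  apply: measurable_funM => //.
  apply: (measurableT_comp (measurable_powR _)); exact: measurable_funX.
apply/funext => x; have [->|fx0] := eqVneq (f x) 0; first by rewrite invr0 mul0r.
by rewrite powR_inv1 ?sqr_ge0// -exprVn expr2 mulrA divff// mul1r.
Qed.

Lemma sqnormrV_ge0 n (x : 'rV[R]_n) : 0 <= sqnormrV x.
Proof. by apply: sumr_ge0 => i _; rewrite -expr2 sqr_ge0. Qed.

Lemma sqnormrVN n (x : 'rV[R]_n) : sqnormrV (- x) = sqnormrV x.
Proof. by apply: eq_bigr => i _; rewrite !mxE mulrNN. Qed.

Definition heatK n s (z : 'rV[R]_n) : R :=
  (4 * pi * s) `^ (- (n%:R / 2)) * expR (- sqnormrV z / (4 * s)).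

Lemma heatK_ge0 n s (z : 'rV[R]_n) : 0 <= heatK s z.
Proof. by rewrite mulr_ge0 ?powR_ge0 ?expR_ge0. Qed.

Lemma heatK_le n s (z : 'rV[R]_n) : 0 < s -> heatK s z <= (4 * pi * s) `^ (- (n%:R / 2)).
Proof.
move=> s0; rewrite ler_piMr ?powR_ge0// -[leRHS]expR0 ler_expR.
by rewrite mulNr oppr_le0 divr_ge0 ?sqnormrV_ge0// mulr_ge0// ltW.
Qed.

Lemma heatKN n s (z : 'rV[R]_n) : heatK s (- z) = heatK s z.
Proof. by rewrite /heatK sqnormrVN. Qed.

Lemma heatKC n s (x y : 'rV[R]_n) : heatK s (x - y) = heatK s (y - x).
Proof. by rewrite -heatKN opprB. Qed.

Lemma heatK_prod n s (z : 'rV[R]_n) : 0 < s ->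
  heatK s z = \prod_(i < n) gauss1 s (z ord0 i).
Proof.
move=> s0; rewrite /heatK /gauss1 big_split/= -expR_sum; congr (_ * expR _).
  by rewrite prodr_const card_ord -powR_mulrn ?powR_ge0// -powRrM; congr (_ `^ _); field.
rewrite /sqnormrV /dotrV -sumrN mulr_suml; apply: eq_bigr => i _.
by rewrite expr2.
Qed.

Lemma measurable_heatK d (T : measurableType d) n (f : T -> 'rV[R]_n) (g : T -> R) :
  measurable_fun setT f -> measurable_fun setT g ->
  measurable_fun setT (fun x => heatK (g x) (f x)).
Proof.
move=> mf mg; apply: measurable_funM.
  by apply: (measurableT_comp (measurable_powR _)); exact: measurable_funM.
apply: measurableT_comp => //; apply: measurable_funM.
  by apply: measurable_funN; exact: measurable_dotrV.
apply: measurable_funV; exact: measurable_funM.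
Qed.

Lemma measurable_heatKB n s (x : 'rV[R]_n) : measurable_fun setT (fun y : 'rV[R]_n => heatK s (x - y)).
Proof. by apply: measurable_heatK => //; exact: measurable_rVB. Qed.

Lemma measurable_heatKB2 n s :
  measurable_fun setT (fun p : 'rV[R]_n * 'rV[R]_n => heatK s (p.1 - p.2)).
Proof. by apply: measurable_heatK => //; exact: measurable_rVB. Qed.

Lemma heatK_semigroup n s t (x z : 'rV[R]_n) : 0 < s -> 0 < t ->
  (\int[mu n]_y (heatK s (x - y) * heatK t (y - z))%:E = (heatK (s + t) (x - z))%:E)%E.
Proof.
move=> s0 t0.
under eq_integral do rewrite !heatK_prod// -big_split/=.
under eq_integral do under eq_bigr do rewrite !mxE.
have mg i : measurable_fun [set: R] (fun a : R => gauss1 s (x ord0 i - a) * gauss1 t (a - z ord0 i)).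
  apply: measurable_funM.
    by apply: (measurableT_comp (measurable_gauss1 s)); exact: measurable_funB.
  by apply: (measurableT_comp (measurable_gauss1 t)); exact: measurable_funB.
rewrite (integral_rV_prod mg); last by move=> i a; rewrite mulr_ge0 ?gauss1_ge0.
under eq_bigr do rewrite gauss1_semigroup//.
by rewrite prodEFin heatK_prod ?addr_gt0//; under [in RHS]eq_bigr do rewrite !mxE.
Qed.

Lemma integral_heatK n s (x : 'rV[R]_n) : 0 < s ->
  (\int[mu n]_y (heatK s (x - y))%:E = 1)%E.
Proof.
move=> s0.
under eq_integral do rewrite !heatK_prod//=.
under eq_integral do under eq_bigr do rewrite !mxE.
have mg i : measurable_fun [set: R] (fun a : R => gauss1 s (x ord0 i - a)).
  by apply: (measurableT_comp (measurable_gauss1 s)); exact: measurable_funB.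
rewrite (integral_rV_prod mg); last by move=> i a; rewrite gauss1_ge0.
by rewrite big1// => i _; rewrite integral_gauss1.
Qed.

(** By the parallelogram identity the geometric mean of two translated kernels is the kernel at the
    midpoint times a damping factor. Once integrated, that factor is the Hellinger affinity of the
    two Gaussians. *)
Lemma heatK_mid n s (z w : 'rV[R]_n) : 0 < s ->
  heatK s (z + w) * heatK s z =
  (heatK s (z + 2^-1 *: w) * expR (- sqnormrV w / (16 * s))) ^+ 2.
Proof.
move=> s0; rewrite /heatK mulrACA.
suff -> : expR (- sqnormrV (z + w) / (4 * s)) * expR (- sqnormrV z / (4 * s)) =
  (expR (- sqnormrV (z + 2^-1 *: w) / (4 * s)) * expR (- sqnormrV w / (16 * s))) ^+ 2 by ring.
rewrite -!expRD -expRM_natl; congr expR.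
have -> : sqnormrV (z + 2^-1 *: w) = (sqnormrV (z + w) + sqnormrV z) / 2 - sqnormrV w / 4.
  rewrite /sqnormrV /dotrV -big_split/= !mulr_suml -sumrB; apply: eq_bigr => i _.
  by rewrite !mxE; field.
by field; rewrite gt_eqF.
Qed.

Lemma integrable_heatK n s (x : 'rV[R]_n) : 0 < s ->
  (mu n).-integrable setT (fun y => (heatK s (x - y))%:E).
Proof.
move=> s0; apply/integrableP; split.
  by apply/measurable_EFinP; exact: measurable_heatKB.
under eq_integral do rewrite /= ger0_norm ?heatK_ge0//.
by rewrite integral_heatK// ltry.
Qed.

(* |p - q| = |sqrt p - sqrt q| (sqrt p + sqrt q), and sqrt (p q) is an explicit
   multiple of the kernel at the midpoint. *)
Lemma heatK_diff_le n s (z w : 'rV[R]_n) (l : R) : 0 < s -> 0 < l ->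
  `|heatK s (z + w) - heatK s z| <=
  (l / 2 + (2 * l)^-1) * (heatK s (z + w) + heatK s z)
  - (l - l^-1) * (expR (- sqnormrV w / (16 * s)) * heatK s (z + 2^-1 *: w)).
Proof.
move=> s0 l0; have := heatK_mid z w s0.
set p := heatK s (z + w); set q := heatK s z; set m := _ * expR _ => pq.
have p0 : 0 <= p by exact: heatK_ge0.
have q0 : 0 <= q by exact: heatK_ge0.
have m0 : 0 <= m by rewrite mulr_ge0 ?heatK_ge0 ?expR_ge0.
rewrite [_ * heatK _ _]mulrC -/m.
have -> : p = Num.sqrt p ^+ 2 by rewrite sqr_sqrtr.
have -> : q = Num.sqrt q ^+ 2 by rewrite sqr_sqrtr.
have -> : m = Num.sqrt p * Num.sqrt q by rewrite -sqrtrM// pq sqrtr_sqr ger0_norm.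
move: (Num.sqrt p) (Num.sqrt q) (sqrtr_ge0 p) (sqrtr_ge0 q) => P Q P0 Q0.
rewrite subr_sqr normrM (ger0_norm (addr_ge0 P0 Q0)).
have -> : (l / 2 + (2 * l)^-1) * (P ^+ 2 + Q ^+ 2) - (l - l^-1) * (P * Q) =
  (l * (P - Q) ^+ 2 + l^-1 * (P + Q) ^+ 2) / 2 by field; rewrite gt_eqF.
rewrite -(real_normK (num_real (P - Q))).
move: (`|P - Q|) (normr_ge0 (P - Q)) => d d0.
rewrite -subr_ge0.
have -> : (l * d ^+ 2 + l^-1 * (P + Q) ^+ 2) / 2 - d * (P + Q) = l * (d - l^-1 * (P + Q)) ^+ 2 / 2.
  by field; rewrite gt_eqF.
by rewrite divr_ge0// mulr_ge0 ?sqr_ge0// ltW.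
Qed.

(** Only total masses survive the integration of [heatK_diff_le], leaving [l (1 - e) + (1 + e) / l]
    with [e] the damping factor. Bounding [1 - e] by [|w|^2 / (16 s)] and optimising [l] gives the
    square root. *)
Lemma integral_heatK_diff n s (x w : 'rV[R]_n) : 0 < s ->
  (\int[mu n]_y `|heatK s (x + w - y) - heatK s (x - y)|%:E <=
   (Num.sqrt (sqnormrV w / (2 * s)))%:E)%E.
Proof.
move=> s0.
set N := sqnormrV w.
have N0 : 0 <= N by exact: sqnormrV_ge0.
have mK v : measurable_fun setT (fun y : 'rV[R]_n => (heatK s (v - y))%:E).
  by apply/measurable_EFinP; exact: measurable_heatKB.
suff H l : 0 < l -> (\int[mu n]_y `|heatK s (x + w - y) - heatK s (x - y)|%:E <=
   (l * (N / (16 * s)) + 2 * l^-1)%:E)%E.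
  (* For [w = 0] the optimal [l] is infinite; finite values give every positive upper bound. *)
  have [N00|N1] := eqVneq N 0.
    rewrite N00 mul0r sqrtr0; apply/lee_addgt0Pr => e e0; rewrite add0e.
    have e20 : 0 < 2 / e by rewrite divr_gt0.
    have := H (2 / e) e20; rewrite N00 mul0r mulr0 add0r invf_div mulrCA.
    by rewrite divff ?mulr1// pnatr_eq0.
  have {}N1 : 0 < N by rewrite lt_def N1.
  have r0 : 0 < N / (2 * s) by rewrite divr_gt0// mulr_gt0.
  (* This [l] makes both terms equal to half of the target. *)
  apply: le_trans (H (4 / Num.sqrt (N / (2 * s))) _) _; first by rewrite divr_gt0// sqrtr_gt0.
  rewrite lee_fin.
  have -> : N / (16 * s) = (Num.sqrt (N / (2 * s))) ^+ 2 / 8.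
    by rewrite sqr_sqrtr; [field; rewrite gt_eqF|exact: ltW].
  have := sqrtr_gt0 (N / (2 * s)); rewrite r0.
  move: (Num.sqrt _) => r r1.
  by rewrite le_eqVlt; apply/orP; left; apply/eqP; field; rewrite gt_eqF.
move=> l0.
pose e := expR (- N / (16 * s)).
have e1 : 1 - e <= N / (16 * s).
  by rewrite lerBlDr -lerBlDl /e mulNr expR_ge1Dx.
have e2 : e <= 1 by rewrite -[leRHS]expR0 ler_expR mulNr oppr_le0 divr_ge0// mulr_ge0// ltW.
have e0 : 0 <= e by exact: expR_ge0.
apply: (@le_trans _ _ (\int[mu n]_y ((l / 2 + (2 * l)^-1) * (heatK s (x + w - y) + heatK s (x - y))
  - (l - l^-1) * (e * heatK s (x + 2^-1 *: w - y)))%:E)%E).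
  apply: ge0_le_integral => //.
  - apply/measurable_EFinP; apply: measurableT_comp => //.
    by apply: measurable_funB; exact: measurable_heatKB.
  - apply/measurable_EFinP; apply: measurable_funB; apply: measurable_funM => //.
      by apply: measurable_funD; exact: measurable_heatKB.
    by apply: measurable_funM => //; exact: measurable_heatKB.
  - move=> y _; rewrite lee_fin.
    by have := heatK_diff_le (x - y) w s0 l0; rewrite ![_ - y + _]addrAC.
rewrite (_ : (fun y => _) = (fun y => ((l / 2 + (2 * l)^-1)%:E * ((heatK s (x + w - y))%:E + (heatK s (x - y))%:E)
  - (l - l^-1)%:E * (e%:E * (heatK s (x + 2^-1 *: w - y))%:E))%E)); last first.
  by apply/funext => y; rewrite EFinB !EFinM EFinD.
have iK v := integrable_heatK v s0.
rewrite integralB//; last 2 first.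
- by apply: integrableZl => //; exact: integrableD.
- by apply: integrableZl => //; exact: integrableZl.
rewrite integralZl//; last exact: integrableD.
rewrite integralD// integralZl//; last exact: integrableZl.
rewrite integralZl// !integral_heatK// mule1.
rewrite [X in (X <= _)%E](_ : _ = ((l / 2 + (2 * l)^-1) * (1 + 1) - (l - l^-1) * e)%:E)// lee_fin.
have -> : (l / 2 + (2 * l)^-1) * (1 + 1) - (l - l^-1) * e = l * (1 - e) + l^-1 * (1 + e) by field; rewrite gt_eqF.
apply: lerD; first by rewrite ler_wpM2l// ltW.
by rewrite [leRHS]mulrC ler_wpM2l ?invr_ge0 ?(ltW l0)//; lra.
Qed.

(** Oddness. Adding 1 to the sine gives a nonnegative integrand, for which the reflection [x -> - x]
    is a change of variables; the Gaussian part then cancels. *)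
Lemma integral_sin_gauss s (a : R) : 0 < s ->
  \int[leb]_x (sin (a * x) * expR (- (s * x ^+ 2))) = 0.
Proof.
move=> s0; set I := Rintegral _ _ _.
have is_ := integrable_sin_gauss s0; have iw := integrable_gauss_weight s0.
have E (b : R) : b = a \/ b = - a -> (\int[leb]_x ((1 + sin (b * x)) * expR (- (s * x ^+ 2)))%:E =
    (\int[leb]_x expR (- (s * x ^+ 2)))%:E + (\int[leb]_x (sin (b * x) * expR (- (s * x ^+ 2))))%:E)%E.
  move=> _; under eq_integral do rewrite mulrDl mul1r EFinD.
  rewrite integralD// /Rintegral !fineK//; exact: integrable_fin_num.
have mh : measurable_fun setT (-%R : measurableTypeR R -> measurableTypeR R) by exact: oppr_measurable.
have refl (f : R -> \bar R) : measurable_fun setT f -> (forall x, 0 <= f x)%E ->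
    (\int[leb]_x f (- x)%R = \int[leb]_x f x)%E.
  move=> mf f0; rewrite -[in LHS](preimage_setT (-%R : measurableTypeR R -> measurableTypeR R)).
  rewrite -(ge0_integral_pushforward mh leb measurableT)//.
  by apply: eq_measure_integral => A mA _; exact: lebesgue_measureN.
have : (\int[leb]_x ((1 + sin (a * x)) * expR (- (s * x ^+ 2)))%:E =
        \int[leb]_x ((1 + sin (- a * x)) * expR (- (s * x ^+ 2)))%:E)%E.
  rewrite -(refl (fun x => ((1 + sin (a * x)) * expR (- (s * x ^+ 2)))%:E)).
  - by apply: eq_integral => x _; rewrite sqrrN mulrN mulNr.
  - apply/measurable_EFinP; apply: measurable_funM.
      apply: measurable_funD => //; apply: (@measurableT_comp _ _ _ _ _ _ (@sin R)).
        by apply: continuous_measurable_fun; exact: continuous_sin.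
      exact: measurable_funM.
    apply: measurableT_comp => //; apply: measurable_funN; exact: measurable_funM.
  - by move=> x; rewrite lee_fin mulr_ge0 ?expR_ge0// -lerBlDl sub0r sin_geN1.
rewrite !E; [|by right|by left].
rewrite -!EFinD => -[] /addrI; rewrite -/I.
have -> : \int[leb]_x (sin (- a * x) * expR (- (s * x ^+ 2))) = - I.
  rewrite /I -[RHS]mulN1r -RintegralZl//; last exact: is_.
  by apply: eq_Rintegral => x _; rewrite mulNr sinN mulN1r mulNr.
by move: I => J JN; lra.
Qed.

(** The phase [th] stands for the other coordinates in the induction on the dimension, and the
    summand 1 keeps the integrand nonnegative so that Tonelli applies there. *)
Lemma integral_cos_phase1 s (th b : R) : 0 < s ->
  (\int[leb]_x ((1 + cos (th + b * x)) * expR (- (s * x ^+ 2)))%:E =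
   (Num.sqrt (pi / s) * (1 + cos th * expR (- b ^+ 2 / (4 * s))))%:E)%E.
Proof.
move=> s0.
have is_ := integrable_sin_gauss s0 b; have ic := integrable_cos_gauss s0 b.
have iw := integrable_gauss_weight s0.
under eq_integral.
  move=> x _; rewrite cosD (_ : (1 + _) * _ = expR (- (s * x ^+ 2)) +
    (cos th * (cos (b * x) * expR (- (s * x ^+ 2))) - sin th * (sin (b * x) * expR (- (s * x ^+ 2))))); last by ring.
  rewrite EFinD EFinB (EFinM (cos th)) (EFinM (sin th)). over.
rewrite integralD//; last first.
  by apply: integrableB => //; exact: integrableZl.
rewrite integralB//; [|exact: integrableZl|exact: integrableZl].
rewrite !integralZl// int_gauss_weight//.
have -> : (\int[leb]_x (cos (b * x) * expR (- (s * x ^+ 2)))%:E = (Num.sqrt (pi / s) * expR (- b ^+ 2 / (4 * s)))%:E)%E.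
  by rewrite -integral_cos_gauss// /Rintegral fineK//; exact: integrable_fin_num.
have -> : (\int[leb]_x (sin (b * x) * expR (- (s * x ^+ 2)))%:E = 0)%E.
  have := integrable_fin_num measurableT is_; have := integral_sin_gauss b s0.
  by rewrite /Rintegral; case: (integral _ _ _) => //= r ->.
by rewrite mule0 sube0 -EFinM -EFinD; congr (_%:E); ring.
Qed.

(** On the Fourier side this is the multiplier of the heat semigroup at time [s]. *)
Definition gaussW n s (x : 'rV[R]_n) : R := expR (- (s * sqnormrV x)).

Lemma gaussW_ge0 n s (x : 'rV[R]_n) : 0 <= gaussW s x.
Proof. exact: expR_ge0. Qed.

Lemma measurable_gaussW n s : measurable_fun setT (@gaussW n s).
Proof.
apply: measurableT_comp => //; apply: measurable_funN; apply: measurable_funM => //.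
exact: measurable_dotrV.
Qed.

Lemma measurable_cos_dot d (T : measurableType d) n th (f g : T -> 'rV[R]_n) :
  measurable_fun setT f -> measurable_fun setT g ->
  measurable_fun setT (fun x => cos (th + dotrV (f x) (g x))).
Proof.
move=> mf mg; apply: (@measurableT_comp _ _ _ _ _ _ (@cos R)).
  by apply: continuous_measurable_fun; exact: continuous_cos.
by apply: measurable_funD => //; exact: measurable_dotrV.
Qed.

Lemma measurable_sin_dot d (T : measurableType d) n (f g : T -> 'rV[R]_n) :
  measurable_fun setT f -> measurable_fun setT g ->
  measurable_fun setT (fun x => sin (dotrV (f x) (g x))).
Proof.
move=> mf mg; apply: (@measurableT_comp _ _ _ _ _ _ (@sin R)).
  by apply: continuous_measurable_fun; exact: continuous_sin.
exact: measurable_dotrV.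
Qed.

Lemma integral_gaussW n s : 0 < s ->
  (\int[mu n]_x (gaussW s x)%:E = (Num.sqrt (pi / s) ^+ n)%:E)%E.
Proof.
move=> s0.
under eq_integral.
  move=> x _; rewrite /gaussW /sqnormrV /dotrV mulr_sumr -sumrN expR_sum. 
  under eq_bigr do rewrite -expr2. over.
rewrite (@integral_rV_prod _ _ (fun _ a => expR (- (s * a ^+ 2)))).
- under eq_bigr do rewrite int_gauss_weight//.
  by rewrite prodEFin prodr_const card_ord.
- move=> _; apply: measurableT_comp => //; apply: measurable_funN; exact: measurable_funM.
- by move=> *; exact: expR_ge0.
Qed.

Lemma integrable_gaussW n s : 0 < s -> (mu n).-integrable setT (EFin \o gaussW s).
Proof.
move=> s0; apply/integrableP; split; first by apply/measurable_EFinP; exact: measurable_gaussW.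
under eq_integral do rewrite /= ger0_norm ?gaussW_ge0//.
by rewrite integral_gaussW// ltry.
Qed.

Lemma integral_cos_phase n s (th : R) (a : 'rV[R]_n) : 0 < s ->
  (\int[mu n]_x ((1 + cos (th + dotrV a x)) * gaussW s x)%:E =
   (Num.sqrt (pi / s) ^+ n * (1 + cos th * expR (- sqnormrV a / (4 * s))))%:E)%E.
Proof.
move=> s0; elim: n th a => [|n IH] th a.
  have E (x y : 'rV[R]_0) : dotrV x y = 0 by rewrite /dotrV big_ord0.
  under eq_integral do rewrite /gaussW /sqnormrV !E mulr0 oppr0 expR0 addr0 mulr1.
  by rewrite integral_cst//= diracT mule1 expr0 /sqnormrV E oppr0 mul0r expR0 mulr1 mul1r.
pose b := a ord0 ord0; pose a' : 'rV[R]_n := \row_i a ord0 (lift ord0 i).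
have dotE x y : dotrV a (rV_cons (x, y)) = b * y + dotrV a' x.
  rewrite /dotrV big_ord_recl rV_consE0; congr (_ + _).
  by apply: eq_bigr => i _; rewrite rV_consE mxE.
have sqE (x : 'rV[R]_n) y : sqnormrV (rV_cons (x, y)) = y ^+ 2 + sqnormrV x.
  rewrite /sqnormrV /dotrV big_ord_recl rV_consE0 -expr2; congr (_ + _).
  by apply: eq_bigr => i _; rewrite rV_consE.
have aE : sqnormrV a = b ^+ 2 + sqnormrV a'.
  rewrite /sqnormrV /dotrV big_ord_recl -expr2; congr (_ + _).
  by apply: eq_bigr => i _; rewrite mxE.
have pos (u : R) : 0 <= 1 + cos u by rewrite -lerBlDl sub0r cos_geN1.
have mcosw th' k (c : 'rV[R]_k) : measurable_fun setT (fun x => ((1 + cos (th' + dotrV c x)) * gaussW s x)%:E).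
  apply/measurable_EFinP; apply: measurable_funM; last exact: measurable_gaussW.
  by apply: measurable_funD => //; exact: measurable_cos_dot.
rewrite ge0_integral_rVS; first last.
- by move=> x; rewrite lee_fin mulr_ge0 ?gaussW_ge0.
- exact: mcosw.
pose c := Num.sqrt (pi / s); pose e := expR (- b ^+ 2 / (4 * s)).
have c0 : 0 <= c by exact: sqrtr_ge0.
have e1 : e <= 1 by rewrite -[leRHS]expR0 ler_expR mulNr oppr_le0 divr_ge0 ?sqr_ge0// mulr_ge0// ltW.
have e0 : 0 <= e by exact: expR_ge0.
(* [1 + e cos] is split as [(1 - e) + e (1 + cos)]: both terms are nonnegative because
   [0 <= e <= 1], and the second one falls under the induction hypothesis. *)
transitivity (\int[mu n]_x ((c * (1 - e))%:E * (gaussW s x)%:E + (c * e)%:E * ((1 + cos (th + dotrV a' x)) * gaussW s x)%:E))%E.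
  apply: eq_integral => x _.
  transitivity (\int[leb]_y ((gaussW s x)%:E * ((1 + cos ((th + dotrV a' x) + b * y)) * expR (- (s * y ^+ 2)))%:E))%E.
    apply: eq_integral => y _; rewrite dotE /gaussW sqE mulrDr opprD expRD -EFinM; congr (_%:E).
    by rewrite (addrC (b * y)) addrA; ring.
  rewrite ge0_integralZl//; first last.
  - by rewrite lee_fin gaussW_ge0.
  - have : measurable_fun [set: R] (fun y => (1 + cos ((th + dotrV a' x) + b * y)) * expR (- (s * y ^+ 2))).
      apply: measurable_funM.
        apply: measurable_funD => //; apply: (@measurableT_comp _ _ _ _ _ _ (@cos R)).
          by apply: continuous_measurable_fun; exact: continuous_cos.
        by apply: measurable_funD => //; exact: measurable_funM.
      by apply: measurableT_comp => //; apply: measurable_funN; exact: measurable_funM.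
    by move/measurable_EFinP.
  rewrite integral_cos_phase1// -!EFinM -EFinD; congr (_%:E); rewrite -/c -/e; ring.
rewrite ge0_integralD//; first last.
- apply: emeasurable_funM => //; exact: mcosw.
- move=> x _; rewrite -EFinM lee_fin; apply: mulr_ge0; first exact: mulr_ge0.
  exact: mulr_ge0 (pos _) (gaussW_ge0 _ _).
- apply: emeasurable_funM => //; apply/measurable_EFinP; exact: measurable_gaussW.
- by move=> x _; rewrite -EFinM lee_fin mulr_ge0 ?gaussW_ge0// mulr_ge0// subr_ge0.
rewrite !ge0_integralZl//; first last.
- by rewrite lee_fin mulr_ge0// subr_ge0.
- by move=> x _; rewrite lee_fin gaussW_ge0.
- by apply/measurable_EFinP; exact: measurable_gaussW.
- by rewrite lee_fin mulr_ge0.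
- by move=> x _; rewrite lee_fin mulr_ge0 ?gaussW_ge0.
- exact: mcosw.
have -> : expR (- sqnormrV a / (4 * s)) = e * expR (- sqnormrV a' / (4 * s)).
  by rewrite /e -expRD aE; congr expR; ring.
rewrite integral_gaussW// IH -!EFinM -EFinD -/c exprS; congr (_%:E); ring.
Qed.

Lemma integrable_cos_gaussW n s (a : 'rV[R]_n) : 0 < s ->
  (mu n).-integrable setT (fun x => (cos (dotrV a x) * gaussW s x)%:E).
Proof.
move=> s0; apply: le_integrable (integrable_gaussW n s0) => //.
  apply/measurable_EFinP; apply: measurable_funM; last exact: measurable_gaussW.
  under eq_fun do rewrite -[dotrV _ _]add0r.
  exact: measurable_cos_dot.
move=> x _ /=; rewrite lee_fin normrM ler_piMl//.
by rewrite ler_norml cos_le1 cos_geN1.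
Qed.

Lemma Rintegral_cos_gaussW n s (a : 'rV[R]_n) : 0 < s ->
  \int[mu n]_x (cos (dotrV a x) * gaussW s x) =
  Num.sqrt (pi / s) ^+ n * expR (- sqnormrV a / (4 * s)).
Proof.
move=> s0; have := integral_cos_phase 0 a s0.
under eq_integral do rewrite add0r mulrDl mul1r EFinD.
rewrite integralD//; [|exact: integrable_gaussW|exact: integrable_cos_gaussW].
rewrite integral_gaussW// cos0 mul1r mulrDr mulr1 EFinD.
have := integrable_fin_num measurableT (integrable_cos_gaussW a s0).
rewrite /Rintegral; by case: (integral _ _ _) => //= r _ [] /addrI.
Qed.

End heat_kernel.

(** * Square-integrable functions *)

Section L2.
Context d (T : measurableType d) (R : realType) (mu : {measure set T -> \bar R}).
Implicit Types f g : T -> R.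

Definition sqint f : \bar R := (\int[mu]_x (f x ^+ 2)%:E)%E.

Definition isL2 f := measurable_fun setT f /\ (sqint f < +oo)%E.

(** [fine] sends an infinite integral to 0, so this is the norm only under [isL2]; [sqint] keeps
    extended values for comparisons made before finiteness is known. *)
Definition l2 f : R := Num.sqrt (fine (sqint f)).

Lemma sqint_ge0 f : (0 <= sqint f)%E.
Proof. by apply: integral_ge0 => x _; rewrite lee_fin sqr_ge0. Qed.

Lemma l2_ge0 f : 0 <= l2 f. Proof. exact: sqrtr_ge0. Qed.

Lemma measurable_sqr_EFin f : measurable_fun setT f ->
  measurable_fun setT (fun x => (f x ^+ 2)%:E).
Proof. by move=> mf; apply/measurable_EFinP; exact: measurable_funX. Qed.

Lemma sqintE f : isL2 f -> sqint f = (l2 f ^+ 2)%:E.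
Proof.
move=> [_ fy]; rewrite /l2 sqr_sqrtr ?fineK ?fine_ge0 ?sqint_ge0//.
by rewrite ge0_fin_numE// sqint_ge0.
Qed.

Lemma Lnorm2_sqint f : 'N[mu]_2%:E[EFin \o f]%E = (sqint f `^ 2^-1)%E.
Proof.
rewrite unlock; congr (_ `^ _)%E; apply: eq_integral => x _.
by rewrite /= powR_mulrn// real_normK// num_real.
Qed.

Lemma Lnorm2_l2 f : isL2 f -> 'N[mu]_2%:E[EFin \o f]%E = (l2 f)%:E.
Proof.
move=> Lf; rewrite Lnorm2_sqint sqintE// poweR_EFin powR12_sqrt ?sqr_ge0//.
by rewrite sqrtr_sqr ger0_norm ?l2_ge0.
Qed.

Lemma isL2P f : f \in Lfun mu 2%:E <-> isL2 f.
Proof.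
split=> [Lf|Lf].
  have /integrableP[_ fy] := Lfun2_integrable_sqr Lf.
  move: Lf; rewrite inE => /andP[/[!inE]/= mf _]; split => //.
  apply: le_lt_trans fy; rewrite le_eqVlt; apply/orP; left; apply/eqP.
  by apply: eq_integral => x _; rewrite /= ger0_norm// sqr_ge0.
rewrite inE; apply/andP; split; rewrite inE/=; first exact: Lf.1.
by rewrite /finite_norm Lnorm2_l2// ltry.
Qed.

Lemma isL2_le f g : measurable_fun setT f -> (forall x, `|f x| <= `|g x|) ->
  isL2 g -> isL2 f /\ l2 f <= l2 g.
Proof.
move=> mf fg Lg.
have le : (sqint f <= sqint g)%E.
  apply: ge0_le_integral => //.
  - by move=> x _; rewrite lee_fin sqr_ge0.
  - exact: measurable_sqr_EFin.
  - exact: measurable_sqr_EFin Lg.1.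
  - move=> x _; rewrite lee_fin -(real_normK (num_real (f x))) -(real_normK (num_real (g x))).
    by rewrite ler_pXn2r// nnegrE.
have Lf : isL2 f by split => //; exact: le_lt_trans le Lg.2.
split => //; move: le; rewrite !sqintE// lee_fin ler_pXn2r// nnegrE l2_ge0//.
Qed.

Lemma isL2D f g : isL2 f -> isL2 g -> isL2 (f \+ g).
Proof.
move=> Lf Lg; have mfg : measurable_fun setT (f \+ g) by exact: measurable_funD Lf.1 Lg.1.
split=> //.
apply: (@le_lt_trans _ _ (2%:E * sqint f + 2%:E * sqint g)%E); last first.
  by rewrite !sqintE// -!EFinM -EFinD ltry.
rewrite /sqint -!ge0_integralZl//; last 4 first.
- exact: measurable_sqr_EFin Lg.1.
- by move=> x _; rewrite lee_fin sqr_ge0.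
- exact: measurable_sqr_EFin Lf.1.
- by move=> x _; rewrite lee_fin sqr_ge0.
rewrite -ge0_integralD//; last 4 first.
- by move=> x _; rewrite -EFinM lee_fin mulr_ge0 ?sqr_ge0.
- by apply: emeasurable_funM => //; exact: measurable_sqr_EFin Lf.1.
- by move=> x _; rewrite -EFinM lee_fin mulr_ge0 ?sqr_ge0.
- by apply: emeasurable_funM => //; exact: measurable_sqr_EFin Lg.1.
apply: ge0_le_integral => //.
- by move=> x _; rewrite lee_fin sqr_ge0.
- exact: measurable_sqr_EFin.
- by apply: emeasurable_funD; apply: emeasurable_funM => //; [exact: measurable_sqr_EFin Lf.1|exact: measurable_sqr_EFin Lg.1].
- by move=> x _; rewrite -!EFinM -EFinD lee_fin /=; have := sqr_ge0 (f x - g x); nra.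
Qed.

Lemma isL2N f : isL2 f -> isL2 (\- f).
Proof.
move=> [mf fy]; split; first exact: measurable_funN.
by rewrite /sqint; under eq_integral do rewrite sqrrN.
Qed.

Lemma isL2B f g : isL2 f -> isL2 g -> isL2 (f \- g).
Proof. by move=> Lf Lg; exact: isL2D Lf (isL2N Lg). Qed.

Lemma l2D f g : isL2 f -> isL2 g -> l2 (f \+ g) <= l2 f + l2 g.
Proof.
move=> Lf Lg; rewrite -lee_fin EFinD -!Lnorm2_l2//; last exact: isL2D.
by apply: eminkowski; [exact: Lf.1|exact: Lg.1|rewrite lee_fin ler1n].
Qed.

Lemma l2N f : l2 (\- f) = l2 f.
Proof. by rewrite /l2 /sqint; under eq_integral do rewrite sqrrN. Qed.

Lemma l2B f g : isL2 f -> isL2 g -> l2 (f \- g) <= l2 f + l2 g.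
Proof. by move=> Lf Lg; rewrite -(l2N g); exact: l2D Lf (isL2N Lg). Qed.

Lemma integrable_sqr f : isL2 f -> mu.-integrable setT (fun x => (f x ^+ 2)%:E).
Proof.
move=> [mf fy]; apply/integrableP; split; first exact: measurable_sqr_EFin.
by under eq_integral do rewrite /= ger0_norm ?sqr_ge0//.
Qed.

Lemma l2_sqr f : isL2 f -> l2 f ^+ 2 = \int[mu]_x (f x ^+ 2).
Proof. by move=> /sqintE h; rewrite /Rintegral -[integral _ _ _]/(sqint f) h. Qed.

Lemma integrable_mul f g : isL2 f -> isL2 g -> mu.-integrable setT (fun x => (f x * g x)%:E).
Proof.
move=> Lf Lg.
apply: le_integrable (integrableD measurableT (integrable_sqr Lf) (integrable_sqr Lg)) => //.
  by apply/measurable_EFinP; apply: measurable_funM; [exact: Lf.1|exact: Lg.1].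
move=> x _; rewrite -EFinD lee_fin normrM [leRHS]ger0_norm ?addr_ge0 ?sqr_ge0//.
rewrite -(real_normK (num_real (f x))) -(real_normK (num_real (g x))).
have := sqr_ge0 (`|f x| - `|g x|); have := normr_ge0 (f x); have := normr_ge0 (g x).
move: (`|f x|) (`|g x|) => a b; nra.
Qed.

End L2.

Section Rintegral2.
Context d1 d2 (X : measurableType d1) (Y : measurableType d2) (R : realType).
Variables (m2 : {measure set Y -> \bar R}) (s2 : sigma_finite setT m2).

Lemma measurable_Rintegral2 (f : X * Y -> R) : measurable_fun [set: X * Y] f ->
  measurable_fun setT (fun x => (\int[m2]_y f (x, y))%R).
Proof.
move=> mf; apply: (@measurableT_comp _ _ _ _ _ _ fine).
  exact: fine_measurable.
under eq_fun do rewrite integralE.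
have mF : measurable_fun [set: X * Y] (EFin \o f) by exact/measurable_EFinP.
apply: emeasurable_funB.
- have h := measurable_tonelliF s2 (measurable_funepos mF) (fun z => funepos_ge0 _ z).
  by apply: eq_measurable_fun h => x _; apply: eq_integral => y _; rewrite !funeposE.
- have h := measurable_tonelliF s2 (measurable_funeneg mF) (fun z => funeneg_ge0 _ z).
  by apply: eq_measurable_fun h => x _; apply: eq_integral => y _; rewrite !funenegE.
Qed.

End Rintegral2.

(** * Schur's test for integral operators *)

Section schur.
Context d (T : measurableType d) (R : realType) (mu : {measure set T -> \bar R}).
Hypothesis sf : sigma_finite setT mu.
Variables (k : T * T -> R) (A : R).
Hypotheses (mk : measurable_fun [set: T * T] k) (A0 : 0 < A).
Hypothesis kA1 : forall x, (\int[mu]_y `|k (x, y)|%:E <= A%:E)%E.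
Hypothesis kA2 : forall y, (\int[mu]_x `|k (x, y)|%:E <= A%:E)%E.

Let mk1 x : measurable_fun setT (fun y => k (x, y)).
Proof. by apply: measurableT_comp => //; exact: pair1_measurable. Qed.

Let mk2 y : measurable_fun setT (fun x => k (x, y)).
Proof. by apply: measurableT_comp => //; exact: pair2_measurable. Qed.

Lemma kernel_cauchy_schwarz (f : T -> R) x : measurable_fun setT f ->
  mu.-integrable setT (fun y => (f y * k (x, y))%:E) ->
  (((\int[mu]_y (f y * k (x, y)))%R ^+ 2)%:E <=
   A%:E * \int[mu]_y (f y ^+ 2 * `|k (x, y)|)%:E)%E.
Proof.
move=> mf ifk; set X := Rintegral _ _ _; set F := integral _ _ _.
have F0 : (0 <= F)%E by apply: integral_ge0 => y _; rewrite lee_fin mulr_ge0 ?sqr_ge0.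
have mF : measurable_fun setT (fun y => (f y ^+ 2 * `|k (x, y)|)%:E).
  apply/measurable_EFinP; apply: measurable_funM; first exact: measurable_funX.
  exact: measurableT_comp.
have mK : measurable_fun setT (fun y => (`|k (x, y)|)%:E).
  by apply/measurable_EFinP; exact: measurableT_comp.
(* AM-GM, to be used with [l = A / |X|] *)
have key l : 0 < l -> ((2 * `|X|)%:E <= l%:E * F + (A / l)%:E)%E.
  move=> l0.
  have : (`|X|%:E <= \int[mu]_y `|f y * k (x, y)|%:E)%E.
    have -> : `|X|%:E = `| \int[mu]_y (f y * k (x, y))%:E |%E.
      by rewrite -EFin_normr_Rintegral.
    by apply: le_abse_integral => //; exact: measurable_int ifk.
  move=> h; rewrite EFinM; apply: le_trans (lee_wpmul2l _ h) _ => //.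
  rewrite -ge0_integralZl//=; last first.
    by move/measurable_int : ifk => mi; exact: (measurableT_comp (@abse_measurable _ _) mi).
  apply: (@le_trans _ _ (\int[mu]_y (l%:E * (f y ^+ 2 * `|k (x, y)|)%:E + (l^-1)%:E * `|k (x, y)|%:E))%E).
    apply: ge0_le_integral => //.
    - by apply: emeasurable_funM => //; move/measurable_int : ifk => mi; exact: (measurableT_comp (@abse_measurable _ _) mi).
    - by apply: emeasurable_funD; apply: emeasurable_funM.
    - move=> y _; rewrite -!EFinM -EFinD lee_fin normrM.
      have -> : l * (f y ^+ 2 * `|k (x, y)|) + l^-1 * `|k (x, y)| = (l * f y ^+ 2 + l^-1) * `|k (x, y)| by ring.
      rewrite mulrA ler_wpM2r// -(real_normK (num_real (f y))) -subr_ge0.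
      have -> : l * `|f y| ^+ 2 + l^-1 - 2 * `|f y| = l * (`|f y| - l^-1) ^+ 2 by field; rewrite gt_eqF.
      by rewrite mulr_ge0 ?sqr_ge0// ltW.
  have l'0 : 0 <= l^-1 by rewrite invr_ge0 ltW.
  have l00 := ltW l0.
  rewrite ge0_integralD//; first last.
  - exact: emeasurable_funM.
  - by move=> y _; rewrite -EFinM lee_fin mulr_ge0.
  - exact: emeasurable_funM.
  - by move=> y _; rewrite -EFinM lee_fin mulr_ge0// mulr_ge0 ?sqr_ge0.
  rewrite !ge0_integralZl//; last by move=> y _; rewrite lee_fin mulr_ge0 ?sqr_ge0.
  by rewrite leeD2l// mulrC EFinM lee_wpmul2l.
have [->|X0] := eqVneq X 0; first by rewrite expr0n/= mule_ge0// lee_fin ltW.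
have {}X0 : 0 < `|X| by rewrite normr_gt0.
move: key; case: F F0 => [F| |] F0 key //; last first.
  by rewrite gt0_muley ?lte_fin// leey.
have := key (A / `|X|) (divr_gt0 A0 X0).
rewrite -!EFinM -EFinD !lee_fin invf_div.
rewrite -[in X in _ -> X](real_normK (num_real X)).
move: X0; move: (`|X|) => Y Y0.
have -> : A * (Y / A) = Y by field; rewrite gt_eqF.
have -> : A / Y * F + Y = A * F / Y + Y by ring.
rewrite mulr2n mulrDl mul1r lerD2r ler_pdivlMr// => h.
Qed.

(** The row bound enters through [kernel_cauchy_schwarz] and the column bound after Tonelli; each
    gives one factor [A] in the square of the norm. *)
Lemma schur_test (f : T -> R) : isL2 mu f ->
  (forall x, mu.-integrable setT (fun y => (f y * k (x, y))%:E)) ->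
  isL2 mu (fun x => (\int[mu]_y (f y * k (x, y)))%R) /\
  l2 mu (fun x => (\int[mu]_y (f y * k (x, y)))%R) <= A * l2 mu f.
Proof.
move=> Lf ifk; have mf := Lf.1.
set Tf := fun x => _.
have mff : measurable_fun setT (fun p : T * T => f p.2).
  exact: measurableT_comp.
have mTf : measurable_fun setT Tf.
  apply: (measurable_Rintegral2 sf (f := fun p => f p.2 * k p)).
  exact: measurable_funM.
have le : (sqint mu Tf <= ((A * l2 mu f) ^+ 2)%:E)%E.
  have mF2 : measurable_fun setT (fun p : T * T => (f p.2 ^+ 2 * `|k p|)%:E).
    apply/measurable_EFinP; apply: measurable_funM; first exact: measurable_funX.
    exact: measurableT_comp.
  have F20 (p : T * T) : (0 <= (f p.2 ^+ 2 * `|k p|)%:E)%E by rewrite lee_fin mulr_ge0 ?sqr_ge0.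
  apply: (@le_trans _ _ (\int[mu]_x (A%:E * \int[mu]_y (f y ^+ 2 * `|k (x, y)|)%:E))%E).
    apply: ge0_le_integral => //.
    - by move=> x _; rewrite lee_fin sqr_ge0.
    - exact: measurable_sqr_EFin.
    - apply: emeasurable_funM => //.
      exact: (measurable_tonelliF sf mF2).
    - by move=> x _; exact: kernel_cauchy_schwarz.
  rewrite ge0_integralZl//; first last.
  - by rewrite lee_fin ltW.
  - by move=> x _; apply: integral_ge0 => y _; exact: (F20 (x, y)).
  - exact: (measurable_tonelliF sf mF2).
  rewrite (tonelli sf sf mF2)//=.
  rewrite exprMn expr2 -mulrA EFinM lee_wpmul2l ?lee_fin ?(ltW A0)//.
  rewrite EFinM -sqintE// /sqint -ge0_integralZl//; first last.
  - by rewrite lee_fin ltW.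
  - by move=> x _; rewrite lee_fin sqr_ge0.
  - exact: measurable_sqr_EFin.
  apply: ge0_le_integral => //.
  - by move=> y _; apply: integral_ge0 => x _; exact: (F20 (x, y)).
  - exact: (measurable_tonelliG sf mF2).
  - by apply: emeasurable_funM => //; exact: measurable_sqr_EFin.
  move=> y _; under eq_integral do rewrite EFinM.
  rewrite ge0_integralZl//; first last.
  - by rewrite lee_fin sqr_ge0.
  - by apply/measurable_EFinP; exact: measurableT_comp.
  by rewrite muleC lee_wpmul2r// lee_fin sqr_ge0.
have LT : isL2 mu Tf by split => //; apply: le_lt_trans le _; rewrite ltry.
split => //; move: le; rewrite sqintE// lee_fin ler_pXn2r// nnegrE ?l2_ge0//.
by rewrite mulr_ge0 ?l2_ge0// ltW.
Qed.

End schur.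

(** * The heat semigroup on L^2 *)

Section heat_operator.
Context {R : realType} {n : nat}.
Local Notation E := 'rV[R]_n.
Local Notation mu := (@lebesgue_rV R n).
Implicit Types (f g : E -> R) (s t : R).

Let sf : sigma_finite setT mu := lebesgue_rV_sigma_finite n.

Definition heat t f : E -> R := fun x => heat_flow f x t.

Lemma heatE t f x : heat t f x = \int[mu]_y (f y * heatK t (x - y)).
Proof. by apply: eq_Rintegral => y _; rewrite -mulrA. Qed.

Let mK t : measurable_fun setT (fun p : E * E => heatK t (p.1 - p.2)).
Proof. exact: measurable_heatKB2. Qed.

Let normK t (x y : E) : `|heatK t (x - y)| = heatK t (x - y).
Proof. by rewrite ger0_norm// heatK_ge0. Qed.

Lemma integral_heatK' t (y : E) : 0 < t -> (\int[mu]_x (heatK t (x - y))%:E = 1)%E.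
Proof. by move=> t0; under eq_integral do rewrite heatKC; exact: integral_heatK. Qed.

(** From [|f| <= f^2 + 1]: the kernel is bounded, which handles [f^2], and integrable, which handles
    1. This works at every [x]. *)
Lemma integrable_mul_heatK f t x : 0 < t -> isL2 mu f ->
  mu.-integrable setT (fun y => (f y * heatK t (x - y))%:E).
Proof.
move=> t0 Lf; pose C := (4 * pi * t) `^ (- (n%:R / 2)).
have i1 := integrableD measurableT (integrableZl measurableT C (integrable_sqr Lf)) (integrable_heatK x t0).
apply: le_integrable i1 => //.
  by apply/measurable_EFinP; apply: measurable_funM; [exact: Lf.1|exact: measurable_heatKB].
move=> y _; rewrite -EFinM -EFinD lee_fin normrM normK [leRHS]ger0_norm; last first.
  by rewrite addr_ge0 ?heatK_ge0// mulr_ge0 ?powR_ge0 ?sqr_ge0.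
have K0 := heatK_ge0 t (x - y).
apply: (@le_trans _ _ ((f y ^+ 2 + 1) * heatK t (x - y))).
  rewrite ler_wpM2r// -(real_normK (num_real (f y))).
  have := sqr_ge0 (`|f y| - 1); have := normr_ge0 (f y); move: (`|f y|) => a; nra.
by rewrite mulrDl mul1r lerD2r mulrC ler_wpM2r ?sqr_ge0// heatK_le.
Qed.

Lemma heat_l2 t f : 0 < t -> isL2 mu f -> isL2 mu (heat t f) /\ l2 mu (heat t f) <= l2 mu f.
Proof.
move=> t0 Lf.
have := @schur_test _ _ _ mu sf (fun p => heatK t (p.1 - p.2)) 1 (mK t) ltr01 _ _ f Lf
  (fun x => integrable_mul_heatK x t0 Lf).
rewrite mul1r (_ : (fun x => _) = heat t f); last by apply/funext => x; rewrite heatE.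
apply.
- by move=> x; under eq_integral do rewrite normK; rewrite integral_heatK.
- by move=> y; under eq_integral do rewrite normK; rewrite integral_heatK'.
Qed.

Lemma heat_isL2 t f : 0 < t -> isL2 mu f -> isL2 mu (heat t f).
Proof. by move=> t0 Lf; exact: (heat_l2 t0 Lf).1. Qed.

Lemma heatB t f g : 0 < t -> isL2 mu f -> isL2 mu g ->
  heat t (f \- g) = heat t f \- heat t g.
Proof.
move=> t0 Lf Lg; apply/funext => x; rewrite /= !heatE -RintegralB//; last 2 first.
- exact: integrable_mul_heatK.
- exact: integrable_mul_heatK.
by apply: eq_Rintegral => y _; rewrite /= mulrBl.
Qed.

Lemma isL2_norm f : isL2 mu f -> isL2 mu (fun x => `|f x|).
Proof.
move=> Lf; have [] // := @isL2_le _ _ _ mu (fun x => `|f x|) f _ _ Lf.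
  by apply: measurableT_comp => //; exact: Lf.1.
by move=> x; rewrite normr_id.
Qed.

Lemma heat_semigroup s t f : 0 < s -> 0 < t -> isL2 mu f ->
  heat s (heat t f) = heat (s + t) f.
Proof.
move=> s0 t0 Lf; apply/funext => x; rewrite !heatE.
pose F (p : E * E) := f p.2 * heatK t (p.1 - p.2) * heatK s (x - p.1).
have mF : measurable_fun [set: E * E] F.
  apply: measurable_funM; first apply: measurable_funM => //.
  - exact: measurableT_comp Lf.1 measurable_snd.
  - by apply: measurable_heatK => //; apply: measurable_rVB.
have aF (y z : E) : `|F (y, z)| = `|f z| * (heatK s (x - y) * heatK t (y - z)).
  by rewrite /F /= 2!normrM !normK; ring.
have mF2 : measurable_fun [set: E * E] (fun p => `|F p|%:E).
  by apply/measurable_EFinP; exact: measurableT_comp.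
have Ly (y : E) : mu.-integrable setT (fun z => (F (y, z))%:E).
  rewrite (_ : (fun z => _) = fun z => ((heatK s (x - y))%:E * (f z * heatK t (y - z))%:E)%E); last first.
    by apply/funext => z; rewrite -EFinM /F/=; congr (_%:E); ring.
  apply: integrableZl => //; exact: integrable_mul_heatK.
(* The identity that yields the semigroup law also computes the absolute integral needed for
   Fubini. *)
have inner (z : E) : (\int[mu]_y `|F (y, z)|%:E = (`|f z| * heatK (s + t) (x - z))%:E)%E.
  under eq_integral do rewrite aF EFinM.
  rewrite ge0_integralZl//; first by rewrite heatK_semigroup// -EFinM.
  - apply/measurable_EFinP; apply: measurable_funM; first exact: measurable_heatKB.
    by apply: measurable_heatK => //; apply: measurable_rVB.
  - by move=> y _; rewrite lee_fin mulr_ge0 ?heatK_ge0.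
have Lz (z : E) : mu.-integrable setT (fun y => (F (y, z))%:E).
  apply/integrableP; split.
    by apply/measurable_EFinP; apply: (measurableT_comp mF); exact: pair2_measurable.
  by rewrite inner ltry.
have st0 := addr_gt0 s0 t0.
have intF : (\int[mu]_y \int[mu]_z `|F (y, z)|%:E < +oo)%E.
  rewrite (tonelli sf sf mF2)//=.
  under eq_integral do rewrite inner.
  have /integrableP[_] := integrable_mul_heatK x st0 (isL2_norm Lf).
  apply: le_lt_trans; rewrite le_eqVlt; apply/orP; left; apply/eqP.
  by apply: eq_integral => z _; rewrite /= normrM normr_id normK.
transitivity (\int[mu]_y \int[mu]_z F (y, z)).
  apply: eq_Rintegral => y _; rewrite heatE -RintegralZr//; exact: integrable_mul_heatK.
rewrite (Rfubini sf sf mF intF Ly Lz); apply: eq_Rintegral => z _.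
transitivity (f z * (\int[mu]_y (heatK s (x - y) * heatK t (y - z)))%R).
  rewrite -RintegralZl//; last first.
    apply/integrableP; split.
      apply/measurable_EFinP; apply: measurable_funM; first exact: measurable_heatKB.
      by apply: measurable_heatK => //; apply: measurable_rVB.
    under eq_integral do rewrite /= normrM !normK.
    by rewrite heatK_semigroup// ltry.
  by apply: eq_Rintegral => y _; rewrite /F/=; ring.
by rewrite /Rintegral heatK_semigroup.
Qed.

Lemma heat_double_integrable t f g : 0 < t -> isL2 mu f -> isL2 mu g ->
  (\int[mu]_x \int[mu]_y (`|f x| * `|g y| * heatK t (x - y))%:E < +oo)%E.
Proof.
move=> t0 Lf Lg.
have Lf' := isL2_norm Lf; have Lg' := isL2_norm Lg.
have := integrable_mul Lf' (heat_isL2 t0 Lg') => /integrableP[_].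
apply: le_lt_trans; rewrite le_eqVlt; apply/orP; left; apply/eqP.
apply: eq_integral => x _ /=.
have h0 : 0 <= heat t (fun y => `|g y|) x.
  by rewrite heatE; apply: Rintegral_ge0 => y _; rewrite mulr_ge0 ?heatK_ge0.
rewrite normrM normr_id (ger0_norm h0) EFinM heatE /Rintegral fineK; last first.
  by apply: integrable_fin_num => //; exact: integrable_mul_heatK.
under [LHS]eq_integral do rewrite -mulrA EFinM.
rewrite ge0_integralZl//.
- by apply/measurable_EFinP; apply: measurable_funM; [exact: Lg'.1|exact: measurable_heatKB].
- by move=> y _; rewrite lee_fin mulr_ge0 ?heatK_ge0.
Qed.

Lemma heat_selfadjoint t f g : 0 < t -> isL2 mu f -> isL2 mu g ->
  \int[mu]_x (f x * heat t g x) = \int[mu]_x (heat t f x * g x).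
Proof.
move=> t0 Lf Lg.
pose F (p : E * E) := f p.1 * g p.2 * heatK t (p.1 - p.2).
have mF : measurable_fun [set: E * E] F.
  apply: measurable_funM => //; apply: measurable_funM.
  - exact: measurableT_comp Lf.1 measurable_fst.
  - exact: measurableT_comp Lg.1 measurable_snd.
have intF : (\int[mu]_y \int[mu]_z `|F (y, z)|%:E < +oo)%E.
  have := heat_double_integrable t0 Lf Lg.
  by under eq_integral do under eq_integral do rewrite -[heatK _ _]ger0_norm ?heatK_ge0// -!normrM.
have L1 (x : E) : mu.-integrable setT (fun y => (F (x, y))%:E).
  rewrite (_ : (fun z => _) = fun y => ((f x)%:E * (g y * heatK t (x - y))%:E)%E); last first.
    by apply/funext => z; rewrite -EFinM mulrA.
  apply: integrableZl => //; exact: integrable_mul_heatK.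
have L2 (y : E) : mu.-integrable setT (fun x => (F (x, y))%:E).
  rewrite (_ : (fun z => _) = fun x => ((g y)%:E * (f x * heatK t (y - x))%:E)%E); last first.
    by apply/funext => z; rewrite -EFinM /F/= (heatKC _ y); congr (_%:E); ring.
  apply: integrableZl => //; exact: integrable_mul_heatK.
transitivity (\int[mu]_x \int[mu]_y F (x, y)).
  apply: eq_Rintegral => x _; rewrite heatE -RintegralZl//; last exact: integrable_mul_heatK.
  by apply: eq_Rintegral => y _; rewrite mulrA.
rewrite (Rfubini sf sf mF intF L1 L2).
apply: eq_Rintegral => y _; rewrite heatE -RintegralZr//; last exact: integrable_mul_heatK.
by apply: eq_Rintegral => x _; rewrite /F/= heatKC; ring.
Qed.

(** Selfadjointness turns the square norm into a quadratic form at the doubled time, which is the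
    form that [transform_sqr_heat] computes on the Fourier side. *)
Lemma l2_heat_sqr t f : 0 < t -> isL2 mu f ->
  l2 mu (heat t f) ^+ 2 = \int[mu]_x (f x * heat (t + t) f x).
Proof.
move=> t0 Lf; rewrite l2_sqr; last exact: heat_isL2.
rewrite -(heat_semigroup t0 t0 Lf) (heat_selfadjoint t0 Lf (heat_isL2 t0 Lf)).
by apply: eq_Rintegral => x _; rewrite expr2.
Qed.

End heat_operator.

(** * The heat semigroup on the Fourier side *)

Section bounded_kernel.
Context d (T : measurableType d) (R : realType) (mu : {measure set T -> \bar R}).
Hypothesis sf : sigma_finite setT mu.

Lemma integrable_mul_bounded (F G : T -> R) (C : R) :
  mu.-integrable setT (EFin \o F) -> measurable_fun setT G ->
  (forall x, `|G x| <= C) -> mu.-integrable setT (fun x => (F x * G x)%:E).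
Proof.
move=> iF mG GC.
have mF : measurable_fun setT F by apply/measurable_EFinP; exact: measurable_int iF.
apply: le_integrable (integrableZl measurableT C iF) => //.
  by apply/measurable_EFinP; exact: measurable_funM.
move=> x _; rewrite lee_fin !normrM mulrC ler_wpM2r//.
by rewrite (le_trans (GC x))// ler_norm.
Qed.

Variables (c : T * T -> R).
Hypotheses (mc : measurable_fun [set: T * T] c) (c1 : forall z, `|c z| <= 1).

Let mc1 x : measurable_fun setT (fun y => c (x, y)).
Proof. by apply: (measurableT_comp mc); exact: pair1_measurable. Qed.

Let mc2 y : measurable_fun setT (fun x => c (x, y)).
Proof. by apply: (measurableT_comp mc); exact: pair2_measurable. Qed.

Lemma Rintegral_bounded_swap (F V : T -> R) :
  mu.-integrable setT (EFin \o F) -> mu.-integrable setT (EFin \o V) ->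
  \int[mu]_x (F x * \int[mu]_y (V y * c (x, y))) =
  \int[mu]_y (V y * \int[mu]_x (F x * c (x, y))).
Proof.
move=> iF iV.
have mF : measurable_fun setT F by apply/measurable_EFinP; exact: measurable_int iF.
have mV : measurable_fun setT V by apply/measurable_EFinP; exact: measurable_int iV.
have iVc x : mu.-integrable setT (fun y => (V y * c (x, y))%:E).
  exact: (@integrable_mul_bounded _ _ 1).
have iFc y : mu.-integrable setT (fun x => (F x * c (x, y))%:E).
  exact: (@integrable_mul_bounded _ _ 1).
pose H (p : T * T) := F p.1 * V p.2 * c p.
have mH : measurable_fun [set: T * T] H.
  apply: measurable_funM => //; apply: measurable_funM; exact: measurableT_comp.
have intH : (\int[mu]_x \int[mu]_y `|H (x, y)|%:E < +oo)%E.
  have /integrableP[_ Foo] := iF; have /integrableP[_ Voo] := iV.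
  have mabs (W : T -> R) : measurable_fun setT W -> measurable_fun setT (fun y => `|W y|%:E).
    by move=> mW; apply/measurable_EFinP; exact: measurableT_comp.
  apply: (@le_lt_trans _ _ (\int[mu]_x (`|F x|%:E * \int[mu]_y `|V y|%:E))%E).
    have mH2 : measurable_fun [set: T * T] (fun p => `|H p|%:E).
      by apply/measurable_EFinP; exact: measurableT_comp.
    apply: ge0_le_integral => //.
    - by move=> x _; apply: integral_ge0 => y _.
    - exact: (measurable_tonelliF sf mH2).
    - apply: emeasurable_funM => //; exact: mabs.
    - move=> x _; rewrite -ge0_integralZl//; last exact: mabs.
      apply: ge0_le_integral => //.
      + by apply: (measurableT_comp mH2); exact: pair1_measurable.
      + by apply: emeasurable_funM => //; exact: mabs.
      + by move=> y _; rewrite -EFinM lee_fin /H !normrM ler_piMr// mulr_ge0.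
  rewrite ge0_integralZr//; [|exact: mabs|exact: integral_ge0].
  by apply: lte_mul_pinfty => //; [exact: integral_ge0|rewrite ge0_fin_numE//; exact: integral_ge0].
have i1 x : mu.-integrable setT (fun y => (H (x, y))%:E).
  have := integrableZl measurableT (F x) (iVc x).
  by apply: eq_integrable => // y _; rewrite /= -EFinM /H mulrA.
have i2 y : mu.-integrable setT (fun x => (H (x, y))%:E).
  have := integrableZl measurableT (V y) (iFc y).
  by apply: eq_integrable => // x _; rewrite /= -EFinM /H/=; congr (_%:E); ring.
transitivity (\int[mu]_x \int[mu]_y H (x, y)).
  apply: eq_Rintegral => x _; rewrite -RintegralZl//; last exact: iVc.
  by apply: eq_Rintegral => y _; rewrite mulrA.
rewrite (Rfubini sf sf mH intH i1 i2); apply: eq_Rintegral => y _.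
by rewrite -RintegralZl//; [apply: eq_Rintegral => x _; rewrite /H/=; ring|exact: iFc].
Qed.

Lemma Rintegral_bounded_le (V : T -> R) x : mu.-integrable setT (EFin \o V) ->
  `|\int[mu]_y (V y * c (x, y))| <= \int[mu]_y `|V y|.
Proof.
move=> iV.
have iVc : mu.-integrable setT (fun y => (V y * c (x, y))%:E).
  exact: (@integrable_mul_bounded _ _ 1).
apply: le_trans (le_normr_Rintegral measurableT iVc) _.
apply: le_Rintegral => //.
- by have := integrable_abse iVc.
- by have := integrable_abse iV.
- by move=> y _; rewrite normrM ler_piMr.
Qed.

Lemma measurable_bounded_transform (V : T -> R) : mu.-integrable setT (EFin \o V) ->
  measurable_fun setT (fun x => \int[mu]_y (V y * c (x, y))).
Proof.
move=> iV.
have mV : measurable_fun setT V by apply/measurable_EFinP; exact: measurable_int iV.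
apply: (measurable_Rintegral2 sf (f := fun p => V p.2 * c p)).
apply: measurable_funM => //; exact: measurableT_comp.
Qed.

End bounded_kernel.

Section fourier_weight.
Context d (T : measurableType d) (R : realType) (mu : {measure set T -> \bar R}).
Hypothesis sf : sigma_finite setT mu.
Variables (c : T * T -> R).
Hypotheses (mc : measurable_fun [set: T * T] c) (c1 : forall z, `|c z| <= 1).
Hypothesis csym : forall x y, c (x, y) = c (y, x).
Variables (F W : T -> R).
Hypotheses (iF : mu.-integrable setT (EFin \o F)) (iW : mu.-integrable setT (EFin \o W)).

Let U y := \int[mu]_x (F x * c (y, x)).
(** The kernel left after integrating out the frequency [z]. For a Gaussian [W], the sum of its
    cosine and sine versions is a multiple of the heat kernel. *)
Definition weight_gram x y := \int[mu]_z (W z * c (x, z) * c (y, z)).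

Let iWc x : mu.-integrable setT (EFin \o (fun z => W z * c (x, z))).
Proof.
apply: (@integrable_mul_bounded _ _ _ _ _ _ 1) => //.
by apply: (measurableT_comp mc); exact: pair1_measurable.
Qed.

Lemma weight_gram_le x y : `|weight_gram x y| <= \int[mu]_z `|W z|.
Proof.
apply: le_trans (Rintegral_bounded_le mc c1 y (iWc x)) _.
apply: le_Rintegral => //.
- by have := integrable_abse (iWc x).
- by have := integrable_abse iW.
- by move=> z _; rewrite normrM ler_piMr.
Qed.

Lemma measurable_weight_gram x : measurable_fun setT (weight_gram x).
Proof. exact: (measurable_bounded_transform sf mc (iWc x)). Qed.

Lemma measurable_weight_gram2 : measurable_fun setT (fun x => \int[mu]_y (F y * weight_gram x y)).
Proof.
have mF : measurable_fun setT F by apply/measurable_EFinP; exact: measurable_int iF.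
have mW : measurable_fun setT W by apply/measurable_EFinP; exact: measurable_int iW.
apply: (measurable_Rintegral2 sf (f := fun p => F p.2 * weight_gram p.1 p.2)).
apply: measurable_funM; first exact: measurableT_comp.
apply: (measurable_Rintegral2 sf (f := fun p : (T * T) * T => W p.2 * c (p.1.1, p.2) * c (p.1.2, p.2))).
apply: measurable_funM; first apply: measurable_funM.
- exact: measurableT_comp.
- apply: (@measurableT_comp _ _ _ _ _ _ c _ (fun p : (T * T) * T => (p.1.1, p.2)) mc).
  apply: measurable_fun_pair => //; exact: (measurableT_comp measurable_fst measurable_fst).
- apply: (@measurableT_comp _ _ _ _ _ _ c _ (fun p : (T * T) * T => (p.1.2, p.2)) mc).
  apply: measurable_fun_pair => //; exact: (measurableT_comp measurable_snd measurable_fst).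
Qed.

Lemma integrable_gram x : mu.-integrable setT (fun y => (F y * weight_gram x y)%:E).
Proof.
by apply: (integrable_mul_bounded iF (measurable_weight_gram x)) => y; exact: weight_gram_le.
Qed.

Lemma integrable_gram2 : mu.-integrable setT (fun x => (F x * \int[mu]_y (F y * weight_gram x y))%:E).
Proof.
pose C := \int[mu]_z `|W z|.
apply: (@integrable_mul_bounded _ _ _ _ _ _ (C * \int[mu]_y `|F y|)) => //.
  exact: measurable_weight_gram2.
move=> x; apply: le_trans (le_normr_Rintegral measurableT (integrable_gram x)) _.
have iF' := integrable_abse iF.
rewrite -RintegralZl//; apply: le_Rintegral => //.
- by have := integrable_abse (integrable_gram x).
- exact: (integrableZl measurableT C iF').
- by move=> y _; rewrite normrM mulrC ler_wpM2r// weight_gram_le.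
Qed.

(** One exchange of integrals for each factor [U z], both absolutely convergent because [F] and [W]
    are integrable and [c] is bounded. *)
Lemma weighted_transform_sqr :
  \int[mu]_z (W z * U z ^+ 2) = \int[mu]_x (F x * \int[mu]_y (F y * weight_gram x y)).
Proof.
have mU : measurable_fun setT U by exact: measurable_bounded_transform.
have iWU : mu.-integrable setT (EFin \o (fun z => W z * U z)).
  apply: (@integrable_mul_bounded _ _ _ _ _ _ (\int[mu]_x `|F x|)) => // y.
  exact: Rintegral_bounded_le.
transitivity (\int[mu]_z ((W z * U z) * \int[mu]_x (F x * c (z, x)))).
  by apply: eq_Rintegral => z _; rewrite expr2 mulrA.
rewrite (Rintegral_bounded_swap sf mc c1 iWU iF); apply: eq_Rintegral => x _; congr (_ * _).
transitivity (\int[mu]_z ((W z * c (x, z)) * \int[mu]_y (F y * c (z, y)))).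
  by apply: eq_Rintegral => z _; rewrite (csym z x) /U; ring.
rewrite (Rintegral_bounded_swap sf mc c1 (iWc x) iF); apply: eq_Rintegral => y _; congr (_ * _).
by apply: eq_Rintegral => z _; rewrite (csym z y).
Qed.

End fourier_weight.

(** * Plancherel's identity with a Gaussian weight *)

Section plancherel.
Context {R : realType} {n : nat}.
Local Notation E := 'rV[R]_n.
Local Notation mu := (@lebesgue_rV R n).
Let sf : sigma_finite setT mu := lebesgue_rV_sigma_finite n.
Implicit Types (f : E -> R) (t : R).

Let ccos (p : E * E) : R := cos (dotrV p.1 p.2).
Let csin (p : E * E) : R := sin (dotrV p.1 p.2).

Lemma dotrVC (x y : E) : dotrV x y = dotrV y x.
Proof. by apply: eq_bigr => i _; rewrite mulrC. Qed.

Lemma dotrVBl (x y z : E) : dotrV (x - y) z = dotrV x z - dotrV y z.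
Proof. by rewrite /dotrV -sumrB; apply: eq_bigr => i _; rewrite !mxE mulrBl. Qed.

Let mccos : measurable_fun [set: E * E] ccos.
Proof.
by rewrite /ccos; under eq_fun do rewrite -[dotrV _ _]add0r; exact: measurable_cos_dot.
Qed.

Let mcsin : measurable_fun [set: E * E] csin.
Proof. exact: measurable_sin_dot. Qed.

Let ccos1 z : `|ccos z| <= 1.
Proof. by rewrite ler_norml cos_le1 cos_geN1. Qed.

Let csin1 z : `|csin z| <= 1.
Proof. by rewrite ler_norml sin_le1 sin_geN1. Qed.

Let ccosC x y : ccos (x, y) = ccos (y, x).
Proof. by rewrite /ccos /= dotrVC. Qed.

Let csinC x y : csin (x, y) = csin (y, x).
Proof. by rewrite /csin /= dotrVC. Qed.

(** [(2 pi)^(-n)] times the mass of [gaussW t] is the normalising factor of the heat kernel, so the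
    unitary normalisation of the transform produces exactly [heat t]. *)
Lemma fourier_const t : 0 < t ->
  ((2 * pi) `^ (- (n%:R / 2))) ^+ 2 * Num.sqrt (pi / t) ^+ n = (4 * pi * t) `^ (- (n%:R / 2)) :> R.
Proof.
move=> t0; have pi0 := @pi_gt0 R.
rewrite -powR12_sqrt ?divr_ge0 ?ltW// -!powR_mulrn ?powR_ge0// -!powRrM.
have -> : (pi / t) `^ (2^-1 * n%:R) = (t / pi) `^ (- (n%:R / 2)) :> R.
  rewrite [in RHS](_ : t / pi = (pi / t) `^ (-1)); last by rewrite powR_inv1 ?invf_div// divr_ge0// ltW.
  by rewrite -powRrM; congr (_ `^ _); ring.
rewrite (_ : - (n%:R / 2) * 2%:R = 2 * - (n%:R / 2)); last by ring.
rewrite powRrM powR_mulrn; last by rewrite mulr_ge0// ltW.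
rewrite -powRM; [|by rewrite sqr_ge0|by rewrite divr_ge0// ltW].
congr (_ `^ _); move: pi0; move: (@pi R) => p p0.
by field; rewrite gt_eqF.
Qed.

(** [cos cos + sin sin] is the cosine of [dotrV (x - y) z], whose Gaussian integral in [z] is
    proportional to the heat kernel at [x - y]. *)
Lemma transform_sqr_heat F t : 0 < t -> mu.-integrable setT (EFin \o F) -> 
  let c := (2 * pi) `^ (- (n%:R / 2)) in
  \int[mu]_z (gaussW t z * ((c * \int[mu]_x (F x * cos (dotrV x z))) ^+ 2 +
                            (- c * \int[mu]_x (F x * sin (dotrV x z))) ^+ 2)) =
  \int[mu]_x (F x * heat t F x).
Proof.
move=> t0 iF c.
have iW := integrable_gaussW n t0.
have mF : measurable_fun setT F by apply/measurable_EFinP; exact: measurable_int iF.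
have mW := @measurable_gaussW R n t.
pose Uc z := \int[mu]_x (F x * ccos (z, x)); pose Us z := \int[mu]_x (F x * csin (z, x)).
have iU (cc : E * E -> R) : measurable_fun [set: E * E] cc -> (forall z, `|cc z| <= 1) ->
    mu.-integrable setT (fun z => (gaussW t z * (\int[mu]_x (F x * cc (z, x))) ^+ 2)%:E).
  move=> mcc cc1.
  have mU := measurable_bounded_transform sf mcc iF.
  apply: (@integrable_mul_bounded _ _ _ _ _ _ ((\int[mu]_x `|F x|) ^+ 2)) => //.
    exact: measurable_funX.
  move=> z; rewrite normrX ler_pXn2r ?nnegrE//.
    exact: Rintegral_bounded_le.
  by apply: Rintegral_ge0.
have ic := iU _ mccos ccos1; have is_ := iU _ mcsin csin1.
transitivity (\int[mu]_z (c ^+ 2 * (gaussW t z * Uc z ^+ 2) + c ^+ 2 * (gaussW t z * Us z ^+ 2))).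
  apply: eq_Rintegral => z _.
  rewrite (_ : \int[mu]_x (F x * cos (dotrV x z)) = Uc z); last by apply: eq_Rintegral => x _; rewrite ccosC.
  rewrite (_ : \int[mu]_x (F x * sin (dotrV x z)) = Us z); last by apply: eq_Rintegral => x _; rewrite csinC.
  ring.
have zi (h : E -> R) (a : R) : mu.-integrable setT (EFin \o h) -> mu.-integrable setT (EFin \o (fun z => a * h z)).
  by move=> ih; exact: (integrableZl measurableT a ih).
rewrite RintegralD//; [|exact: zi|exact: zi].
rewrite !RintegralZl// -mulrDr.
rewrite (weighted_transform_sqr sf mccos ccos1 ccosC iF iW) (weighted_transform_sqr sf mcsin csin1 csinC iF iW).
have ig2c := integrable_gram2 sf mccos ccos1 iF iW.
have ig2s := integrable_gram2 sf mcsin csin1 iF iW.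
rewrite -(RintegralD measurableT ig2c ig2s) -RintegralZl//; last by have := integrableD measurableT ig2c ig2s.
apply: eq_Rintegral => x _; rewrite -mulrDr mulrCA; congr (_ * _).
have igc := integrable_gram sf mccos ccos1 iF iW x.
have igs := integrable_gram sf mcsin csin1 iF iW x.
rewrite -RintegralD// -RintegralZl//; last by have := integrableD measurableT igc igs.
rewrite heatE; apply: eq_Rintegral => y _; rewrite -mulrDr mulrCA; congr (_ * _).
rewrite /weight_gram -RintegralD//; last 2 first.
- have i1 := @integrable_mul_bounded _ _ _ mu (fun z => gaussW t z * ccos (x, z)) (fun z => ccos (y, z)) 1.
  apply: i1 => //; last by apply: (measurableT_comp mccos); exact: pair1_measurable.
  apply: (@integrable_mul_bounded _ _ _ _ _ _ 1) => //.
  by apply: (measurableT_comp mccos); exact: pair1_measurable.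
- have i1 := @integrable_mul_bounded _ _ _ mu (fun z => gaussW t z * csin (x, z)) (fun z => csin (y, z)) 1.
  apply: i1 => //; last by apply: (measurableT_comp mcsin); exact: pair1_measurable.
  apply: (@integrable_mul_bounded _ _ _ _ _ _ 1) => //.
  by apply: (measurableT_comp mcsin); exact: pair1_measurable.
transitivity (c ^+ 2 * \int[mu]_z (cos (dotrV (x - y) z) * gaussW t z)).
  congr (_ * _); apply: eq_Rintegral => z _.
  by rewrite /ccos /csin /= dotrVBl cosB; ring.
by rewrite Rintegral_cos_gaussW// mulrA fourier_const.
Qed.

Definition disk k : set E := [set x | sqnormrV x <= k%:R ^+ 2].

Lemma measurable_sqnormrV : measurable_fun setT (@sqnormrV R n).
Proof. exact: measurable_dotrV. Qed.

Lemma measurable_disk k : measurable (disk k).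
Proof.
rewrite -[disk k]setTI.
have mB : measurable (`]-oo, k%:R ^+ 2]%classic : set R) by [].
have := measurable_sqnormrV measurableT mB.
by rewrite (_ : _ @^-1` _ = disk k)//; apply/seteqP; split => x /=; rewrite in_itv.
Qed.

Lemma disk_cube k : disk k `<=` @cube R n k.
Proof.
move=> x /= xk i; rewrite /= in_itv/= -ler_norml.
rewrite -(@ler_pXn2r _ 2)// ?nnegrE// real_normK ?num_real//.
apply: le_trans xk; rewrite /sqnormrV /dotrV (bigD1 i)//= -expr2 lerDl.
by apply: sumr_ge0 => j _; rewrite -expr2 sqr_ge0.
Qed.

Lemma disk_ltoo k : (mu (disk k) < +oo)%E.
Proof.
apply: le_lt_trans (cube_ltoo n k).
by apply: le_measure; rewrite ?inE; [exact: measurable_disk|exact: measurable_cube|exact: disk_cube].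
Qed.

Lemma isL2_patch (A : set E) f : measurable A -> isL2 mu f -> isL2 mu (f \_ A).
Proof.
move=> mA Lf; have [] // := @isL2_le _ _ _ mu (f \_ A) f _ _ Lf.
  by apply/(measurable_restrictT _ mA); apply: measurable_funTS; exact: Lf.1.
by move=> x; rewrite /patch; case: ifP; rewrite ?normr0.
Qed.

Lemma integrable_patch_disk f k : isL2 mu f -> mu.-integrable setT (EFin \o (f \_ (disk k))).
Proof.
move=> Lf.
have i1 : mu.-integrable setT (EFin \o (\1_(disk k) : E -> R)).
  apply/integrableP; split.
    by apply/measurable_EFinP; exact: measurable_indic (measurable_disk k).
  under eq_integral do rewrite /= ger0_norm//.
  by rewrite integral_indic//= ?setIT ?disk_ltoo//; exact: measurable_disk.
apply: le_integrable (integrableD measurableT i1 (integrable_sqr Lf)) => //.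
  by apply/measurable_EFinP; have [] := isL2_patch (measurable_disk k) Lf.
move=> x _; rewrite -EFinD lee_fin /patch indicE; case: (x \in _) => /=; last first.
  by rewrite normr0.
rewrite [leRHS]ger0_norm ?addr_ge0 ?sqr_ge0// -(real_normK (num_real (f x))).
have := sqr_ge0 (`|f x| - 1); have := normr_ge0 (f x); move: (`|f x|) => a; nra.
Qed.

Lemma ball_fourierE f k :
  ball_fourier f k =
  ((fun xi => (2 * pi) `^ (- (n%:R / 2)) * \int[mu]_x ((f \_ (disk k)) x * cos (dotrV x xi))),
   (fun xi => - (2 * pi) `^ (- (n%:R / 2)) * \int[mu]_x ((f \_ (disk k)) x * sin (dotrV x xi)))).
Proof.
rewrite /ball_fourier; congr pair; apply/funext => xi; congr (_ * _); rewrite Rintegral_mkcond.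
  by apply: eq_Rintegral => x _; rewrite /patch /disk; case: ifP => //; rewrite mul0r.
by apply: eq_Rintegral => x _; rewrite /patch /disk; case: ifP => //; rewrite mul0r.
Qed.

Lemma l2_patch_disk_cvg f : isL2 mu f ->
  l2 mu (f \- (f \_ (disk k))) @[k --> \oo] --> (0 : R).
Proof.
move=> Lf.
pose h k (x : E) := ((f \- (f \_ (disk k))) x ^+ 2)%:E.
have mh k : measurable_fun setT (h k).
  apply: measurable_sqr_EFin; apply: measurable_funB; first exact: Lf.1.
  by have [] := isL2_patch (measurable_disk k) Lf.
have h0 : (\int[mu]_x h k x)%E @[k --> \oo] --> (\int[mu]_x cst 0 x)%E.
  apply: (@dominated_cvg _ _ _ mu setT _ h (cst 0%E) (fun x => (f x ^+ 2)%:E)) => //.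
  - move=> x _; apply: cvg_near_cst; near=> k.
    rewrite /h /patch /= ifT ?subrr ?expr0n//; rewrite inE /disk/=.
    have k1 : sqnormrV x <= k%:R by near: k; exact: nbhs_infty_ger.
    have k2 : 1 <= k%:R :> R by near: k; exact: nbhs_infty_ger.
    by rewrite (le_trans k1)// expr2 ler_peMl// (le_trans _ k2).
  - exact: integrable_sqr.
  - move=> k x _; rewrite /h /= ger0_norm ?sqr_ge0// lee_fin /patch.
    by case: ifP => _; rewrite ?subrr ?subr0// expr0n sqr_ge0.
rewrite integral_cst// mul0e in h0.
rewrite -(sqrtr0 R); apply: (@continuous_cvg _ _ _ _ _ _ (@Num.sqrt R)).
  exact: sqrt_continuous.
by move/fine_cvgP : h0 => [].
Unshelve. all: by end_near. Qed.

Lemma cvg_dist_le (x_ e_ : nat -> R) (x : R) : e_ k @[k --> \oo] --> (0 : R) ->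
  (\forall k \near \oo, `|x - x_ k| <= e_ k) -> x_ k @[k --> \oo] --> x.
Proof.
move=> e0 xe; apply/cvgrPdist_lt => e egt0.
near=> k; apply: (@le_lt_trans _ _ (e_ k)); first by near: k.
apply: le_lt_trans (ler_norm _) _.
by rewrite -[e_ k]subr0 distrC; near: k; move/cvgrPdist_lt : e0; apply.
Unshelve. all: by end_near. Qed.

Lemma cvg_near_unique (u v : nat -> R) (a b : R) :
  u k @[k --> \oo] --> a -> v k @[k --> \oo] --> b ->
  (\forall k \near \oo, u k = v k) -> a = b.
Proof.
move=> ua vb uv.
have va : v k @[k --> \oo] --> a.
  apply: cvg_trans ua; apply: near_eq_cvg; apply: filterS uv => k -> //.
by rewrite -(cvg_lim (@Rhausdorff R) va) -(cvg_lim (@Rhausdorff R) vb).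
Qed.

Lemma l2_dist f g : isL2 mu f -> isL2 mu g -> `|l2 mu f - l2 mu g| <= l2 mu (f \- g).
Proof.
move=> Lf Lg; rewrite ler_norml; apply/andP; split.
  have := l2D (isL2N (isL2B Lf Lg)) Lf.
  rewrite (_ : (\- (f \- g)) \+ f = g); last by apply/funext => x /=; ring.
  by rewrite l2N; lra.
have := l2D (isL2B Lf Lg) Lg.
rewrite (_ : (f \- g) \+ g = f); last by apply/funext => x /=; ring.
by lra.
Qed.

Lemma gaussW_le1 t (x : E) : 0 < t -> gaussW t x <= 1.
Proof. by move=> t0; rewrite -[leRHS]expR0 ler_expR oppr_le0 mulr_ge0 ?sqnormrV_ge0// ltW. Qed.

Lemma isL2_gaussW t f : 0 < t -> isL2 mu f ->
  isL2 mu (fun x => gaussW t x * f x) /\ l2 mu (fun x => gaussW t x * f x) <= l2 mu f.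
Proof.
move=> t0 Lf; apply: isL2_le => //.
  by apply: measurable_funM; [exact: measurable_gaussW|exact: Lf.1].
by move=> x; rewrite normrM ger0_norm ?gaussW_ge0// ler_piMl// gaussW_le1.
Qed.

(** Norms converging to 0 in the extended reals are finite from some rank on. Square-integrability
    of the truncated transforms is obtained this way, hence only for large [k]. *)
Lemma L2_cvg_near (h : nat -> E -> R) (g : E -> R) :
  (forall k, measurable_fun setT (h k)) -> isL2 mu g ->
  'N[mu]_2%:E[EFin \o (h k \- g)%R]%E @[k --> \oo] --> 0%E ->
  (\forall k \near \oo, isL2 mu (h k)) /\ l2 mu (h k \- g) @[k --> \oo] --> (0 : R).
Proof.
move=> mh Lg /fine_cvgP[finN N0].
have LL : \forall k \near \oo, isL2 mu (h k \- g).
  apply: filterS finN => k; rewrite Lnorm2_sqint => fk; split.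
    by apply: measurable_funB => //; exact: Lg.1.
  apply: (@lty_poweRy _ _ 2^-1)%R => //.
  by rewrite -ge0_fin_numE// poweR_ge0.
split.
  apply: filterS LL => k Lk; rewrite (_ : h k = (h k \- g) \+ g); first exact: isL2D.
  by apply/funext => x /=; ring.
apply: cvg_trans N0; apply: near_eq_cvg; apply: filterS LL => k Lk /=.
by rewrite Lnorm2_l2.
Qed.

(** For the truncations to disks, which are integrable, this is [transform_sqr_heat] at time
    [t + t], as squaring the multiplier doubles the time. Both sides pass to the limit since
    [heat t] and multiplication by [gaussW t] are contractions of L^2. *)
Lemma plancherel_heat f g t : 0 < t -> isL2 mu f -> L2_fourier f g ->
  l2 mu (fun x => gaussW t x * g.1 x) ^+ 2 + l2 mu (fun x => gaussW t x * g.2 x) ^+ 2 =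
  l2 mu (heat t f) ^+ 2.
Proof.
move=> t0 Lf [/isL2P Lg1 /isL2P Lg2 c1 c2].
pose c : R := (2 * pi) `^ (- (n%:R / 2)).
have mb1 k : measurable_fun setT (ball_fourier f k).1.
  rewrite ball_fourierE/=; apply: measurable_funM => //.
  have := measurable_bounded_transform sf mccos (integrable_patch_disk k Lf).
  apply: eq_measurable_fun => z _; apply: eq_Rintegral => x _; by rewrite ccosC.
have mb2 k : measurable_fun setT (ball_fourier f k).2.
  rewrite ball_fourierE/=; apply: measurable_funM => //.
  have := measurable_bounded_transform sf mcsin (integrable_patch_disk k Lf).
  apply: eq_measurable_fun => z _; apply: eq_Rintegral => x _; by rewrite csinC.
have [LL1 C1] := L2_cvg_near mb1 Lg1 c1.
have [LL2 C2] := L2_cvg_near mb2 Lg2 c2.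
have H (h : nat -> E -> R) g0 : isL2 mu g0 -> (\forall k \near \oo, isL2 mu (h k)) ->
    l2 mu (h k \- g0) @[k --> \oo] --> (0 : R) ->
    l2 mu (fun x => gaussW t x * h k x) @[k --> \oo] --> l2 mu (fun x => gaussW t x * g0 x).
  move=> Lg0 Lh Ch; apply: (cvg_dist_le Ch); apply: filterS Lh => k Lk.
  rewrite distrC; apply: le_trans (l2_dist (isL2_gaussW t0 Lk).1 (isL2_gaussW t0 Lg0).1) _.
  apply: le_trans (isL2_gaussW t0 (isL2B Lk Lg0)).2.
  by rewrite le_eqVlt; apply/orP; left; apply/eqP; congr l2; apply/funext => x /=; ring.
have D1 := H _ _ Lg1 LL1 C1; have D2 := H _ _ Lg2 LL2 C2.
pose Fk k := f \_ (disk k).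
have LF k : isL2 mu (Fk k) by apply: isL2_patch => //; exact: measurable_disk.
have D3 : l2 mu (heat t (Fk k)) @[k --> \oo] --> l2 mu (heat t f).
  apply: (cvg_dist_le (l2_patch_disk_cvg Lf)); apply: nearW => k.
  apply: le_trans (l2_dist (heat_isL2 t0 Lf) (heat_isL2 t0 (LF k))) _.
  by rewrite -heatB//; exact: (heat_l2 t0 (isL2B Lf (LF k))).2.
have sqc (u : nat -> R) (l : R) : u k @[k --> \oo] --> l -> u k ^+ 2 @[k --> \oo] --> l ^+ 2.
  by move=> ul; rewrite expr2; under eq_fun do rewrite expr2; exact: cvgM.
pose u k : R := l2 mu (fun x => gaussW t x * (ball_fourier f k).1 x) ^+ 2 +
  l2 mu (fun x => gaussW t x * (ball_fourier f k).2 x) ^+ 2.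
pose a : R := l2 mu (fun x => gaussW t x * g.1 x) ^+ 2 + l2 mu (fun x => gaussW t x * g.2 x) ^+ 2.
have S12 : u k @[k --> \oo] --> a by exact: (cvgD (sqc _ _ D1) (sqc _ _ D2)).
have S3 := sqc _ _ D3.
apply: (@cvg_near_unique u (fun k => l2 mu (heat t (Fk k)) ^+ 2) a (l2 mu (heat t f) ^+ 2) S12 S3).
apply: filterS2 LL1 LL2 => k Lk1 Lk2; rewrite /u.
rewrite (l2_heat_sqr t0 (LF k)) -(transform_sqr_heat (addr_gt0 t0 t0)); last exact: integrable_patch_disk.
have Gk1 := (isL2_gaussW t0 Lk1).1; have Gk2 := (isL2_gaussW t0 Lk2).1.
rewrite (l2_sqr Gk1) (l2_sqr Gk2).
rewrite -(RintegralD measurableT (integrable_sqr Gk1) (integrable_sqr Gk2)).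
apply: eq_Rintegral => x _.
rewrite ball_fourierE /= -/c -/(Fk k) !exprMn (_ : gaussW (t + t) x = gaussW t x ^+ 2); first by ring.
by rewrite /gaussW expr2 -expRD; congr expR; ring.
Qed.

End plancherel.

(** * Continuity of the heat semigroup at time 0 *)

Section gauss1_tail.
Context {R : realType}.
Local Notation leb := (@lebesgue_measure R).

(** Doubling the time absorbs the factor [|z|], by [u <= exp (u^2)] with [u = |z| / sqrt (8 s)]; the
    change of normalisation contributes a factor [sqrt 2]. *)
Lemma normr_gauss1_le s (z : R) : 0 < s -> `|z| * gauss1 s z <= 4 * Num.sqrt s * gauss1 (2 * s) z.
Proof.
move=> s0; have s80 : 0 < 8 * s by rewrite mulr_gt0.
pose u := `|z| / Num.sqrt (8 * s).
have r0 : 0 < Num.sqrt (8 * s) by rewrite sqrtr_gt0.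
have u1 : u <= expR (u ^+ 2).
  apply: le_trans (expR_ge1Dx _); have := sqr_ge0 (u - 1).
  have : 0 <= u by rewrite divr_ge0// ltW.
  nra.
have u2 : u ^+ 2 = z ^+ 2 / (8 * s).
  by rewrite /u expr_div_n sqr_sqrtr ?(ltW s80)// real_normK ?num_real.
have zE : `|z| = u * Num.sqrt (8 * s) by rewrite /u divfK// gt_eqF.
have p0 : 0 <= 4 * pi * s :> R.
  by apply: mulr_ge0; [apply: mulr_ge0 => //; exact: pi_ge0|exact: ltW].
have cE : (4 * pi * s) `^ (- 2^-1) = Num.sqrt 2 * (4 * pi * (2 * s)) `^ (- 2^-1).
  rewrite (_ : 4 * pi * (2 * s) = 2 * (4 * pi * s)); last by ring.
  rewrite (powRM _ (ler0n R 2) p0) mulrA -powR12_sqrt// -powRD; last by rewrite pnatr_eq0 implybT.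
  by rewrite subrr powRr0 mul1r.
have e8 : Num.sqrt (8 * s) * Num.sqrt 2 = 4 * Num.sqrt s :> R.
  rewrite -sqrtrM ?(ltW s80)// (_ : 8 * s * 2 = 4 ^+ 2 * s); last by ring.
  by rewrite sqrtrM ?sqr_ge0// sqrtr_sqr ger0_norm.
rewrite /gauss1 cE zE -e8.
have -> : u * Num.sqrt (8 * s) * (Num.sqrt 2 * (4 * pi * (2 * s)) `^ (- 2^-1) * expR (- z ^+ 2 / (4 * s)))
  = (Num.sqrt (8 * s) * Num.sqrt 2 * (4 * pi * (2 * s)) `^ (- 2^-1)) * (u * expR (- z ^+ 2 / (4 * s))) by ring.
rewrite [leRHS]mulrA [leLHS]mulrA -[leLHS]mulrA ler_wpM2l//.
  by rewrite !mulr_ge0 ?powR_ge0 ?sqrtr_ge0.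
rewrite (_ : - z ^+ 2 / (4 * s) = - u ^+ 2 - u ^+ 2); last by rewrite u2; field; rewrite gt_eqF.
rewrite (_ : - z ^+ 2 / (4 * (2 * s)) = - u ^+ 2); last by rewrite u2; field; rewrite gt_eqF.
rewrite expRD mulrA -[leRHS]mul1r ler_wpM2r ?expR_ge0//.
by rewrite expRN ler_pdivrMr ?expR_gt0// mul1r.
Qed.

Lemma integral_normr_gauss1 s : 0 < s ->
  (\int[leb]_z (`|z| * gauss1 s z)%:E <= (4 * Num.sqrt s)%:E)%E.
Proof.
move=> s0; have s20 : 0 < 2 * s by rewrite mulr_gt0.
have mg t : measurable_fun [set: R] (gauss1 t) by exact: measurable_gauss1.
apply: (@le_trans _ _ (\int[leb]_z ((4 * Num.sqrt s)%:E * (gauss1 (2 * s) (0 - z))%:E))%E).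
  apply: ge0_le_integral => //.
  - by move=> z _; rewrite lee_fin mulr_ge0 ?gauss1_ge0.
  - have : measurable_fun [set: R] (fun z => `|z| * gauss1 s z).
      by apply: measurable_funM => //; exact: normr_measurable.
    by move/measurable_EFinP.
  - apply: emeasurable_funM => //.
    have : measurable_fun [set: R] (fun z => gauss1 (2 * s) (0 - z)).
      by apply: (measurableT_comp (mg _)); exact: measurable_funB.
    by move/measurable_EFinP.
  - by move=> z _; rewrite -EFinM lee_fin sub0r gauss1N normr_gauss1_le.
rewrite ge0_integralZl//.
- by rewrite integral_gauss1// mule1.
- have : measurable_fun [set: R] (fun z => gauss1 (2 * s) (0 - z)).
    by apply: (measurableT_comp (mg _)); exact: measurable_funB.
  by move/measurable_EFinP.
- by move=> z _; rewrite lee_fin gauss1_ge0.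
Qed.

(** The points of the interval that leave it under translation by [z] lie in a segment of length
    [|z|] at the end they move towards. *)
Lemma indic_shift_le (a b z : R) :
  (\int[leb]_x (\1_(`]a, b]) x * \1_(~` `]a, b]) (x + z)%R)%:E <= `|z|%:E)%E.
Proof.
pose J : set R := if 0 <= z then `](b - z), b]%classic else `](a), (a - z)]%classic.
apply: (@le_trans _ _ (\int[leb]_x (\1_J x)%:E)%E).
  have mJ : measurable J by rewrite /J; case: ifP.
  have mI : measurable (`]a, b]%classic : set R) by [].
  apply: ge0_le_integral => //.
  - have : measurable_fun [set: R] (fun x => \1_(`]a, b]) x * \1_(~` `]a, b]) (x + z) : R).
      apply: measurable_funM; first exact: measurable_indic.
      apply: (@measurableT_comp _ _ _ _ _ _ (\1_(~` `]a, b]) : R -> R)).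
        by apply: measurable_indic; exact: measurableC.
      exact: measurable_funD.
    by move/measurable_EFinP.
  - apply/measurable_EFinP; exact: measurable_indic.
  - move=> x _; rewrite lee_fin !indicE.
    case: (boolP (x \in `]a, b]%classic)) => [|_]; last by rewrite mul0r.
    rewrite inE/= in_itv/= => /andP[ax xb].
    case: (boolP (x + z \in _)) => [|_]; last by rewrite mulr0.
    rewrite inE /= in_itv/= => /negP; rewrite negb_and -leNgt -ltNge mul1r => xz.
    rewrite (_ : x \in J)//; rewrite inE /J; case: ifP => z0; rewrite /= in_itv/=.
      by apply/andP; split => //; case/orP : xz => ?; lra.
    by move/negbT : z0; rewrite -ltNge => z0; apply/andP; split => //; case/orP : xz => ?; lra.
rewrite integral_indic//=; last by rewrite /J; case: ifP.
rewrite setIT /J; case: ifP => z0; rewrite lebesgue_measure_itv/= lte_fin.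
  case: ifPn => _; last by rewrite lee_fin.
  by rewrite -EFinD lee_fin ger0_norm//; lra.
case: ifPn => _; last by rewrite lee_fin.
by rewrite -EFinD lee_fin ltr0_norm; [lra|rewrite ltNge z0].
Qed.

(** Substituting [y = x + z] and integrating in [x] first leaves the first absolute moment of the
    Gaussian, of order [sqrt s]. *)
Lemma gauss1_leak (a b s : R) : 0 < s ->
  (\int[leb]_x \int[leb]_y (\1_(`]a, b]) x * \1_(~` `]a, b]) y * gauss1 s (x - y))%:E <=
   (4 * Num.sqrt s)%:E)%E.
Proof.
move=> s0.
have mI : measurable (`]a, b]%classic : set R) by [].
have mC : measurable (~` `]a, b]%classic : set R) by exact: measurableC.
have mi : measurable_fun [set: R] (\1_(`]a, b]) : R -> R) by exact: measurable_indic.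
have mic : measurable_fun [set: R] (\1_(~` `]a, b]) : R -> R) by exact: measurable_indic.
have mg := @measurable_gauss1 R s.
pose H (p : measurableTypeR R * measurableTypeR R) : R :=
  (\1_(`]a, b]) p.1 * \1_(~` `]a, b]) ((p.1 : R) + p.2)) * gauss1 s p.2.
have mH : measurable_fun setT (fun p => (H p)%:E).
  apply/measurable_EFinP; apply: measurable_funM; first apply: measurable_funM.
  - exact: measurableT_comp mi measurable_fst.
  - apply: (measurableT_comp mic); apply: measurable_funD; [exact: measurable_fst|exact: measurable_snd].
  - exact: measurableT_comp mg measurable_snd.
have H0 p : (0 <= (H p)%:E)%E by rewrite lee_fin /H !indicE mulr_ge0 ?gauss1_ge0// mulr_ge0.
apply: (@le_trans _ _ (\int[leb]_x \int[leb]_z (H (x, z))%:E)%E).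
  rewrite le_eqVlt; apply/orP; left; apply/eqP; apply: eq_integral => x _.
  rewrite -(@ge0_integral_shift R x (fun y => (\1_(`]a, b]) x * \1_(~` `]a, b]) y * gauss1 s (x - y)%R)%:E)).
  - apply: eq_integral => z _; rewrite /H /= -[in RHS]gauss1N; congr ((_ * \1_ _ _ * gauss1 _ _)%:E).
      by rewrite addrC.
    by rewrite opprD addrCA subrr addr0.
  - apply/measurable_EFinP; apply: measurable_funM; first exact: measurable_funM.
    by apply: (measurableT_comp mg); exact: measurable_funB.
  - by move=> y; rewrite lee_fin !indicE mulr_ge0 ?gauss1_ge0// mulr_ge0.
rewrite (tonelli (@lebesgue_sigma_finite R) (@lebesgue_sigma_finite R) mH)//.
apply: le_trans (integral_normr_gauss1 s0).
apply: ge0_le_integral => //.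
- by move=> z _; apply: integral_ge0.
- exact: (measurable_tonelliG (@lebesgue_sigma_finite R) mH).
- have : measurable_fun [set: R] (fun z => `|z| * gauss1 s z).
    by apply: measurable_funM => //; exact: normr_measurable.
  by move/measurable_EFinP.
move=> z _; rewrite /H/=.
under eq_integral do rewrite EFinM.
rewrite ge0_integralZr//.
- by rewrite [in leRHS]EFinM lee_wpmul2r ?lee_fin ?gauss1_ge0// indic_shift_le.
- have : measurable_fun [set: R] (fun x => \1_(`]a, b]) x * \1_(~` `]a, b]) (x + z) : R).
    apply: measurable_funM => //; apply: (measurableT_comp mic); exact: measurable_funD.
  by move/measurable_EFinP.
- by rewrite lee_fin gauss1_ge0.
Qed.

End gauss1_tail.

(** * Dirichlet forms and strong continuity *)

Section dirichlet.
Context {R : realType} {n : nat}.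
Local Notation E := 'rV[R]_n.
Local Notation leb := (@lebesgue_measure R).
Local Notation mu := (@lebesgue_rV R n).
Let sf : sigma_finite setT mu := lebesgue_rV_sigma_finite n.
Implicit Types (f g h : E -> R) (s t : R).

(** For square-integrable [f] this is twice the inner product of [f] with [f - P_s f]. *)
Definition dirichlet s f : \bar R :=
  (\int[mu]_x \int[mu]_y ((f x - f y) ^+ 2 * heatK s (x - y))%:E)%E.

Let mD s f : measurable_fun setT f ->
  measurable_fun [set: E * E] (fun p => ((f p.1 - f p.2) ^+ 2 * heatK s (p.1 - p.2))%:E).
Proof.
move=> mf; apply/measurable_EFinP; apply: measurable_funM; last exact: measurable_heatKB2.
apply: measurable_funX; apply: measurable_funB; exact: measurableT_comp.
Qed.

Let D0 s f (p : E * E) : (0 <= ((f p.1 - f p.2) ^+ 2 * heatK s (p.1 - p.2))%:E)%E.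
Proof. by rewrite lee_fin mulr_ge0 ?sqr_ge0 ?heatK_ge0. Qed.

Let mD1 s f x : measurable_fun setT f ->
  measurable_fun setT (fun y : E => ((f x - f y) ^+ 2 * heatK s (x - y))%:E).
Proof.
move=> mf; apply/measurable_EFinP; apply: measurable_funM; last exact: measurable_heatKB.
by apply: measurable_funX; exact: measurable_funB.
Qed.

Lemma dirichlet_le s f g h c : 0 <= c ->
  measurable_fun setT f -> measurable_fun setT g -> measurable_fun setT h ->
  (forall x y, (f x - f y) ^+ 2 <= c * ((g x - g y) ^+ 2 + (h x - h y) ^+ 2)) ->
  (dirichlet s f <= c%:E * (dirichlet s g + dirichlet s h))%E.
Proof.
move=> c0 mf mg mh H.
have G0 (k : E -> R) x : (0 <= \int[mu]_y ((k x - k y) ^+ 2 * heatK s (x - y))%:E)%E.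
  by apply: integral_ge0 => y _; exact: (D0 s k (x, y)).
have mG (k : E -> R) : measurable_fun setT k -> measurable_fun setT
    (fun x : E => \int[mu]_y ((k x - k y) ^+ 2 * heatK s (x - y))%:E)%E.
  by move=> mk; exact: (measurable_tonelliF sf (mD s mk)).
rewrite /dirichlet -ge0_integralD//; [|exact: mG|exact: mG].
rewrite -ge0_integralZl//; last 2 first.
- by apply: emeasurable_funD; exact: mG.
- by move=> x _; rewrite adde_ge0.
apply: ge0_le_integral => //; first exact: mG.
- by apply: emeasurable_funM => //; apply: emeasurable_funD; exact: mG.
move=> x _.
have g0 (k : E -> R) (y : E) : (0 <= ((k x - k y) ^+ 2 * heatK s (x - y))%:E)%E by exact: (D0 s k (x, y)).
rewrite -ge0_integralD//; [|exact: mD1|exact: mD1].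
rewrite -ge0_integralZl//; last 2 first.
- by apply: emeasurable_funD; exact: mD1.
- by move=> y _; rewrite adde_ge0.
apply: ge0_le_integral => //; first exact: mD1.
- by apply: emeasurable_funM => //; apply: emeasurable_funD; exact: mD1.
move=> y _; rewrite -EFinD -EFinM lee_fin -mulrDl mulrA ler_wpM2r ?heatK_ge0//.
Qed.

Lemma dirichlet_le_sqint s f : 0 < s -> measurable_fun setT f ->
  (dirichlet s f <= 4%:E * sqint mu f)%E.
Proof.
move=> s0 mf.
have mk1 (x : E) : measurable_fun setT (fun y : E => (heatK s (x - y))%:E).
  by apply/measurable_EFinP; exact: measurable_heatKB.
pose G1 (p : E * E) := (f p.1 ^+ 2 * heatK s (p.1 - p.2))%:E.
pose G2 (p : E * E) := (f p.2 ^+ 2 * heatK s (p.1 - p.2))%:E.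
have mG1 : measurable_fun [set: E * E] G1.
  apply/measurable_EFinP; apply: measurable_funM; last exact: measurable_heatKB2.
  by apply: measurable_funX; exact: measurableT_comp.
have mG2 : measurable_fun [set: E * E] G2.
  apply/measurable_EFinP; apply: measurable_funM; last exact: measurable_heatKB2.
  by apply: measurable_funX; exact: measurableT_comp.
have G10 p : (0 <= G1 p)%E by rewrite lee_fin mulr_ge0 ?sqr_ge0 ?heatK_ge0.
have G20 p : (0 <= G2 p)%E by rewrite lee_fin mulr_ge0 ?sqr_ge0 ?heatK_ge0.
have E1 : (\int[mu]_x \int[mu]_y G1 (x, y) = sqint mu f)%E.
  apply: eq_integral => x _; rewrite /G1/=.
  under eq_integral do rewrite EFinM.
  rewrite ge0_integralZl// ?integral_heatK ?mule1//.
    by move=> y _; rewrite lee_fin heatK_ge0.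
  by rewrite lee_fin sqr_ge0.
have E2 : (\int[mu]_x \int[mu]_y G2 (x, y) = sqint mu f)%E.
  rewrite (tonelli sf sf mG2 G20); apply: eq_integral => y _; rewrite /G2/=.
  under eq_integral do rewrite EFinM heatKC.
  rewrite ge0_integralZl// ?integral_heatK ?mule1//.
    by move=> x _; rewrite lee_fin heatK_ge0.
  by rewrite lee_fin sqr_ge0.
rewrite (_ : 4%:E * sqint mu f = 2%:E * (sqint mu f + sqint mu f))%E; last first.
  have := sqint_ge0 mu f; case: (sqint mu f) => [r _| _|] //.
    by rewrite -EFinD -!EFinM; congr (_%:E); ring.
  by rewrite addye// !gt0_muley.
rewrite -{1}E1 -E2 -ge0_integralD//; last 4 first.
- by move=> x _; apply: integral_ge0 => y _.
- exact: (measurable_tonelliF sf mG1).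
- by move=> x _; apply: integral_ge0 => y _.
- exact: (measurable_tonelliF sf mG2).
have m12 : measurable_fun setT (fun x : E => \int[mu]_y G1 (x, y) + \int[mu]_y G2 (x, y))%E.
  by apply: emeasurable_funD; [exact: (measurable_tonelliF sf mG1)|exact: (measurable_tonelliF sf mG2)].
rewrite -ge0_integralZl//; last first.
  by move=> x _; apply: adde_ge0; apply: integral_ge0 => y _.
apply: ge0_le_integral => //.
- by move=> x _; apply: integral_ge0 => y _; exact: (D0 s f (x, y)).
- exact: (measurable_tonelliF sf (mD s mf)).
- exact: emeasurable_funM.
move=> x _.
have mx1 : measurable_fun setT (fun y => G1 (x, y)) by apply: (measurableT_comp mG1); exact: pair1_measurable.
have mx2 : measurable_fun setT (fun y => G2 (x, y)) by apply: (measurableT_comp mG2); exact: pair1_measurable.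
rewrite -ge0_integralD// -ge0_integralZl//; last 2 first.
- exact: emeasurable_funD.
- by move=> y _; rewrite adde_ge0.
apply: ge0_le_integral => //.
- by move=> y _; exact: (D0 s f (x, y)).
- exact: mD1.
- by apply: emeasurable_funM => //; exact: emeasurable_funD.
move=> y _; rewrite /G1 /G2 -EFinD -EFinM lee_fin -mulrDl mulrA ler_wpM2r ?heatK_ge0//=.
by have := sqr_ge0 (f x + f y); nra.
Qed.

(** Jensen's inequality: [heat s f x - f x] averages the increments [f y - f x] against a
    probability density. *)
Lemma l2_heat_sub_le s f : 0 < s -> isL2 mu f ->
  ((l2 mu (heat s f \- f) ^+ 2)%:E <= dirichlet s f)%E.
Proof.
move=> s0 Lf; have Lh := heat_isL2 s0 Lf.
rewrite -sqintE; last exact: isL2B.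
have mf := Lf.1.
apply: ge0_le_integral => //.
- by move=> x _; rewrite lee_fin sqr_ge0.
- by apply: measurable_sqr_EFin; apply: measurable_funB => //; exact: Lh.1.
- exact: (measurable_tonelliF sf (mD s mf)).
move=> x _.
have iK := integrable_heatK x s0.
have iff : mu.-integrable setT (fun y => ((f y - f x) * heatK s (x - y))%:E).
  have := integrableB measurableT (integrable_mul_heatK x s0 Lf) (integrableZl measurableT (f x) iK).
  rewrite (_ : (fun y => _) = (fun y => ((f y - f x) * heatK s (x - y))%:E))//.
  by apply/funext => y; rewrite -EFinM -EFinB mulrBl.
have := @kernel_cauchy_schwarz _ _ _ mu (fun p => heatK s (p.1 - p.2)) 1 (measurable_heatKB2 s) ltr01 _ (fun y => f y - f x) x _ iff.
rewrite mul1e /= => cs.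
rewrite (_ : heat s f x - f x = \int[mu]_y ((f y - f x) * heatK s (x - y))).
  apply: le_trans (cs _ _) _.
  - by move=> z; under eq_integral do rewrite ger0_norm ?heatK_ge0//; rewrite integral_heatK.
  - by apply: measurable_funB.
  rewrite le_eqVlt; apply/orP; left; apply/eqP; apply: eq_integral => y _.
  by rewrite ger0_norm ?heatK_ge0// -sqrrN opprB.
rewrite heatE.
transitivity (\int[mu]_y (f y * heatK s (x - y) - f x * heatK s (x - y))).
  rewrite RintegralB//; last 2 first.
  - exact: integrable_mul_heatK.
  - exact: (integrableZl measurableT (f x) iK).
  rewrite RintegralZl//; congr (_ - _).
  by rewrite /Rintegral integral_heatK// mulr1.
by apply: eq_Rintegral => y _; rewrite mulrBl.
Qed.

(* By [l2_heat_sub_le], the heat semigroup is continuous at time 0 at such [f].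
   These [f] form a closed subspace of L^2; it contains the indicators of boxes,
   hence, the sets below being a sigma-algebra, everything. *)
Definition vanishing f := isL2 mu f /\
  forall e, 0 < e -> exists2 d, 0 < d & forall s, 0 < s < d -> (dirichlet s f <= e%:E)%E.

(** A single comparison of increments serves for sums, differences, multiples and indicators of
    intersections. *)
Lemma vanishing_le f g h c : 0 < c -> isL2 mu f -> vanishing g -> vanishing h ->
  (forall x y, (f x - f y) ^+ 2 <= c * ((g x - g y) ^+ 2 + (h x - h y) ^+ 2)) -> vanishing f.
Proof.
move=> c0 Lf [Lg Gg] [Lh Gh] H; split=> [|e e0]; first exact: Lf.
have e2 : 0 < e / (2 * c) by rewrite divr_gt0// mulr_gt0.
have [d1 d10 H1] := Gg _ e2; have [d2 d20 H2] := Gh _ e2.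
exists (Num.min d1 d2); first by rewrite lt_min d10 d20.
move=> s /andP[s0]; rewrite lt_min => /andP[sd1 sd2].
apply: le_trans (dirichlet_le s (ltW c0) Lf.1 Lg.1 Lh.1 H) _.
have -> : e = c * (e / (2 * c) + e / (2 * c)) by field; rewrite gt_eqF.
rewrite EFinM lee_wpmul2l ?lee_fin ?(ltW c0)// EFinD; apply: leeD; [apply: H1|apply: H2]; exact/andP.
Qed.

Lemma isL2_0 : isL2 mu (cst 0).
Proof.
split=> //; rewrite /sqint; under eq_integral do rewrite expr0n/=.
by rewrite integral_cst// mul0e.
Qed.

Lemma vanishing0 : vanishing (cst 0).
Proof.
split; first exact: isL2_0.
move=> e e0; exists 1 => // s s0; apply: le_trans (dirichlet_le_sqint _ _) _ => //.
  by case/andP : s0.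
rewrite /sqint; under eq_integral do rewrite expr0n/=.
by rewrite integral_cst// mul0e mule0 lee_fin ltW.
Qed.

Lemma vanishingD f g : vanishing f -> vanishing g -> vanishing (f \+ g).
Proof.
move=> Gf Gg; apply: (@vanishing_le _ f g 2) => //; first exact: isL2D Gf.1 Gg.1.
move=> x y /=; have := sqr_ge0 ((f x - f y) - (g x - g y)); nra.
Qed.

Lemma vanishingB f g : vanishing f -> vanishing g -> vanishing (f \- g).
Proof.
move=> Gf Gg; apply: (@vanishing_le _ f g 2) => //; first exact: isL2B Gf.1 Gg.1.
move=> x y /=; have := sqr_ge0 ((f x - f y) + (g x - g y)); nra.
Qed.

Lemma vanishingZ (a : R) f : vanishing f -> vanishing (fun x => a * f x).
Proof.
move=> Gf; apply: (@vanishing_le _ f f (a ^+ 2 + 1)) => //.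
- by rewrite ltr_wpDl// sqr_ge0.
- have mf : measurable_fun setT (fun x => a * f x) by apply: measurable_funM => //; exact: Gf.1.1.
  split => //; rewrite /sqint; under eq_integral do rewrite exprMn EFinM.
  rewrite ge0_integralZl//; last 3 first.
  + exact: measurable_sqr_EFin Gf.1.1.
  + by move=> x _; rewrite lee_fin sqr_ge0.
  + by rewrite lee_fin sqr_ge0.
  by rewrite -/(sqint mu f) (sqintE Gf.1) -EFinM ltry.
- move=> x y; rewrite -mulrBr exprMn.
  have := sqr_ge0 (f x - f y); have := sqr_ge0 a; move: ((_ - _) ^+ 2) (a ^+ 2) => u v; nra.
Qed.

(** [dirichlet_le_sqint] is uniform in [s], so the form of [f - g] is small for all times at once;
    only [g] decides how small [s] must be. *)
Lemma vanishing_approx f : isL2 mu f ->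
  (forall e : R, 0 < e -> exists2 g, vanishing g & (sqint mu (f \- g)%R <= e%:E)%E) -> vanishing f.
Proof.
move=> Lf H; split=> [|e e0]; first exact: Lf.
have [g Gg fg] := H (e / 16) ltac:(by rewrite divr_gt0).
have [d d0 Hd] := Gg.2 (e / 4) ltac:(by rewrite divr_gt0).
exists d => // s /andP[s0 sd].
apply: le_trans (@dirichlet_le s f g (f \- g) 2 _ Lf.1 Gg.1.1 (isL2B Lf Gg.1).1 _) _ => //.
  move=> x y /=; have := sqr_ge0 ((g x - g y) - ((f x - g x) - (f y - g y))); nra.
rewrite (_ : e = 2 * (e / 4 + 4 * (e / 16))); last by field.
rewrite EFinM lee_wpmul2l// EFinD; apply: leeD; first by apply: Hd; apply/andP.
apply: le_trans (dirichlet_le_sqint s0 (isL2B Lf Gg.1).1) _.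
by rewrite EFinM lee_wpmul2l.
Qed.

Lemma isL2_indic (A : set E) : measurable A -> (mu A < +oo)%E -> isL2 mu (\1_A).
Proof.
move=> mA Aoo; split; first exact: measurable_indic.
rewrite /sqint (_ : (fun x => _) = (fun x => (\1_A x)%:E)); first by rewrite integral_indic// setIT.
by apply/funext => x; rewrite indicE; case: (x \in A); rewrite ?expr1n ?expr0n.
Qed.

Definition box (a b : 'I_n -> R) : set E := [set x | forall i, `](a i), (b i)]%classic (x ord0 i)].

Lemma measurable_box a b : measurable (box a b).
Proof. exact: (@measurable_rV_forall R n (fun i => `](a i), (b i)]%classic)). Qed.

Lemma box_ltoo a b : (mu (box a b) < +oo)%E.
Proof.
apply: (@lebesgue_rV_box_ltoo R n (fun i => `](a i), (b i)]%classic)) => // i.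
by rewrite lebesgue_measure_itv/=; case: ifP => // _; rewrite ltry.
Qed.

Lemma indic_box a b x : \1_(box a b) x = \prod_(i < n) \1_(`](a i), (b i)]) (x ord0 i) :> R.
Proof.
rewrite indicE; case: (boolP (x \in box a b)) => [|].
  rewrite inE => xb; rewrite big1// => i _; rewrite indicE mem_set//; exact: xb.
move/negP => xb; have [i nxi] : exists i, ~ `](a i), (b i)]%classic (x ord0 i).
  by apply/not_existsP => H; apply: xb; rewrite inE => i; exact: contrapT (H i).
by rewrite (bigD1 i)//= indicE memNset// mul0r.
Qed.

Section vanishing_box.
Variables a b : 'I_n -> R.
Local Notation I i := (`](a i), (b i)]%classic : set R).
Local Notation B := (box a b).

Let mI i : measurable_fun [set: R] (\1_(I i) : R -> R).
Proof. by apply: measurable_indic. Qed.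

Let mIc i : measurable_fun [set: R] (\1_(~` I i) : R -> R).
Proof. by apply: measurable_indic; exact: measurableC. Qed.

(** Heat that starts in the box and ends outside the slab of coordinate [j]. Leaving the box means
    leaving one of these slabs, which reduces the estimate to one dimension. *)
Let leak j s (p : E * E) : R := \1_B p.1 * \1_(~` I j) (p.2 ord0 j) * heatK s (p.1 - p.2).

Let leak_ge0 j s p : (0 <= (leak j s p)%:E)%E.
Proof. by rewrite lee_fin /leak !indicE mulr_ge0 ?heatK_ge0// mulr_ge0. Qed.

Let mleak j s : measurable_fun [set: E * E] (fun p => (leak j s p)%:E).
Proof.
apply/measurable_EFinP; apply: measurable_funM; last exact: measurable_heatKB2.
apply: measurable_funM.
  apply: (@measurableT_comp _ _ _ _ _ _ (\1_B : E -> R)) => //.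
  by apply: measurable_indic; exact: measurable_box.
apply: (measurableT_comp (mIc j)).
exact: measurableT_comp (@measurable_rV _ R n j) measurable_snd.
Qed.

Let V j : R := \prod_(i < n | i != j) fine (leb (I i)).

Lemma box_leak j s : 0 < s ->
  (\int[mu]_x \int[mu]_y (leak j s (x, y))%:E <= (V j * (4 * Num.sqrt s))%:E)%E.
Proof.
move=> s0.
have mg := @measurable_gauss1 R s.
have mgx (x : R) : measurable_fun [set: R] (fun y => gauss1 s (x - y)).
  by apply: (measurableT_comp mg); exact: measurable_funB.
pose k (p : measurableTypeR R * measurableTypeR R) : R := \1_(~` I j) p.2 * gauss1 s ((p.1 : R) - p.2).
have mk : measurable_fun setT k.
  apply: measurable_funM; first exact: measurableT_comp (mIc j) measurable_snd.
  by apply: (measurableT_comp mg); apply: measurable_funB; [exact: measurable_fst|exact: measurable_snd].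
pose l (x : R) : R := \int[leb]_y (k (x, y)).
have lE x : ((l x)%:E = \int[leb]_y (\1_(~` I j) y * gauss1 s (x - y)%R)%:E)%E.
  rewrite /l /Rintegral fineK// ge0_fin_numE; last first.
    by apply: integral_ge0 => y _; rewrite lee_fin mulr_ge0 ?gauss1_ge0// indicE.
  apply: (@le_lt_trans _ _ (\int[leb]_y (gauss1 s (x - y))%:E)%E); last by rewrite integral_gauss1// ltry.
  apply: ge0_le_integral => //.
  - by move=> y _; rewrite lee_fin mulr_ge0 ?gauss1_ge0// indicE.
  - have : measurable_fun [set: R] (fun y => \1_(~` I j) y * gauss1 s (x - y)).
      exact: measurable_funM (mIc j) (mgx x).
    by move/measurable_EFinP.
  - by move/measurable_EFinP : (mgx x).
  - move=> y _; rewrite lee_fin /k /= ler_piMl ?gauss1_ge0// indicE; by case: (_ \in _).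
have l0 x : 0 <= l x by apply: Rintegral_ge0 => y _; rewrite mulr_ge0 ?gauss1_ge0// indicE.
have ml : measurable_fun [set: R] l by exact: (measurable_Rintegral2 (@lebesgue_sigma_finite R) mk).
pose phi x (i : 'I_n) (y : R) : R := (if i == j then \1_(~` I j) y else 1) * gauss1 s ((x : E) ord0 i - y).
have mphi x i : measurable_fun [set: R] (phi x i).
  by rewrite /phi; case: (i == j); apply: measurable_funM.
have phi0 x i y : 0 <= phi x i y.
  by rewrite mulr_ge0 ?gauss1_ge0//; case: ifP => // _; rewrite indicE.
pose psi (i : 'I_n) (y : R) : R := \1_(I i) y * (if i == j then l y else 1).
have mpsi i : measurable_fun [set: R] (psi i) by rewrite /psi; case: (i == j); apply: measurable_funM.
have psi0 i y : 0 <= psi i y.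
  by rewrite mulr_ge0 ?indicE//; case: ifP.
(* In the inner integral every coordinate but [j] integrates to 1 and coordinate [j] gives [l], so
   the outer integrand is a product again. *)
rewrite (_ : integral _ _ _ = \int[mu]_x (\prod_(i < n) psi i (x ord0 i))%:E)%E; last first.
  apply: eq_integral => x _.
  transitivity (\int[mu]_y ((\1_B x)%:E * (\prod_(i < n) phi x i (y ord0 i))%:E))%E.
    apply: eq_integral => y _; rewrite -EFinM /leak /= -mulrA; congr (_ * _)%:E.
    rewrite heatK_prod// /phi [RHS]big_split/=; congr (_ * _).
      rewrite (bigD1 j)//= eqxx big1 ?mulr1// => i ij; by rewrite (negbTE ij).
    by apply: eq_bigr => i _; rewrite !mxE.
  have mprod : measurable_fun setT (fun y : E => (\prod_(i < n) phi x i (y ord0 i))%:E).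
    apply/measurable_EFinP; apply: measurable_prod => i _.
    exact: (measurableT_comp (mphi x i) (@measurable_rV _ R n i)).
  rewrite ge0_integralZl//; last by move=> y _; rewrite lee_fin prodr_ge0.
  rewrite integral_rV_prod// (bigD1 j)//= big1 ?mule1; last first.
    move=> i ij; rewrite /phi (negbTE ij).
    by under eq_integral do rewrite mul1r; rewrite integral_gauss1.
  rewrite /phi eqxx -lE -EFinM; congr (_%:E).
  rewrite indic_box /psi big_split/=; congr (_ * _).
  by rewrite (bigD1 j)//= eqxx big1 ?mulr1// => i ij; rewrite (negbTE ij).
rewrite integral_rV_prod// (bigD1 j)//= muleC EFinM.
have Ioo i : leb (I i) \is a fin_num.
  by rewrite ge0_fin_numE// lebesgue_measure_itv/=; case: ifP => // _; rewrite ltry.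
rewrite (_ : (\prod_(i < n | i != j) _)%E = (V j)%:E); last first.
  rewrite /V -prodEFin; apply: eq_bigr => i ij; rewrite /psi (negbTE ij) fineK//.
  under eq_integral do rewrite mulr1.
  by rewrite integral_indic// setIT.
apply: lee_wpmul2l; first by rewrite lee_fin prodr_ge0// => i _; rewrite fine_ge0.
rewrite /psi eqxx; apply: le_trans (gauss1_leak (a j) (b j) s0).
rewrite le_eqVlt; apply/orP; left; apply/eqP; apply: eq_integral => x _.
rewrite EFinM lE -ge0_integralZl//.
- by apply: eq_integral => y _; rewrite -EFinM mulrA.
- have : measurable_fun [set: R] (fun y => \1_(~` I j) y * gauss1 s (x - y)).
    exact: measurable_funM (mIc j) (mgx x).
  by move/measurable_EFinP.
- by move=> y _; rewrite lee_fin mulr_ge0 ?gauss1_ge0// indicE.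
Qed.

(** A nonzero increment of the indicator means that one point is in the box and the other outside
    some slab; the squared increment is thus at most the sum, over the slabs and both directions, of
    the products of indicators in [leak]. *)
Lemma dirichlet_box s : 0 < s ->
  (dirichlet s (\1_B) <= ((\sum_(j < n) (V j + V j)) * (4 * Num.sqrt s))%:E)%E.
Proof.
move=> s0.
pose G (j : 'I_n) (p : E * E) : \bar R := (leak j s p)%:E.
pose G' (j : 'I_n) (p : E * E) : \bar R := (leak j s (p.2, p.1))%:E.
have mG' j : measurable_fun [set: E * E] (G' j).
  apply: (measurableT_comp (mleak j s)); apply: measurable_fun_pair => //.
have G'0 j p : (0 <= G' j p)%E by exact: leak_ge0.
have T1 j := box_leak j s0.
have T2 j : (\int[mu]_x \int[mu]_y G' j (x, y) <= (V j * (4 * Num.sqrt s))%:E)%E.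
  by rewrite (tonelli sf sf (mG' j) (G'0 j)); exact: T1.
have mGG j : measurable_fun setT (fun x : E => \int[mu]_y G j (x, y) + \int[mu]_y G' j (x, y))%E.
  by apply: emeasurable_funD; [exact: (measurable_tonelliF sf (mleak j s))|exact: (measurable_tonelliF sf (mG' j))].
have GG0 j (x : E) : (0 <= \int[mu]_y G j (x, y) + \int[mu]_y G' j (x, y))%E.
  by apply: adde_ge0; apply: integral_ge0 => y _; [exact: leak_ge0|exact: G'0].
apply: (@le_trans _ _ (\int[mu]_x \sum_(j < n) (\int[mu]_y G j (x, y) + \int[mu]_y G' j (x, y)))%E); last first.
  rewrite ge0_integral_sum//.
  rewrite mulr_suml -sumEFin; apply: lee_sum => j _.
  rewrite ge0_integralD//; last 4 first.
  - by move=> x _; apply: integral_ge0 => y _; exact: leak_ge0.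
  - exact: (measurable_tonelliF sf (mleak j s)).
  - by move=> x _; apply: integral_ge0 => y _; exact: G'0.
  - exact: (measurable_tonelliF sf (mG' j)).
  by rewrite mulrDl EFinD; apply: leeD; [exact: T1|exact: T2].
have mB : measurable_fun setT (\1_B : E -> R) by apply: measurable_indic; exact: measurable_box.
apply: ge0_le_integral => //.
- by move=> x _; apply: integral_ge0 => y _; exact: (D0 s _ (x, y)).
- exact: (measurable_tonelliF sf (mD s mB)).
- by apply: emeasurable_sum => j; exact: mGG.
move=> x _.
have mGx j : measurable_fun setT (fun y => G j (x, y)).
  by apply: (measurableT_comp (mleak j s)); exact: pair1_measurable.
have mG'x j : measurable_fun setT (fun y => G' j (x, y)).
  by apply: (measurableT_comp (mG' j)); exact: pair1_measurable.
rewrite (_ : \sum_(j < n) _ = \int[mu]_y \sum_(j < n) (G j (x, y) + G' j (x, y)))%E; last first.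
  rewrite ge0_integral_sum//; last 2 first.
  - by move=> j; exact: emeasurable_funD.
  - by move=> j y _; apply: adde_ge0; [exact: leak_ge0|exact: G'0].
  apply: eq_bigr => j _; rewrite ge0_integralD//.
  by move=> y _; exact: leak_ge0.
apply: ge0_le_integral => //.
- by move=> y _; exact: (D0 s _ (x, y)).
- exact: mD1.
- by apply: emeasurable_sum => j; exact: emeasurable_funD.
move=> y _; rewrite /G /G' /leak/=.
under eq_bigr do rewrite -EFinD (heatKC s y x) -mulrDl.
rewrite sumEFin lee_fin -mulr_suml ler_wpM2r ?heatK_ge0//.
have s0' (u v : E) : 0 <= \sum_(i < n) (\1_B u * \1_(~` I i) (v ord0 i) + \1_B v * \1_(~` I i) (u ord0 i)) :> R.
  by apply: sumr_ge0 => i _; rewrite !indicE addr_ge0// mulr_ge0.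
have key (u v : E) : u \in B -> v \notin B ->
  1 <= \sum_(i < n) (\1_B u * \1_(~` I i) (v ord0 i) + \1_B v * \1_(~` I i) (u ord0 i)) :> R.
  move=> uB /negP vB; have [i nxi] : exists i, ~ I i (v ord0 i).
    by apply/not_existsP => H; apply: vB; rewrite inE => i; exact: contrapT (H i).
  rewrite (bigD1 i)//= {1 2}/indic uB/= mem_set//= mul1r -addrA lerDl addr_ge0//.
  by apply: sumr_ge0 => k _; rewrite !indicE addr_ge0// mulr_ge0.
rewrite {1 2}/indic.
case: (boolP (x \in B)) => xB; case: (boolP (y \in B)) => yB /=.
- by rewrite subrr expr0n s0'.
- by rewrite subr0 expr1n; exact: key.
- rewrite sub0r sqrrN expr1n; apply: le_trans (key y x yB xB) _.
  by apply: ler_sum => i _; rewrite addrC.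
- by rewrite subrr expr0n s0'.
Qed.

Lemma vanishing_box : vanishing (\1_B).
Proof.
split; first by apply: isL2_indic; [exact: measurable_box|exact: box_ltoo].
move=> e e0.
pose C := (\sum_(j < n) (V j + V j)) * 4.
have V0 j : 0 <= V j by apply: prodr_ge0 => i _; rewrite fine_ge0.
have C0 : 0 <= C by rewrite mulr_ge0// sumr_ge0// => j _; rewrite addr_ge0.
have C1 : 0 < C + 1 by rewrite ltr_wpDl.
(* [C + 1] replaces [C], which can be 0. *)
exists ((e / (C + 1)) ^+ 2); first by rewrite exprn_gt0// divr_gt0.
move=> s /andP[s0 sd]; apply: le_trans (dirichlet_box s0) _.
rewrite lee_fin mulrA -/C.
have : Num.sqrt s <= e / (C + 1).
  rewrite -(ger0_norm (ltW (divr_gt0 e0 C1))) -sqrtr_sqr ler_sqrt; first exact: ltW.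
  by rewrite sqr_ge0.
rewrite ler_pdivlMr// => h; apply: le_trans h.
by rewrite mulrC ler_wpM2l ?sqrtr_ge0// lerDl.
Qed.

End vanishing_box.

(** Half-open, unlike [cube], so that its intersection with a half-open strip is a [box]. *)
Definition hcube k : set E := box (fun=> - k%:R) (fun=> k%:R).

Lemma measurable_hcube k : measurable (hcube k). Proof. exact: measurable_box. Qed.

Lemma hcubeP x : exists k0, forall k, (k0 <= k)%N -> hcube k x.
Proof.
pose M := (\sum_(i < n) `|x ord0 i|)%R.
exists (Num.truncn M).+1 => k k0 i; rewrite /= in_itv/=.
have xM : `|x ord0 i| <= M by rewrite /M (bigD1 i)//= lerDl sumr_ge0.
have Mk : M < k%:R by apply: lt_le_trans (truncnS_gt M) _; rewrite ler_nat.
by move: xM; rewrite ler_norml => /andP[? ?]; apply/andP; split; lra.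
Qed.

Lemma isL2_indic_hcube A k : measurable A -> isL2 mu (\1_(A `&` hcube k)).
Proof.
move=> mA; apply: isL2_indic; first exact: measurableI (measurable_hcube k).
apply: le_lt_trans (box_ltoo (fun=> - k%:R) (fun=> k%:R)).
by apply: le_measure; rewrite ?inE; [exact: measurableI (measurable_hcube k)|exact: measurable_hcube|exact: subIsetr].
Qed.

(** Cutting by cubes gives every measurable set a square-integrable indicator, so that complements
    stay in the class. *)
Definition vanishing_set : set (set E) :=
  [set A | measurable A /\ forall k, vanishing (\1_(A `&` hcube k))].

Lemma vanishing_setI A B : vanishing_set A -> vanishing_set B -> vanishing_set (A `&` B).
Proof.
move=> [mA GA] [mB GB]; have mAB := measurableI _ _ mA mB; split; first exact: mAB.
move=> k; apply: (vanishing_le ltr01 (isL2_indic_hcube k mAB) (GA k) (GB k)) => x y.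
rewrite mul1r !indicE !in_setI.
case: (x \in A); case: (x \in B); case: (x \in hcube k);
  case: (y \in A); case: (y \in B); case: (y \in hcube k) => /=; lra.
Qed.

Lemma vanishing_setC A : vanishing_set A -> vanishing_set (~` A).
Proof.
move=> [mA GA]; have mC := measurableC mA; split; first exact: mC.
move=> k; have := vanishingB (vanishing_box (fun=> - k%:R) (fun=> k%:R)) (GA k).
rewrite (_ : _ \- _ = \1_(~` A `&` hcube k))//.
apply/funext => x; rewrite /= -/(hcube k) !indicE !in_setI in_setC.
case: (x \in A); case: (x \in hcube k) => /=; ring.
Qed.

Lemma vanishing_setU A B : vanishing_set A -> vanishing_set B -> vanishing_set (A `|` B).
Proof.
move=> GA GB; rewrite -[_ `|` _]setCK setCU; apply: vanishing_setC.
by apply: vanishing_setI; exact: vanishing_setC.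
Qed.

Lemma vanishing_set0 : vanishing_set set0.
Proof. by split; [exact: measurable0|move=> k; rewrite set0I indic0; exact: vanishing0]. Qed.

Lemma sqint_approx f (h_ : nat -> E -> R) g : isL2 mu f -> (forall k : nat, measurable_fun setT (h_ k)) -> isL2 mu g ->
  (forall k x, `|f x - h_ k x| <= `|g x|) ->
  (forall x, h_ k x @[k --> \oo] --> f x) ->
  forall e : R, 0 < e -> exists k, (sqint mu (f \- h_ k)%R <= e%:E)%E.
Proof.
move=> Lf mh Lg fhg hf e e0.
pose u k x := ((f x - h_ k x) ^+ 2)%:E.
have mu_ k : measurable_fun setT (u k).
  by apply: measurable_sqr_EFin; apply: measurable_funB; [exact: Lf.1|exact: mh].
have u0 : (\int[mu]_x u k x)%E @[k --> \oo] --> (\int[mu]_x cst 0 x)%E.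
  apply: (@dominated_cvg _ _ _ mu setT _ u (cst 0%E) (fun x => (g x ^+ 2)%:E)) => //.
  - move=> x _; apply: cvg_EFin; first exact: nearW.
    have : f x - h_ k x @[k --> \oo] --> f x - f x by apply: cvgB; [exact: cvg_cst|exact: hf].
    rewrite subrr => h0.
    have : (f x - h_ k x) * (f x - h_ k x) @[k --> \oo] --> (0 * 0 : R) by exact: cvgM.
    by rewrite mulr0.
  - exact: integrable_sqr.
  - move=> k x _; rewrite /u /= ger0_norm ?sqr_ge0// lee_fin.
    rewrite -(real_normK (num_real (f x - _))) -(real_normK (num_real (g x))).
    by rewrite ler_pXn2r ?nnegrE//.
rewrite integral_cst// mul0e in u0.
move/fine_cvgP : u0 => [fin_ /cvgrPdist_lt /(_ e e0) H].
have [k [fk Hk]] : exists k, ((\int[mu]_x u k x)%E \is a fin_num) /\ `|0 - fine (\int[mu]_x u k x)%E| < e.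
  have [N _ HN] := filterI fin_ H; exists N; exact: (HN N (leqnn N)).
exists k; rewrite /sqint -[leLHS](fineK fk) lee_fin.
by apply/ltW; apply: le_lt_trans Hk; rewrite sub0r normrN ler_norm.
Qed.

Lemma vanishing_set_bigcup (A : (set E)^nat) : (forall i, vanishing_set (A i)) -> vanishing_set (\bigcup_i A i).
Proof.
move=> GA; have mA : measurable (\bigcup_i A i) by apply: bigcup_measurable => i _; exact: (GA i).1.
split; first exact: mA.
move=> k; apply: vanishing_approx; first exact: isL2_indic_hcube.
pose B m := \big[setU/set0]_(i < m) A i.
have GB m : vanishing_set (B m).
  rewrite /B; elim/big_ind : _ => [||i _]; [exact: vanishing_set0|exact: vanishing_setU|exact: GA].
move=> e e0.
have [|||m Hm] := @sqint_approx (\1_((\bigcup_i A i) `&` hcube k)) (fun m => \1_(B m `&` hcube k))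
   (\1_((\bigcup_i A i) `&` hcube k)) (isL2_indic_hcube k mA) _ (isL2_indic_hcube k mA) _ _ e e0.
- by move=> m; apply: measurable_indic; apply: measurableI (measurable_hcube k); exact: (GB m).1.
- move=> m x; rewrite !indicE !in_setI.
  have : x \in B m -> x \in \bigcup_i A i.
    by rewrite !inE /B -bigcup_mkord => -[i _ ?]; exists i.
  case: (x \in B m); case: (x \in \bigcup_i A i); case: (x \in hcube k) => //= H.
  + by rewrite subrr normr0.
  + by rewrite subrr normr0.
  + by have := H isT.
  + by rewrite subrr normr0.
  + by rewrite subr0.
  + by rewrite subrr normr0.
  + by rewrite subrr normr0.
  + by rewrite subrr normr0.
- move=> x; apply: cvg_near_cst.
  have [[i _ Ai]|nA] := pselect ((\bigcup_i A i) x).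
    near=> m; rewrite !indicE !in_setI.
    have -> : x \in \bigcup_i A i by apply/mem_set; exists i.
    suff -> : x \in B m by [].
    apply/mem_set; rewrite /B -bigcup_mkord; exists i => //=.
    by near: m; exists i.+1.
  near=> m; rewrite !indicE !in_setI.
  rewrite (memNset nA).
  suff -> : (x \in B m) = false by [].
  by apply/memNset; rewrite /B -bigcup_mkord => -[i _ ?]; apply: nA; exists i.
by exists (\1_(B m `&` hcube k)) => //; exact: (GB m).2.
Unshelve. all: by end_near. Qed.

(** The sets [Y] with this property form a sigma-algebra. It contains the half-open intervals, which
    generate the Borel sets, because their truncated preimages are boxes. *)
Lemma vanishing_set_coord (i : 'I_n) (Y : set R) : measurable Y ->
  vanishing_set ((fun x : E => x ord0 i) @^-1` Y).
Proof.
move=> mY.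
suff : [set Y : set (measurableTypeR R) | measurable Y] `<=`
    [set Y : set R | vanishing_set ((fun x : E => x ord0 i) @^-1` Y)] by apply.
apply: smallest_sub.
  split => /=.
  - by rewrite preimage_set0; exact: vanishing_set0.
  - by move=> A GA; rewrite setTD preimage_setC; exact: vanishing_setC.
  - by move=> A GA; rewrite preimage_bigcup; exact: vanishing_set_bigcup.
move=> _ [[a b] _ <-] /=.
split.
  rewrite -[_ @^-1` _]setTI; apply: (@measurable_rV _ R n i) => //.
move=> k.
have := vanishing_box (fun j => if j == i then Num.max a (- k%:R) else - k%:R)
                 (fun j => if j == i then Num.min b k%:R else k%:R).
set B := box _ _; rewrite (_ : B = (fun x : E => x ord0 i) @^-1` `]a, b] `&` hcube k)//.
apply/seteqP; split => x.
  move=> Bx; split.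
    by have := Bx i; rewrite /= eqxx !in_itv/= gt_max le_min => /andP[/andP[-> _] /andP[-> _]].
  move=> j; have := Bx j; rewrite /=; case: ifP => // _.
  by rewrite !in_itv/= gt_max le_min => /andP[/andP[_ ->] /andP[_ ->]].
move=> [/= xi xk] j; have := xk j; rewrite /=; case: ifPn => // /eqP ->.
move: xi; rewrite !in_itv/= gt_max le_min => /andP[-> ->] /andP[-> ->]//.
Qed.

Lemma vanishing_set_measurable A : measurable A -> vanishing_set A.
Proof.
move: A; apply: smallest_sub.
  split.
  - exact: vanishing_set0.
  - by move=> A GA; rewrite setTD; exact: vanishing_setC.
  - exact: vanishing_set_bigcup.
rewrite -bigcup_seq; apply: bigcup_sub => i _ _ [B mB <-].
by rewrite setTI; exact: vanishing_set_coord.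
Qed.

Import HBNNSimple.

Lemma vanishing_ge0 f : isL2 mu f -> (forall x, 0 <= f x) -> vanishing f.
Proof.
move=> Lf f0; apply: vanishing_approx => // e e0.
have mf : measurable_fun setT (EFin \o f) by apply/measurable_EFinP; exact: Lf.1.
have f0' x : setT x -> (0 <= (EFin \o f) x)%E by rewrite lee_fin.
pose g := nnsfun_approx measurableT mf.
(* The cutoff puts each level set in the form covered by [vanishing_set]; every point is eventually
   inside the cubes, so the limit is unchanged. *)
pose h k x := g k x * \1_(hcube k) x : R.
have gh k : vanishing (h k).
  rewrite (_ : h k = fun x => \sum_(y <- finmap.enum_fset (fset_set (range (g k)))) y * \1_((g k @^-1` [set y]) `&` hcube k) x).
    elim: (finmap.enum_fset (fset_set (range (g k)))) => [|y s IH].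
      rewrite (_ : (fun _ => _) = cst 0); first exact: vanishing0.
      by apply/funext => x; rewrite big_nil.
    under eq_fun do rewrite big_cons.
    apply: vanishingD IH; apply: vanishingZ.
    exact: (vanishing_set_measurable (measurable_sfunP _ _)).2.
  apply/funext => x; rewrite /h fimfunE fsbig_finite//= mulr_suml.
  by apply: eq_bigr => y _; rewrite indicI/= mulrA.
have gf k x : g k x <= f x by rewrite -lee_fin /g nnsfun_approxE; exact: (le_approx k f0' I).
have [|||k Hk] := @sqint_approx f h f Lf _ Lf _ _ e e0.
- by move=> k; exact: (gh k).1.1.
- move=> k x; rewrite (ger0_norm (f0 x)) /h ger0_norm; last first.
    rewrite subr_ge0; apply: le_trans (gf k x); by rewrite ler_piMr// indicE.
  by rewrite gerBl mulr_ge0// indicE.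
- move=> x.
  have c1 : EFin \o g^~ x @ \oo --> (EFin \o f) x by exact: cvg_nnsfun_approx.
  have c2 : g k x @[k --> \oo] --> f x by move/fine_cvgP : c1 => [].
  apply: cvg_trans c2; apply: near_eq_cvg.
  have [k0 Hk0] := hcubeP x.
  exists k0 => // k /= k0k; rewrite /h indicE mem_set ?mulr1//; exact: Hk0.
by exists (h k).
Qed.

Lemma vanishing_all f : isL2 mu f -> vanishing f.
Proof.
move=> Lf.
have mabs : measurable_fun setT (fun x => `|f x|) by apply: measurableT_comp => //; exact: Lf.1.
have mp : measurable_fun setT (fun x => (`|f x| + f x) / 2).
  by apply: measurable_funM => //; apply: measurable_funD => //; exact: Lf.1.
have mn : measurable_fun setT (fun x => (`|f x| - f x) / 2).
  by apply: measurable_funM => //; apply: measurable_funB => //; exact: Lf.1.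
have pm x : 0 <= (`|f x| + f x) / 2 /\ 0 <= (`|f x| - f x) / 2.
  by split; apply: divr_ge0 => //; [rewrite -lerBlDr sub0r -normrN ler_norm|rewrite subr_ge0 ler_norm].
have [Lp _] : isL2 mu (fun x => (`|f x| + f x) / 2) /\ l2 mu (fun x => (`|f x| + f x) / 2) <= l2 mu f.
  apply: isL2_le => // x; rewrite ger0_norm; last by have [] := pm x.
  by have := ler_norm (f x); lra.
have [Ln _] : isL2 mu (fun x => (`|f x| - f x) / 2) /\ l2 mu (fun x => (`|f x| - f x) / 2) <= l2 mu f.
  apply: isL2_le => // x; rewrite ger0_norm; last by have [] := pm x.
  by have := ler_norm (- f x); rewrite normrN; lra.
rewrite (_ : f = (fun x => (`|f x| + f x) / 2) \- (fun x => (`|f x| - f x) / 2)).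
  by apply: vanishingB; apply: vanishing_ge0 => // x; have [] := pm x.
by apply/funext => x /=; field.
Qed.

(** [plancherel_heat] speaks of positive times only; this lets [heat s f] stand for [f] at an
    arbitrarily small cost. *)
Lemma l2_heat_approx f e : isL2 mu f -> 0 < e ->
  exists2 s, 0 < s & l2 mu f <= l2 mu (heat s f) + e.
Proof.
move=> Lf e0; have [_ /(_ (e ^+ 2) (exprn_gt0 _ e0)) [d d0 Hd]] := vanishing_all Lf.
have s0 : 0 < d / 2 by rewrite divr_gt0.
exists (d / 2) => //.
have : l2 mu (heat (d / 2) f \- f) <= e.
  have : ((l2 mu (heat (d / 2) f \- f) ^+ 2)%:E <= (e ^+ 2)%:E)%E.
    apply: le_trans (l2_heat_sub_le s0 Lf) _; apply: Hd; apply/andP; split; lra.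
  by rewrite lee_fin ler_pXn2r// nnegrE ?l2_ge0// ltW.
have Lh := heat_isL2 s0 Lf.
have := l2B Lh (isL2B Lh Lf).
rewrite (_ : heat (d / 2) f \- (heat (d / 2) f \- f) = f); last by apply/funext => x /=; ring.
lra.
Qed.

End dirichlet.

(** * Quantitative unique continuation from a neighbourhood of infinity *)

Section translation.
Context {R : realType} {n : nat}.
Local Notation E := 'rV[R]_n.+1.
Local Notation mu := (@lebesgue_rV R n.+1).
Let sf : sigma_finite setT mu := lebesgue_rV_sigma_finite n.+1.
Implicit Types (f g v : E -> R) (s t h a : R).

Definition translate h f : E -> R := fun x => f (x + shiftv n h).

Definition tdiff h f : E -> R := f \- translate h f.

Lemma sqnormrV_shiftv h : sqnormrV (shiftv n h) = h ^+ 2 :> R.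
Proof.
rewrite /sqnormrV /dotrV big_ord_recl big1 ?addr0 => [|i _]; first by rewrite mxE eqxx.
by rewrite mxE /= mul0r.
Qed.

Lemma measurable_translate h f : measurable_fun setT f -> measurable_fun setT (translate h f).
Proof. by move=> mf; apply: (measurableT_comp mf); apply: measurable_rVD. Qed.

Lemma sqint_translate h f : measurable_fun setT f -> sqint mu (translate h f) = sqint mu f.
Proof.
move=> mf; rewrite /sqint -[RHS](@ge0_integral_rV_shift R n h)//.
  exact: measurable_sqr_EFin.
by move=> x; rewrite lee_fin sqr_ge0.
Qed.

Lemma isL2_translate h f : isL2 mu f -> isL2 mu (translate h f).
Proof.
move=> Lf; split; first exact: measurable_translate Lf.1.
by rewrite sqint_translate; [exact: Lf.2|exact: Lf.1].
Qed.

Lemma l2_translate h f : measurable_fun setT f -> l2 mu (translate h f) = l2 mu f.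
Proof. by move=> mf; rewrite /l2 sqint_translate. Qed.

Lemma Rintegral_translate h f : measurable_fun setT f ->
  \int[mu]_x f (x + shiftv n h) = \int[mu]_x f x.
Proof.
move=> mf; rewrite /Rintegral; congr fine.
have mF : measurable_fun setT (EFin \o f) by apply/measurable_EFinP.
rewrite [LHS]integralE [RHS]integralE; congr (_ - _)%E.
  have <- := @ge0_integral_rV_shift R n h _ (measurable_funepos mF) (fun x => funepos_ge0 _ x).
  by apply: eq_integral => x _; rewrite !funeposE.
have <- := @ge0_integral_rV_shift R n h _ (measurable_funeneg mF) (fun x => funeneg_ge0 _ x).
by apply: eq_integral => x _; rewrite !funenegE.
Qed.

Lemma heat_translate t h f : measurable_fun setT f -> heat t (translate h f) = translate h (heat t f).
Proof.
move=> mf; apply/funext => x; rewrite /translate !heatE.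
rewrite -[RHS](Rintegral_translate h).
  by apply: eq_Rintegral => y _; congr (_ * heatK _ _); rewrite opprD addrACA subrr addr0.
by apply: measurable_funM => //; exact: measurable_heatKB.
Qed.

Lemma isL2_tdiff h f : isL2 mu f -> isL2 mu (tdiff h f).
Proof. by move=> Lf; apply: isL2B Lf (isL2_translate h Lf). Qed.

Lemma heat_tdiff t h f : 0 < t -> isL2 mu f -> heat t (tdiff h f) = tdiff h (heat t f).
Proof.
move=> t0 Lf; rewrite /tdiff (heatB t0 Lf (isL2_translate h Lf)).
by rewrite (heat_translate t h Lf.1).
Qed.

(** Schur's test for a difference of two translated kernels, whose rows and columns are bounded by
    [integral_heatK_diff]. *)
Lemma l2_tdiff_heat t h f : 0 < t -> 0 < h -> isL2 mu f ->
  l2 mu (tdiff h (heat t f)) <= h * Num.sqrt (2 * t)^-1 * l2 mu f.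
Proof.
move=> t0 h0 Lf; pose w := shiftv n h : E.
pose k (p : E * E) : R := heatK t (p.1 - p.2) - heatK t (p.1 + w - p.2).
have mk : measurable_fun setT k.
  apply: measurable_funB; first exact: measurable_heatKB2.
  rewrite (_ : (fun p : E * E => _) = (fun p => heatK t (p.1 - (p.2 - w)))).
    apply: (@measurableT_comp _ _ _ _ _ _ (fun p : E * E => heatK t (p.1 - p.2)) _ (fun p : E * E => (p.1, p.2 - w))).
      exact: measurable_heatKB2.
    by apply: measurable_fun_pair => //; apply: measurable_rVB.
  by apply/funext => p; rewrite opprB addrA addrAC.
pose A := Num.sqrt (sqnormrV w / (2 * t)).
have AE : A = h * Num.sqrt (2 * t)^-1.
  by rewrite /A sqnormrV_shiftv sqrtrM ?sqr_ge0// sqrtr_sqr ger0_norm// ltW.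
have A0 : 0 < A by rewrite AE mulr_gt0// sqrtr_gt0 invr_gt0 mulr_gt0.
have kA1 x : (\int[mu]_y `|k (x, y)|%:E <= A%:E)%E.
  apply: le_trans (integral_heatK_diff x w t0); rewrite le_eqVlt; apply/orP; left; apply/eqP.
  by apply: eq_integral => y _; rewrite distrC.
have kA2 y : (\int[mu]_x `|k (x, y)|%:E <= A%:E)%E.
  rewrite /A -sqnormrVN; apply: le_trans (integral_heatK_diff y (- w) t0).
  rewrite le_eqVlt; apply/orP; left; apply/eqP.
  apply: eq_integral => x _; rewrite /k /= distrC (heatKC t x y) (heatKC t (x + w) y).
  by rewrite opprD addrA addrAC.
have i1 x := integrable_mul_heatK x t0 Lf.
have iB x : mu.-integrable setT (fun y => (f y * k (x, y))%:E).
  have := integrableB measurableT (i1 x) (i1 (x + w)).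
  by congr (integrable _ _ _); apply/funext => y; rewrite -EFinB -mulrBr.
have := (@schur_test _ _ _ mu sf k A mk A0 kA1 kA2 f Lf iB).2.
rewrite AE (_ : (fun x => _) = tdiff h (heat t f))//.
apply/funext => x; rewrite /tdiff /translate /= !heatE -RintegralB//; [|exact: i1|exact: i1].
by apply: eq_Rintegral => y _; rewrite -mulrBr.
Qed.

End translation.

(** * Approximation by translates and estimates on half-spaces *)

Section observability.
Context {R : realType} {n : nat}.
Local Notation E := 'rV[R]_n.+1.
Local Notation mu := (@lebesgue_rV R n.+1).
Implicit Types (f g v : E -> R) (s t h a q e : R).

(* The polynomial [1 - (1 - S)^m] in the translation [S] is divisible by [S], so
   that its values on a half-space only depend on the translated half-space. *)
Definition tpoly h m f : E -> R := f \- iter m (tdiff h) f.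

Lemma isL2_iter (U : (E -> R) -> (E -> R)) j f :
  (forall g, isL2 mu g -> isL2 mu (U g)) -> isL2 mu f -> isL2 mu (iter j U f).
Proof. by move=> HU Lf; elim: j => // j IH /=; apply: HU. Qed.

Lemma iter_comm (U V : (E -> R) -> (E -> R)) j f :
  (forall g, isL2 mu g -> isL2 mu (V g)) ->
  (forall g, isL2 mu g -> U (V g) = V (U g)) -> isL2 mu f ->
  U (iter j V f) = iter j V (U f).
Proof.
move=> LV UV Lf; elim: j => //= j <-; apply: UV; exact: isL2_iter.
Qed.

Lemma iter_heat s j f : 0 < s -> isL2 mu f ->
  iter j.+1 (heat s) f = heat (s *+ j.+1) f.
Proof.
move=> s0 Lf; elim: j => [|j IH]; first by rewrite mulr1n.
have sj : 0 < s *+ j.+1 by rewrite pmulrn_lgt0.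
by rewrite iterS IH (heat_semigroup s0 sj Lf) -mulrS.
Qed.

(** Differences [D] commute with the flow [P], so [D^j P^j] is [(D P)^j]: each difference is paired
    with its own time step and contributes a factor [q]. *)
Lemma l2_iter_tdiff_heat s h q j f : 0 < s -> 0 <= q ->
  (forall g, isL2 mu g -> l2 mu (tdiff h (heat s g)) <= q * l2 mu g) ->
  isL2 mu f -> l2 mu (iter j (tdiff h) (iter j (heat s) f)) <= q ^+ j * l2 mu f.
Proof.
move=> s0 q0 H; have LV g : isL2 mu g -> isL2 mu (heat s g) by exact: heat_isL2.
have LD g : isL2 mu g -> isL2 mu (tdiff h g) by exact: isL2_tdiff.
elim: j f => [|j IH] f Lf; first by rewrite expr0 mul1r.
rewrite [iter j.+1 (heat s) f]iterSr iterSr.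
have -> : tdiff h (iter j (heat s) (heat s f)) = iter j (heat s) (tdiff h (heat s f)).
  apply: iter_comm => //; last exact: LV.
  by move=> g Lg; rewrite heat_tdiff.
apply: le_trans (IH _ (LD _ (LV _ Lf))) _.
by rewrite exprSr -mulrA ler_wpM2l ?exprn_ge0// H.
Qed.

Lemma isL2_tpoly h m f : isL2 mu f -> isL2 mu (tpoly h m f).
Proof.
move=> Lf; apply: (isL2B Lf); apply: isL2_iter Lf => g; exact: isL2_tdiff.
Qed.

(** Telescoping, with [D = tdiff h] and [Q = 1 - D^m]: [P^(k+1) - Q^(k+1) P^(k+1)] is
    [P^k D^m P + (P^k - Q^k P^k) Q P]. The bounds [e] for [D^m P] and [1 + e] for [Q P] give the
    recursion solved by [(1 + e)^k - 1]. *)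
Lemma l2_sub_iter_tpoly (P : (E -> R) -> (E -> R)) h m e k v : 0 <= e ->
  (forall f, isL2 mu f -> isL2 mu (P f)) ->
  (forall f, isL2 mu f -> l2 mu (P f) <= l2 mu f) ->
  (forall f g, isL2 mu f -> isL2 mu g -> P (f \- g) = P f \- P g) ->
  (forall f, isL2 mu f -> P (tpoly h m f) = tpoly h m (P f)) ->
  (forall f, isL2 mu f -> l2 mu (iter m (tdiff h) (P f)) <= e * l2 mu f) ->
  isL2 mu v ->
  l2 mu (iter k P v \- iter k (tpoly h m) (iter k P v)) <= ((1 + e) ^+ k - 1) * l2 mu v.
Proof.
move=> e0 LP P1 PB PC PD.
have LD f : isL2 mu f -> isL2 mu (iter m (tdiff h) f).
  by apply: isL2_iter => g; exact: isL2_tdiff.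
have Lt f : isL2 mu f -> isL2 mu (tpoly h m f) by exact: isL2_tpoly.
have Li j f : isL2 mu f -> isL2 mu (iter j P f) by exact: isL2_iter.
have Lti j f : isL2 mu f -> isL2 mu (iter j (tpoly h m) f) by exact: isL2_iter.
have iB j f g : isL2 mu f -> isL2 mu g -> iter j P (f \- g) = iter j P f \- iter j P g.
  by move=> Lf Lg; elim: j => //= j ->; apply: PB; exact: Li.
have i1 j f : isL2 mu f -> l2 mu (iter j P f) <= l2 mu f.
  by move=> Lf; elim: j => //= j; apply: le_trans; apply: P1; exact: Li.
elim: k v => [|k IH] v Lv.
  rewrite expr0 subrr mul0r (_ : _ \- _ = cst 0); last by apply/funext => x /=; rewrite subrr.
  by rewrite /l2 /sqint; under eq_integral do rewrite expr0n; rewrite integral0 sqrtr0.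
have LPv := LP _ Lv; have LDv := LD _ LPv; have Lw := Lt _ LPv.
have -> : iter k.+1 P v \- iter k.+1 (tpoly h m) (iter k.+1 P v) =
  iter k P (iter m (tdiff h) (P v)) \+
  (iter k P (tpoly h m (P v)) \- iter k (tpoly h m) (iter k P (tpoly h m (P v)))).
  have -> : iter k.+1 (tpoly h m) (iter k.+1 P v) = iter k (tpoly h m) (iter k P (tpoly h m (P v))).
    rewrite iterSr; congr iter; rewrite iterSr; apply: iter_comm => //.
    by move=> g Lg; rewrite PC.
  rewrite {3}/tpoly (iB _ _ _ LPv LDv) -iterSr.
  by apply/funext => x /=; ring.
apply: le_trans (l2D (Li _ _ LDv) (isL2B (Li _ _ Lw) (Lti _ _ (Li _ _ Lw)))) _.
have h1 := le_trans (i1 k _ LDv) (PD _ Lv).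
have h2 : l2 mu (tpoly h m (P v)) <= (1 + e) * l2 mu v.
  by apply: le_trans (l2B LPv LDv) _; rewrite mulrDl mul1r lerD// ?P1// PD.
have h3 := IH _ Lw.
have c0 : 0 <= (1 + e) ^+ k - 1 by rewrite subr_ge0 exprn_ege1// lerDl.
have h4 := ler_wpM2l c0 h2.
apply: le_trans (lerD h1 (le_trans h3 h4)) _.
by rewrite exprS le_eqVlt; apply/orP; left; apply/eqP; ring.
Qed.

Definition half a f : E -> R := fun x => (if a < x ord0 ord0 then f x else 0).

Lemma measurable_half a f : measurable_fun setT f -> measurable_fun setT (half a f).
Proof.
move=> mf; apply: measurable_fun_if => //; last first.
  exact: measurable_funTS.
by apply: measurable_fun_ltr => //; exact: measurable_rV.
Qed.

Lemma half_L2 a f : isL2 mu f -> isL2 mu (half a f) /\ l2 mu (half a f) <= l2 mu f.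
Proof.
move=> Lf; apply: isL2_le => //; first exact: measurable_half Lf.1.
by move=> x; rewrite /half; case: ifP => // _; rewrite normr0.
Qed.

Lemma halfB a f g : half a (f \- g) = half a f \- half a g.
Proof. by apply/funext => x; rewrite /half /=; case: ifP => // _; rewrite subrr. Qed.

Lemma halfD a f g : half a (f \+ g) = half a f \+ half a g.
Proof. by apply/funext => x; rewrite /half /=; case: ifP => // _; rewrite addr0. Qed.

Lemma half_le a b f : a <= b -> isL2 mu f -> l2 mu (half b f) <= l2 mu (half a f).
Proof.
move=> ab Lf; have [La _] := half_L2 a Lf; apply: (isL2_le _ _ La).2.
  exact: measurable_half Lf.1.
move=> x; rewrite /half; case: ifPn => [bx|_]; last by rewrite normr0.
by rewrite (le_lt_trans ab bx).
Qed.

Lemma half_translate a h f : half a (translate h f) = translate h (half (a + h) f).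
Proof.
by apply/funext => x; rewrite /half /translate !mxE eqxx ltrD2r.
Qed.

Lemma l2_half_translate a h f : isL2 mu f ->
  l2 mu (half a (translate h f)) = l2 mu (half (a + h) f).
Proof.
by move=> Lf; rewrite half_translate l2_translate//; apply: measurable_half; exact: Lf.1.
Qed.

(** Translation by [h > 0] only reads [f] further inside the half-space, so each difference at most
    doubles the norm there. *)
Lemma l2_half_iter_tdiff a h m f : 0 < h -> isL2 mu f ->
  l2 mu (half a (iter m (tdiff h) f)) <= 2 ^+ m * l2 mu (half a f).
Proof.
move=> h0 Lf; elim: m => [|m IH]; first by rewrite mul1r.
have Lg : isL2 mu (iter m (tdiff h) f) by apply: isL2_iter Lf => g; exact: isL2_tdiff.
move: IH Lg; rewrite iterS; set g := iter m _ _ => IH Lg.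
rewrite {1}/tdiff halfB.
apply: le_trans (l2B (half_L2 a Lg).1 (half_L2 a (isL2_translate h Lg)).1) _.
rewrite (l2_half_translate _ _ Lg).
have : l2 mu (half (a + h) g) <= l2 mu (half a g) by apply: half_le Lg; rewrite lerDl ltW.
by rewrite exprS; move: IH; set X := 2 ^+ m; nra.
Qed.

(** [1 - (1 - S)^(m+1) = (1 - (1 - S)^m) + S (1 - S)^m]: every new term carries a translation, which
    moves the half-space by [h], and the costs add up to [2^m + 2^m]. *)
Lemma l2_half_tpoly a h m f : 0 < h -> isL2 mu f ->
  l2 mu (half a (tpoly h m f)) <= 2 ^+ m * l2 mu (half (a + h) f).
Proof.
move=> h0 Lf; elim: m => [|m IH].
  rewrite (_ : half _ _ = cst 0); last first.
    by apply/funext => x; rewrite /half /tpoly /= subrr; case: ifP.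
  rewrite {1}/l2 /sqint; under eq_integral do rewrite expr0n.
  by rewrite integral0 sqrtr0 mulr_ge0 ?l2_ge0.
have Lg : isL2 mu (iter m (tdiff h) f) by apply: isL2_iter Lf => g; exact: isL2_tdiff.
have -> : tpoly h m.+1 f = tpoly h m f \+ translate h (iter m (tdiff h) f).
  by apply/funext => x; rewrite /tpoly /= /tdiff /=; ring.
rewrite halfD.
apply: le_trans (l2D (half_L2 a (isL2_tpoly h m Lf)).1 (half_L2 a (isL2_translate h Lg)).1) _.
rewrite (l2_half_translate _ _ Lg).
have := l2_half_iter_tdiff (a + h) m h0 Lf.
by move: IH; rewrite exprS; set X := 2 ^+ m; lra.
Qed.

Lemma l2_half_iter_tpoly a h m k f : 0 < h -> isL2 mu f ->
  l2 mu (half a (iter k (tpoly h m) f)) <= 2 ^+ (m * k) * l2 mu (half (a + h *+ k) f).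
Proof.
move=> h0 Lf; elim: k a => [|k IH] a; first by rewrite muln0 expr0 mul1r mulr0n addr0.
have Lg : isL2 mu (iter k (tpoly h m) f) by apply: isL2_iter Lf => g; exact: isL2_tpoly.
rewrite iterS; apply: le_trans (l2_half_tpoly a m h0 Lg) _.
rewrite mulnS exprD -mulrA ler_wpM2l ?exprn_ge0//.
have -> : a + h *+ k.+1 = a + h + h *+ k by rewrite mulrS addrA.
exact: IH.
Qed.

Definition outside r f : E -> R := fun x => (if r <= `|x ord0 ord0| then f x else 0).

Lemma outside_L2 r f : isL2 mu f -> isL2 mu (outside r f) /\ l2 mu (outside r f) <= l2 mu f.
Proof.
move=> Lf; apply: isL2_le => //; last first.
  by move=> x; rewrite /outside; case: ifP => // _; rewrite normr0.
apply: measurable_fun_if => //; last exact: measurable_funTS Lf.1.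
apply: measurable_fun_ler => //; apply: measurableT_comp => //; exact: measurable_rV.
Qed.

(** [e] is the [m]-th power of the bound for one difference over one time step. The summand 1 next
    to [2 ^+ (m * k)] accounts for the region [x_1 <= - r], which is observed directly. *)
Lemma l2_heat_outside r t m k e v : 0 < r -> 0 < t -> (0 < m)%N -> (0 < k)%N -> isL2 mu v ->
  e = (2 * r * Num.sqrt (m%:R / (2 * t * k%:R))) ^+ m ->
  l2 mu (heat t v) <=
    ((1 + e) ^+ k - 1) * l2 mu v + (2 ^+ (m * k) + 1) * l2 mu (outside r (heat t v)).
Proof.
move=> r0 t0 m0 k0 Lv.
have m0' : 0 < m%:R :> R by rewrite ltr0n.
have k0' : 0 < k%:R :> R by rewrite ltr0n.
(* There are [m * k] equal time steps, [m] for each polynomial, and [k] translations that carry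
   [- r] to [r]. *)
pose s := t / (m%:R * k%:R); pose h := 2 * r / k%:R.
have s0 : 0 < s by rewrite divr_gt0// mulr_gt0.
have h0 : 0 < h by rewrite divr_gt0// mulr_gt0.
pose q := h * Num.sqrt (2 * s)^-1.
have q0 : 0 <= q by rewrite mulr_ge0 ?sqrtr_ge0// ltW.
have -> : 2 * r * Num.sqrt (m%:R / (2 * t * k%:R)) = q.
  rewrite /q /h -[2 * r / _ * _]mulrA; congr (_ * _).
  rewrite -[in RHS](ger0_norm (_ : 0 <= k%:R^-1)) ?invr_ge0 ?ltW//.
  rewrite -sqrtr_sqr -sqrtrM ?sqr_ge0//; congr Num.sqrt.
  by rewrite /s; field; rewrite !gt_eqF.
move=> eE; have e0 : 0 <= e by rewrite eE exprn_ge0.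
have Lp g : isL2 mu g -> isL2 mu (heat s g) by exact: heat_isL2.
pose P := iter m (heat s) : (E -> R) -> (E -> R).
have LP g : isL2 mu g -> isL2 mu (P g) by exact: isL2_iter.
have PE : iter k P v = heat t v.
  have -> : iter k P v = iter (m * k) (heat s) v.
    by rewrite /P -iterM mulnC.
  have mk1 : (m * k).-1.+1 = (m * k)%N by rewrite prednK// muln_gt0 m0.
  have sE : s *+ (m * k) = t.
    by rewrite -mulr_natr natrM /s divfK// mulf_neq0 ?gt_eqF.
  by rewrite -{1}mk1 (iter_heat _ s0 Lv) mk1 sE.
have LF : isL2 mu (heat t v) by exact: heat_isL2.
pose X := iter k (tpoly h m) (heat t v).
have LX : isL2 mu X by apply: isL2_iter LF => g; exact: isL2_tpoly.
have key1 : l2 mu (heat t v \- X) <= ((1 + e) ^+ k - 1) * l2 mu v.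
  rewrite /X -PE; apply: l2_sub_iter_tpoly => //.
  - move=> f Lf; rewrite /P; elim: (m) => //= j; apply: le_trans.
    by apply: (heat_l2 s0 _).2; exact: isL2_iter.
  - move=> f g Lf Lg; rewrite /P; elim: (m) => //= j ->.
    by apply: heatB => //; exact: isL2_iter.
  - move=> f Lf; have LD : isL2 mu (iter m (tdiff h) f).
      by apply: isL2_iter Lf => g; exact: isL2_tdiff.
    have PB j f' g : isL2 mu f' -> isL2 mu g ->
        iter j (heat s) (f' \- g) = iter j (heat s) f' \- iter j (heat s) g.
      by move=> Lf' Lg; elim: j => //= j ->; apply: heatB => //; exact: isL2_iter.
    rewrite /P {1}/tpoly PB// /tpoly; congr (_ \- _); apply/esym.
    apply: iter_comm => // g Lg; apply/esym; apply: iter_comm => //.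
      by move=> f'; exact: isL2_tdiff.
    by move=> f' Lf'; rewrite heat_tdiff.
  - move=> f Lf; rewrite eE; apply: l2_iter_tdiff_heat => // g Lg.
    exact: l2_tdiff_heat.
have key2 := l2_half_iter_tpoly (- r) m k h0 LF.
have hk : - r + h *+ k = r by rewrite -mulr_natr /h divfK ?gt_eqF//; ring.
rewrite hk -/X in key2.
have LX' := isL2B LF LX.
have [Lo _] := outside_L2 r LF.
have key3 : l2 mu (half r (heat t v)) <= l2 mu (outside r (heat t v)).
  apply: (isL2_le _ _ Lo).2; first exact: measurable_half LF.1.
  move=> x; rewrite /half /outside; case: ifPn => [rx|_]; last by rewrite normr0.
  by rewrite (le_trans (ltW rx) (ler_norm _)).
have key4 : l2 mu (heat t v \- half (- r) (heat t v)) <= l2 mu (outside r (heat t v)).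
  apply: (isL2_le _ _ Lo).2; first exact: measurable_funB LF.1 (measurable_half _ LF.1).
  move=> x; rewrite /half /outside /=; case: ifPn => [rx|]; first by rewrite subrr normr0.
  rewrite -leNgt subr0 => xr; rewrite (_ : r <= _)//.
  by rewrite lerNr in xr; apply: le_trans xr _; rewrite -normrN ler_norm.
have [Lh _] := half_L2 (- r) LF.
have key5 : l2 mu (half (- r) (heat t v)) <= l2 mu (heat t v \- X) + l2 mu (half (- r) X).
  have -> : half (- r) (heat t v) = half (- r) (heat t v \- X) \+ half (- r) X.
    by rewrite halfB; apply/funext => x /=; ring.
  apply: le_trans (l2D (half_L2 _ LX').1 (half_L2 _ LX).1) _.
  by rewrite lerD2r; exact: (half_L2 _ LX').2.
have key6 : l2 mu (heat t v) <= l2 mu (half (- r) (heat t v)) + l2 mu (heat t v \- half (- r) (heat t v)).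
  have -> : l2 mu (heat t v) = l2 mu (half (- r) (heat t v) \+ (heat t v \- half (- r) (heat t v))).
    by congr l2; apply/funext => x /=; ring.
  exact: l2D Lh (isL2B LF Lh).
have p0 : 0 <= 2 ^+ (m * k) :> R by rewrite exprn_ge0.
have := ler_wpM2l p0 key3; move: key1 key2 key4 key5 key6.
set Z := 2 ^+ (m * k); lra.
Qed.

End observability.

(** * Optimisation of the parameters *)

Section log_stability.
Context {R : realType}.

Lemma powR_inv (x a : R) : 0 <= x -> x^-1 `^ a = (x `^ a)^-1.
Proof. by move=> x0; rewrite -[in LHS]powR_inv1// -powRrM mulN1r powRN. Qed.

Lemma expR_sqr_ge (x : R) : 0 <= x -> x ^+ 2 <= 4 * expR x.
Proof.
move=> x0; have -> : expR x = expR (x / 2) ^+ 2 by rewrite expr2 -expRD; congr expR; field.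
have := expR_ge1Dx (x / 2); set y := expR _ => h; nra.
Qed.

Lemma exp2_le_expR j : 2 ^+ j <= expR j%:R :> R.
Proof.
rewrite -[j%:R]mulr1 expRM_natl; apply: lerXn2r; rewrite ?nnegrE ?expR_ge0//.
exact: expR_ge1Dx.
Qed.

Lemma expR1D_expn_le (x : R) k : 0 <= x -> (1 + x) ^+ k <= expR (k%:R * x).
Proof.
move=> x0; rewrite expRM_natl; apply: lerXn2r; rewrite ?nnegrE ?expR_ge0 ?addr_ge0//.
exact: expR_ge1Dx.
Qed.

Lemma expRB1_le (x : R) : expR x - 1 <= x * expR x.
Proof.
have := expR_ge1Dx (- x); rewrite expRN => h.
have e0 := expR_gt0 x.
have : (1 + - x) * expR x <= 1 by rewrite -ler_pdivlMr// div1r.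
lra.
Qed.

(** The excess over 1 is at most [z e^z] with [z = c m e^(-2m) <= c]. Multiplied by the [e^m] of the
    low frequencies it leaves a multiple of [m e^(-m)], whence a decay of order [1 / m]. *)
Lemma binom_gap_le (c m : nat) :
  expR m%:R * ((1 + expR (- (2 * m%:R))) ^+ (c * m) - 1) * m%:R <= 4 * (c%:R * expR c%:R) :> R.
Proof.
set x : R := m%:R; have x0 : 0 <= x by [].
pose z := (c * m)%:R * expR (- (2 * x)).
have z0 : 0 <= z by rewrite mulr_ge0 ?expR_ge0.
have h1 : (1 + expR (- (2 * x))) ^+ (c * m) - 1 <= z * expR z.
  apply: le_trans (expRB1_le z); rewrite lerD2r; exact: expR1D_expn_le (expR_ge0 _).
have xe : x * expR (- (2 * x)) <= 1.
  rewrite expRN ler_pdivrMr ?expR_gt0// mul1r; apply: le_trans (expR_ge1Dx _); lra.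
have zc : z <= c%:R by rewrite /z natrM -mulrA ler_piMr.
have h2 : z * expR z <= z * expR c%:R by rewrite ler_wpM2l// ler_expR.
have h3 : expR x * ((1 + expR (- (2 * x))) ^+ (c * m) - 1) * x <= expR x * (z * expR c%:R) * x.
  by rewrite ler_wpM2r// ler_wpM2l ?expR_ge0// (le_trans h1).
apply: le_trans h3 _.
have -> : expR x * (z * expR c%:R) * x = (c%:R * expR c%:R) * (x ^+ 2 * expR (- x)).
  rewrite /z natrM -/x (_ : - (2 * x) = - x - x); last by ring.
  rewrite expRD expRN; field; exact: lt0r_neq0 (expR_gt0 _).
rewrite mulrC ler_wpM2r ?mulr_ge0 ?expR_ge0//.
by rewrite expRN ler_pdivrMr ?expR_gt0// expR_sqr_ge.
Qed.

(** With [l = m / T] the cost of inverting the flow is [e^m], and three errors remain: the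
    observation, of order [e^(L/2) N] by the choice of [m]; the approximation, of order [1 / m]; the
    high frequencies, of order [m^(- beta)]. Here [L = - ln N], and [m] is of order [sqrt L]. *)
Lemma log_stability (beta M1 K T : R) (c : nat) :
  0 < beta -> 0 < M1 -> 0 <= K -> 0 < T ->
  exists kappa C : R, [/\ 0 < kappa < 1, 0 < C &
    forall U D N : R, 0 <= U -> U <= M1 -> 0 < N -> N < 1 ->
    (forall m, (0 < m)%N -> D <= (2 ^+ (m * (c * m)) + 1) * K * N +
        ((1 + expR (- (2 * m%:R))) ^+ (c * m) - 1) * U) ->
    (forall l, 0 <= l -> U <= expR (T * l) * D + (1 + l) `^ (- beta) * M1) ->
    U <= C * (- ln N) `^ (- kappa)].
Proof.
move=> beta0 M10 K0 T0.
(* The minimum with 1 reflects the [1 / m] bound on the approximation error; the half comes from [m]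
   being of order [sqrt L]. *)
pose g := Num.min beta 1; pose kap := g / 2.
have g0 : 0 < g by rewrite /g lt_min beta0 ltr01.
have g1 : g <= 1 by rewrite /g ge_min lexx orbT.
have gb : g <= beta by rewrite /g ge_min lexx.
(* For [m >= 1], [m^2 a <= L] bounds [2^(c m^2) e^m] by [e^(L/2)]. *)
pose a : R := 2 * (c%:R + 1).
have a1 : 1 <= a by rewrite /a; have := ler0n R c; lra.
have a0 : 0 < a by lra.
pose C0 : R := c%:R * expR c%:R.
have C00 : 0 <= C0 by rewrite mulr_ge0 ?expR_ge0.
have Ma : 0 < M1 * a `^ kap by rewrite mulr_gt0// powR_gt0.
(* The summands belong to the observation, to the approximation together with the high frequencies,
   and to the case of small [L]. *)
pose C := 4 * K + (4 * C0 * M1 + T `^ g * M1) * (4 * a) `^ kap + M1 * a `^ kap.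
have CM0 : 0 <= (4 * C0 * M1 + T `^ g * M1) * (4 * a) `^ kap.
  by rewrite mulr_ge0 ?powR_ge0// addr_ge0 ?mulr_ge0 ?powR_ge0 ?(ltW M10).
have kap01 : 0 < kap < 1 by apply/andP; split; rewrite /kap; lra.
exists kap, C; split; [exact: kap01|by rewrite /C; lra|].
move=> U D N U0 UM N0 N1 HD HU.
pose L := - ln N.
have L0 : 0 < L by rewrite oppr_gt0 ln_lt0// N0.
have NE : N = expR (- L) by rewrite opprK lnK.
rewrite -/L.
have Lk0 : 0 < L `^ (- kap) by rewrite powR_gt0.
(* For [L < a] no [m >= 1] satisfies [m^2 a <= L], and the a priori bound [M1] suffices. *)
have [La|aL] := ltP L a.
  apply: le_trans UM _.
  apply: (@le_trans _ _ (M1 * a `^ kap * L `^ (- kap))); last first.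
    by rewrite ler_wpM2r ?(ltW Lk0)// /C; lra.
  rewrite -mulrA ler_peMr ?(ltW M10)// powRN -ler_pdivrMr ?invr_gt0 ?powR_gt0//.
  rewrite invrK mul1r; apply: ge0_ler_powR; rewrite ?nnegrE; lra.
pose y : R := Num.sqrt (L / a).
have La0 : 0 < L / a by rewrite divr_gt0.
have y2 : y ^+ 2 = L / a by rewrite sqr_sqrtr// ltW.
have y1 : 1 <= y.
  have : 1 <= L / a by rewrite ler_pdivlMr// mul1r.
  by move/ler_wsqrtr; rewrite sqrtr1.
pose m := Num.truncn y.
have [my ym] : m%:R <= y /\ y < m.+1%:R.
  have y0 : 0 <= y by lra.
  by have /andP[] := truncn_itv y0; split.
have m0 : (0 < m)%N.
  by rewrite lt0n; apply/eqP => m0; move: ym; rewrite m0 ltNge y1.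
have x1 : 1 <= m%:R :> R by rewrite ler1n.
move: (HD m m0) (HU (m%:R / T)) (binom_gap_le c m).
rewrite -natr1 in ym.
have x2a : (m * m)%:R * a <= L.
  by rewrite -ler_pdivlMr// -y2 natrM -expr2; apply: lerXn2r; rewrite ?nnegrE; lra.
(* [y < m + 1 <= 2 m]: rounding down loses at most a factor 2. *)
have x2b : L / (4 * a) <= m%:R ^+ 2.
  have -> : L / (4 * a) = (y / 2) ^+ 2 by rewrite expr_div_n y2; field; rewrite gt_eqF.
  by apply: lerXn2r; rewrite ?nnegrE; lra.
have p2 : (2 ^+ (m * (c * m)) + 1) * expR m%:R <= 2 * expR (L / 2) :> R.
  have -> : 2 * expR (L / 2) = 2 * expR (L / 2 - m%:R) * expR m%:R.
    by rewrite -mulrA -expRD subrK.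
  rewrite ler_wpM2r ?expR_ge0//.
  have : 2 ^+ (m * (c * m)) <= expR (L / 2 - m%:R) :> R.
    apply: le_trans (exp2_le_expR _) _; rewrite ler_expR.
    move: x2a; rewrite /a mulnCA !natrM; move: x1; set x : R := m%:R => x1; nra.
  have : 1 <= 2 ^+ (m * (c * m)) :> R by rewrite exprn_ege1// ler1n.
  by move: (2 ^+ _) (expR _) => Z Y; lra.
set b := (_ ^+ (c * m) - 1).
have b0 : 0 <= b by rewrite subr_ge0 exprn_ege1// lerDl expR_ge0.
rewrite mulrCA divff ?gt_eqF// mulr1.
set x : R := m%:R in x1 x2b p2 *.
set Z : R := 2 ^+ (m * (c * m)) in p2 *.
rewrite -/b; clearbody Z b x; move=> hD hU hb.
have {}hU : U <= expR x * D + (1 + x / T) `^ (- beta) * M1.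
  exact: hU (divr_ge0 (le_trans ler01 x1) (ltW T0)).
have xg0 : 0 < x `^ (- g) by rewrite powR_gt0//; lra.
have q1 : (1 + x / T) `^ (- beta) <= T `^ g * x `^ (- g).
  have xT : 0 < x / T by rewrite divr_gt0//; lra.
  apply: (@le_trans _ _ ((1 + x / T) `^ (- g))); first by apply: ler_powR; lra.
  rewrite !powRN.
  have -> : T `^ g * (x `^ g)^-1 = ((x / T) `^ g)^-1.
    rewrite powRM ?invr_ge0 ?(ltW T0)//; last lra.
    by rewrite powR_inv ?(ltW T0)// invfM invrK mulrC.
  rewrite lef_pV2 ?posrE ?powR_gt0//; last lra.
  apply: ge0_ler_powR; rewrite ?nnegrE; lra.
have q2 : expR x * b <= 4 * C0 * x `^ (- g).
  have : expR x * b <= 4 * C0 / x by rewrite ler_pdivlMr//; lra.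
  move=> h; apply: le_trans h _; rewrite ler_wpM2l//; first by rewrite mulr_ge0.
  rewrite powRN lef_pV2 ?posrE ?powR_gt0//; [|lra|lra].
  by rewrite -[leRHS]powRr1; [apply: ler_powR|lra].
have q3 : x `^ (- g) <= (4 * a) `^ kap * L `^ (- kap).
  have -> : x `^ (- g) = ((x ^+ 2) `^ kap)^-1.
    rewrite -powR_mulrn; last lra.
    by rewrite -powRrM /kap powRN; congr (_ `^ _)^-1; field.
  have -> : (4 * a) `^ kap * L `^ (- kap) = ((L / (4 * a)) `^ kap)^-1.
    have a40 : 0 <= 4 * a by lra.
    by rewrite [(L / _) `^ kap]powRM ?invr_ge0 ?(ltW L0)// powR_inv// powRN invfM invrK mulrC.
  have La40 : 0 < L / (4 * a) by rewrite divr_gt0//; lra.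
  have x20 : 0 < x ^+ 2 by rewrite exprn_gt0//; lra.
  rewrite lef_pV2 ?posrE ?powR_gt0//.
  apply: ge0_ler_powR; rewrite ?nnegrE ?(ltW La40) ?(ltW x20)//.
  by case/andP : kap01 => /ltW.
(* The cost uses up half of the smallness of [N = e^(-L)]; the remaining [e^(-L/2)] beats any power
   of [L]. *)
have q4 : expR (L / 2) * N <= 2 * L `^ (- kap).
  rewrite NE -expRD (_ : L / 2 - L = - (L / 2)); last by field.
  apply: (@le_trans _ _ (2 / L)).
    rewrite expRN -[2 / L]invrK invf_div lef_pV2 ?posrE ?expR_gt0 ?divr_gt0//.
    by apply: le_trans (expR_ge1Dx _); lra.
  rewrite ler_wpM2l// powRN lef_pV2 ?posrE ?powR_gt0//.
  by rewrite -[leRHS]powRr1 ?(ltW L0)//; apply: ler_powR; [lra|case/andP : kap01 => _ /ltW].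
have ex0 := expR_gt0 x.
have KN0 : 0 <= K * N by rewrite mulr_ge0// ltW.
have r1 : expR x * D <= 4 * K * L `^ (- kap) + 4 * C0 * M1 * x `^ (- g).
  apply: (@le_trans _ _ (expR x * ((Z + 1) * K * N + b * U))).
    by rewrite ler_wpM2l// ltW.
  rewrite mulrDr; apply: lerD.
    have -> : expR x * ((Z + 1) * K * N) = ((Z + 1) * expR x) * (K * N) by ring.
    apply: le_trans (ler_wpM2r KN0 p2) _.
    have := ler_wpM2l K0 q4; set A := expR (L / 2); set B := L `^ _; lra.
  rewrite mulrA; apply: (@le_trans _ _ (expR x * b * M1)).
    by rewrite ler_wpM2l// mulr_ge0// ltW.
  by rewrite [leRHS]mulrAC ler_wpM2r// ltW.
have r2 : (1 + x / T) `^ (- beta) * M1 <= T `^ g * M1 * x `^ (- g).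
  by rewrite mulrAC ler_wpM2r// ltW.
have r3 : (4 * C0 * M1 + T `^ g * M1) * x `^ (- g) <=
    (4 * C0 * M1 + T `^ g * M1) * (4 * a) `^ kap * L `^ (- kap).
  rewrite -[leRHS]mulrA ler_wpM2l// addr_ge0 ?mulr_ge0 ?powR_ge0 ?(ltW M10)//.
have r4 : 0 <= M1 * a `^ kap * L `^ (- kap) by rewrite mulr_ge0 ?(ltW Ma) ?(ltW Lk0).
rewrite /C 2!mulrDl; move: r1 r2 r3 r4 hU.
set A1 := expR x * D; set A2 := _ `^ (- beta) * M1; set A3 := x `^ (- g); set A4 := L `^ _.
lra.
Qed.

(** If [U > 0], a suitable [N = expR (- L)] makes the right-hand side [U / 2]. This serves the
    vanishing observation, for which the estimate holds with every [N] in the open unit interval. *)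
Lemma log_modulus_limit (U C kap : R) : 0 <= U -> 0 < C -> 0 < kap ->
  (forall N, 0 < N < 1 -> U <= C * (- ln N) `^ (- kap)) -> U = 0.
Proof.
move=> U0 C0 k0 H; apply/eqP; apply: contraT => Un0.
have {Un0} {}U0 : 0 < U by rewrite lt_neqAle eq_sym Un0.
pose L := (2 * C / U) `^ kap^-1.
have CU0 : 0 < 2 * C / U by rewrite divr_gt0// mulr_gt0.
have L0 : 0 < L by rewrite powR_gt0.
have eL : 0 < expR (- L) < 1 by rewrite expR_gt0 expR_lt1 oppr_lt0.
have := H _ eL; rewrite expRK opprK.
have -> : L `^ (- kap) = U / (2 * C).
  rewrite powRN /L -powRrM mulVf ?gt_eqF// powRr1 ?invf_div// ltW//.
have -> : C * (U / (2 * C)) = U / 2 by field; rewrite gt_eqF.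
lra.
Qed.

End log_stability.

(** Nonnegative integrals are suprema over simple functions below, so the comparison covers
    arbitrary functions, among them the cylinder integrand over [omega]. *)
Lemma integral_monotone d (T : measurableType d) (R : realType) (m : {measure set T -> \bar R})
    (f g : T -> \bar R) : (forall x, 0 <= f x)%E -> (forall x, f x <= g x)%E ->
  (\int[m]_x f x <= \int[m]_x g x)%E.
Proof.
move=> f0 fg; have g0 x : (0 <= g x)%E := le_trans (f0 x) (fg x).
rewrite !ge0_integralTE//; apply: ereal_sup_le => _ [h hf <-]; exists h => // x.
exact: le_trans (hf x) (fg x).
Qed.

Lemma le_add_of_sqr (R : realType) (x y z : R) : 0 <= x -> 0 <= y -> 0 <= z ->
  x ^+ 2 <= y ^+ 2 + z ^+ 2 -> x <= y + z.
Proof.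
move=> x0 y0 z0 h; have yz0 : 0 <= y * z by rewrite mulr_ge0.
by rewrite -(@ler_pXn2r _ 2)// ?nnegrE ?addr_ge0//; move: h; rewrite sqrrD; lra.
Qed.

(** * Interpolation between the heat flow and the Sobolev norm *)

Section fourier_weights.
Context {R : realType} {n : nat}.
Local Notation E := 'rV[R]_n.
Local Notation mu := (@lebesgue_rV R n).
Implicit Types (f : E -> R) (g : (E -> R) * (E -> R)).

Lemma weighted_norm_lt (s : R) g (M : R) : 0 < M -> (weighted_norm s g < M%:E)%E ->
  (\int[mu]_xi ((1 + sqnormrV xi) `^ s * (g.1 xi ^+ 2 + g.2 xi ^+ 2))%:E <= (M ^+ 2)%:E)%E.
Proof.
move=> M0; rewrite /weighted_norm; set I := integral _ _ _.
have I0 : (0 <= I)%E.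
  by apply: integral_ge0 => x _; rewrite lee_fin mulr_ge0 ?powR_ge0// addr_ge0 ?sqr_ge0.
case: I I0 => [i i0| _|//].
- rewrite poweR_EFin lte_fin lee_fin powR12_sqrt// => h.
  by rewrite -[leLHS]sqr_sqrtr//; apply: lerXn2r; rewrite ?nnegrE ?sqrtr_ge0 ?(ltW M0)// ltW.
- by rewrite poweRyr ?invr_eq0 ?pnatr_eq0//.
Qed.

(** The inequality on the multipliers is multiplied by the squared modulus of the transform and
    integrated. The multiplier [gaussW s] on the left is at most 1, so the bound does not depend on
    [s]. *)
Lemma heat_sobolev_le (a b c s t M : R) f g :
  0 <= a -> 0 <= b -> 0 < s -> 0 < t -> 0 < M -> isL2 mu f -> L2_fourier f g ->
  (weighted_norm c g < M%:E)%E ->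
  (forall x : R, 0 <= x -> 1 <= a * expR (- (2 * t * x)) + b * (1 + x) `^ c) ->
  l2 mu (heat s f) ^+ 2 <= a * l2 mu (heat t f) ^+ 2 + b * M ^+ 2.
Proof.
move=> a0 b0 s0 t0 M0 Lf Fg /(weighted_norm_lt M0) hW hab.
have [/isL2P L1 /isL2P L2 _ _] := Fg.
have E1 := plancherel_heat s0 Lf Fg; have E2 := plancherel_heat t0 Lf Fg.
have Ls1 := (isL2_gaussW s0 L1).1; have Ls2 := (isL2_gaussW s0 L2).1.
have Lt1 := (isL2_gaussW t0 L1).1; have Lt2 := (isL2_gaussW t0 L2).1.
(* This moves the goal to the extended reals, where nonnegative integrals are added and compared
   without integrability conditions. *)
have real (A B C D X Y : R) (A' B' C' D' : \bar R) : A + B = X -> C + D = Y ->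
    A' = A%:E -> B' = B%:E -> C' = C%:E -> D' = D%:E ->
    (A' + B' <= a%:E * (C' + D') + b%:E * (M ^+ 2)%:E)%E -> X <= a * Y + b * M ^+ 2.
  by move=> <- <- -> -> -> ->; rewrite -!EFinD lee_fin.
apply: (real _ _ _ _ _ _ _ _ _ _ E1 E2 (sqintE Ls1) (sqintE Ls2) (sqintE Lt1) (sqintE Lt2)).
clear E1 E2.
have mq (h : E -> R) : isL2 mu h -> measurable_fun setT (fun x => (h x ^+ 2)%:E).
  by move=> Lh; apply: measurable_sqr_EFin; exact: Lh.1.
have q0 (h : E -> R) x : setT x -> (0 <= (h x ^+ 2)%:E)%E by move=> _; rewrite lee_fin sqr_ge0.
have sqD (h k : E -> R) : isL2 mu h -> isL2 mu k ->
    (sqint mu h + sqint mu k = \int[mu]_x ((h x ^+ 2)%:E + (k x ^+ 2)%:E))%E.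
  by move=> Lh Lk; rewrite ge0_integralD//; [exact: q0|exact: mq|exact: q0|exact: mq].
rewrite (sqD _ _ Ls1 Ls2) (sqD _ _ Lt1 Lt2).
have mS (h k : E -> R) : isL2 mu h -> isL2 mu k ->
    measurable_fun setT (fun x => (h x ^+ 2)%:E + (k x ^+ 2)%:E)%E.
  by move=> Lh Lk; apply: emeasurable_funD; exact: mq.
have mw : measurable_fun [set: E] (fun x => (1 + sqnormrV x) `^ c).
  apply: (measurableT_comp (measurable_powR _)); apply: measurable_funD => //.
  exact: measurable_dotrV.
pose w x := ((1 + sqnormrV x) `^ c * (g.1 x ^+ 2 + g.2 x ^+ 2))%:E.
have mW : measurable_fun setT w.
  apply/measurable_EFinP; apply: measurable_funM => //.
  by apply: measurable_funD; apply: measurable_funX; [exact: L1.1|exact: L2.1].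
have w0 x : setT x -> (0 <= w x)%E.
  by move=> _; rewrite lee_fin mulr_ge0 ?powR_ge0// addr_ge0 ?sqr_ge0.
have S0 (h k : E -> R) x : setT x -> (0 <= (h x ^+ 2)%:E + (k x ^+ 2)%:E)%E.
  by move=> _; rewrite adde_ge0 ?lee_fin ?sqr_ge0.
apply: (@le_trans _ _ (a%:E * \int[mu]_x (((gaussW t x * g.1 x) ^+ 2)%:E + ((gaussW t x * g.2 x) ^+ 2)%:E)
    + b%:E * \int[mu]_x w x)%E); last first.
  by apply: leeD => //; apply: lee_wpmul2l.
have Z (u : E -> \bar R) r : 0 <= r -> measurable_fun setT u ->
    (forall x, setT x -> (0 <= u x)%E) ->
    (r%:E * \int[mu]_x u x = \int[mu]_x (r%:E * u x))%E.
  by move=> r0 mu_ u0; rewrite ge0_integralZl.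
rewrite (Z _ _ a0 (mS _ _ Lt1 Lt2) (S0 _ _)) (Z _ _ b0 mW w0).
rewrite -ge0_integralD//; first last.
- by apply: emeasurable_funM.
- by move=> x _; apply: mule_ge0; [rewrite lee_fin|exact: w0].
- by apply: emeasurable_funM => //; exact: mS.
- by move=> x _; apply: mule_ge0; [rewrite lee_fin|apply: adde_ge0; rewrite lee_fin sqr_ge0].
apply: integral_monotone => x; first by apply: adde_ge0; rewrite lee_fin sqr_ge0.
rewrite /w -!EFinD lee_fin !exprMn -!mulrDr.
have p0 : 0 <= g.1 x ^+ 2 + g.2 x ^+ 2 by rewrite addr_ge0 ?sqr_ge0.
rewrite !mulrA -mulrDl ler_wpM2r//.
have sx := sqnormrV_ge0 x.
have -> : a * gaussW t x * gaussW t x = a * expR (- (2 * t * sqnormrV x)).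
  by rewrite /gaussW -mulrA -expRD; congr (_ * expR _); ring.
apply: le_trans (hab _ sx).
by rewrite expr_le1// ?gaussW_ge0// gaussW_le1.
Qed.

(** Uniformity in [s] allows [heat s f] to approach [f]. The coefficients enter squared so that
    taking the root gives a sum of norms. *)
Lemma l2_sobolev_le (a b c t M : R) f g :
  0 <= a -> 0 <= b -> 0 < t -> 0 < M -> isL2 mu f -> L2_fourier f g ->
  (weighted_norm c g < M%:E)%E ->
  (forall x : R, 0 <= x -> 1 <= a ^+ 2 * expR (- (2 * t * x)) + b ^+ 2 * (1 + x) `^ c) ->
  l2 mu f <= a * l2 mu (heat t f) + b * M.
Proof.
move=> a0 b0 t0 M0 Lf Fg hW hab.
have d0 : 0 <= l2 mu (heat t f) by exact: l2_ge0.
apply/ler_addgt0Pr => e e0.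
have [s s0 hs] := l2_heat_approx Lf e0; apply: le_trans hs _; rewrite lerD2r.
have h := heat_sobolev_le (sqr_ge0 a) (sqr_ge0 b) s0 t0 M0 Lf Fg hW hab.
apply: le_add_of_sqr; [exact: l2_ge0|exact: mulr_ge0|exact: mulr_ge0 b0 (ltW M0)|].
by rewrite !exprMn; exact: h.
Qed.

Lemma heat_l2_antitone s t f : 0 < s -> s <= t -> isL2 mu f ->
  l2 mu (heat t f) <= l2 mu (heat s f).
Proof.
move=> s0; rewrite le_eqVlt => /orP[/eqP->//|st] Lf.
have ts : 0 < t - s by rewrite subr_gt0.
have := (heat_l2 ts (heat_isL2 s0 Lf)).2.
by rewrite (heat_semigroup ts s0 Lf) subrK.
Qed.

(** Low frequencies [x <= l] make the first term at least 1, high frequencies the second. *)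
Lemma frequency_split (beta t l x : R) : 0 < beta -> 0 < t -> 0 <= l -> 0 <= x ->
  1 <= expR (t * l) ^+ 2 * expR (- (2 * t * x)) +
       ((1 + l) `^ (- beta)) ^+ 2 * (1 + x) `^ (2 * beta).
Proof.
move=> beta0 t0 l0 x0.
have [xl|lx] := leP x l.
  rewrite ler_wpDr ?mulr_ge0 ?sqr_ge0 ?powR_ge0//.
  have h : 0 <= t * (l - x) by rewrite mulr_ge0 ?subr_ge0// ltW.
  rewrite expr2 -!expRD; apply: le_trans (expR_ge1Dx _).
  by move: h; rewrite mulrBr; lra.
rewrite ler_wpDl ?mulr_ge0 ?sqr_ge0 ?expR_ge0//.
have l1 : 0 < 1 + l by lra.
have p0 : 0 < (1 + l) `^ (2 * beta) by rewrite powR_gt0.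
have -> : ((1 + l) `^ (- beta)) ^+ 2 = ((1 + l) `^ (2 * beta))^-1.
  rewrite -powR_mulrn ?powR_ge0// -powRrM -powRN; congr (_ `^ _); ring.
rewrite mulrC ler_pdivlMr// mul1r.
apply: ge0_ler_powR; rewrite ?nnegrE; [|lra|lra|lra].
by rewrite mulr_ge0// ltW.
Qed.

End fourier_weights.

Lemma rV_tonelli2 (R : realType) n (f : 'rV[R]_n * measurableTypeR R -> \bar R) :
  measurable_fun setT f -> (forall p, 0 <= f p)%E ->
  (\int[(lebesgue_rV n \x @lebesgue_measure R)%E]_p f p =
   \int[@lebesgue_measure R]_t \int[lebesgue_rV n]_x f (x, t))%E.
Proof.
move=> mf f0; have [m' ->] := sigma_finite_measureE (@lebesgue_rV_sigma_finite R n).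
by rewrite fubini_tonelli2.
Qed.

Lemma compact_complement_outside (R : realType) n (omega : set 'rV[R]_n.+1) :
  compact (~` omega) ->
  exists2 r, 0 < r & forall x : 'rV[R]_n.+1, r <= `|x ord0 ord0| -> omega x.
Proof.
move=> /compact_bounded [M [_ HM]].
have M1 : M < `|M| + 1 by apply: le_lt_trans (ler_norm M) _; rewrite ltrDl.
(* One more than the bound [|M| + 1] on the sup norm over the complement, to contradict it
   strictly. *)
exists (`|M| + 2); first by rewrite ltr_wpDl.
move=> x xr; apply: contrapT => nx; have := HM _ M1 x nx.
apply/negP; rewrite -ltNge; apply: (@lt_le_trans _ _ `|x ord0 ord0|).
  by apply: lt_le_trans xr; lra.
rewrite [in leRHS]/Num.norm/= mx_normrE; apply: le_trans (le_bigmax _ _ (ord0, ord0)) => //.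
Qed.

(** * Lower bound for the observation *)

Section cylinder.
Context {R : realType} {n : nat}.
Local Notation E := 'rV[R]_n.+1.
Local Notation mu := (@lebesgue_rV R n.+1).
Local Notation leb := (@lebesgue_measure R).

Lemma measurable_heat_flow (f : E -> R) : measurable_fun setT f ->
  measurable_fun setT (fun p : E * measurableTypeR R => heat p.2 f p.1).
Proof.
move=> mf; under eq_fun do rewrite heatE.
pose F (q : (E * measurableTypeR R) * E) : R := f q.2 * heatK q.1.2 (q.1.1 - q.2).
apply: (@measurable_Rintegral2 _ _ _ _ _ _ (lebesgue_rV_sigma_finite n.+1) F).
apply: measurable_funM; first exact: measurableT_comp.
apply: measurable_heatK.
  by apply: measurable_rVB => //; apply: measurableT_comp.
exact: (measurableT_comp measurable_snd measurable_fst).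
Qed.

(** Over [|x_1| >= r] and [t0 < t < T] the cylinder integrand is the squared flow, so Tonelli bounds
    the square of the norm below by [c^2] times [T - t0]. *)
Lemma L2norm_cylinder_ge (omega : set E) (r tau t0 T c : R) (f : E -> R) :
  (forall x : E, r <= `|x ord0 ord0| -> omega x) -> isL2 mu f ->
  0 < t0 -> tau <= t0 -> t0 < T -> 0 <= c ->
  (forall t, t0 < t -> t < T -> c <= l2 mu (outside r (heat t f))) ->
  ((c * Num.sqrt (T - t0))%:E <= L2norm_cylinder omega tau T (heat_flow f))%E.
Proof.
move=> Hr Lf t00 tau0 t0T c0 Hc.
have Tt0 : 0 <= T - t0 by rewrite subr_ge0 ltW.
rewrite /L2norm_cylinder unlock; set I := integral _ _ _.
have I0 : (0 <= I)%E by apply: integral_ge0 => x _; exact: poweR_ge0.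
suff HI : ((c ^+ 2 * (T - t0))%:E <= I)%E.
  have -> : (c * Num.sqrt (T - t0))%:E = ((c ^+ 2 * (T - t0))%:E `^ 2^-1)%E.
    have c2 : 0 <= c ^+ 2 * (T - t0) by rewrite mulr_ge0 ?sqr_ge0.
    by rewrite poweR_EFin powR12_sqrt// sqrtrM ?sqr_ge0// sqrtr_sqr ger0_norm.
  by apply: gt0_ler_poweR => //; rewrite in_itv/= leey andbT// lee_fin mulr_ge0 ?sqr_ge0.
pose J : set (measurableTypeR R) := `]t0, T[%classic.
have mJ : measurable J by exact: measurable_itv.
have JP t : t \in J -> t0 < t /\ t < T.
  by rewrite inE /J /= in_itv/= => /andP[].
pose g (p : E * measurableTypeR R) : R := outside r (heat p.2 f) p.1 * \1_J p.2.
have mg : measurable_fun setT g.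
  apply: measurable_funM.
    apply: measurable_fun_if => //.
      apply: measurable_fun_ler => //; apply: measurableT_comp => //.
      exact: (measurableT_comp (@measurable_rV _ R n.+1 ord0) measurable_fst).
    by apply: measurable_funTS; apply: measurable_heat_flow; exact: Lf.1.
  exact: (@measurableT_comp _ _ _ _ _ _ (\1_J : measurableTypeR R -> R)).
apply: (@le_trans _ _ (\int[(mu \x leb)%E]_p (g p ^+ 2)%:E)%E); last first.
  apply: integral_monotone => -[x t]; first by rewrite lee_fin sqr_ge0.
  rewrite /g /= indicE /outside.
  case: (boolP (t \in J)) => [/JP[t1 t2]|_]; last by rewrite mulr0 expr0n/= poweR_ge0.
  case: ifPn => [rx|_]; last by rewrite mul0r expr0n/= poweR_ge0.
  rewrite patchE mem_set; last first.
    by split => /=; [exact: Hr|rewrite in_itv/= t2 (le_lt_trans tau0 t1)].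
  by rewrite mulr1 /= lee_fin powR_mulrn// real_normK// num_real.
have mg2 : measurable_fun setT (fun p => (g p ^+ 2)%:E).
  exact: (measurable_sqr_EFin mg).
have g20 p : (0 <= (g p ^+ 2)%:E)%E by rewrite lee_fin sqr_ge0.
rewrite (rV_tonelli2 mg2 g20).
apply: (@le_trans _ _ (\int[leb]_t ((c ^+ 2)%:E * (\1_J t)%:E))%E).
  rewrite ge0_integralZl//; last 2 first.
  - by apply/measurable_EFinP; exact: measurable_indic.
  - by rewrite lee_fin sqr_ge0.
  have -> : (\int[leb]_x (\1_J x)%:E = (T - t0)%:E)%E.
    rewrite integral_indic// setIT.
    have := @lebesgue_measure_itv R `]t0, T[; rewrite /= lte_fin t0T -EFinD; exact.
  by rewrite -EFinM.
apply: integral_monotone => t; first by rewrite mule_ge0// lee_fin ?sqr_ge0// indicE.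
rewrite indicE; case: (boolP (t \in J)) => [tJ|_]; last first.
  by rewrite mule0; apply: integral_ge0.
have [t1 t2] := JP _ tJ.
have Lh : isL2 mu (outside r (heat t f)).
  by apply: (outside_L2 r (heat_isL2 _ Lf)).1; exact: lt_trans t1.
rewrite mule1.
have -> : (\int[mu]_x (g (x, t) ^+ 2)%:E)%E = sqint mu (outside r (heat t f)).
  by apply: eq_integral => x _; rewrite /g /= indicE tJ mulr1.
rewrite (sqintE Lh) lee_fin; apply: lerXn2r; rewrite ?nnegrE ?l2_ge0//.
exact: Hc.
Qed.

End cylinder.

Theorem theorem1p1 (R : realType) (n : nat) (hn : (1 <= n)%N)
    (beta M : R) (hbeta : 0 < beta) (hM : 0 < M)
    (tau T : R) (htau : 0 <= tau) (hT : tau < T)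
    (omega : set 'rV[R]_n) (homega : open omega)
    (hcompact : compact (~` omega)) :
  exists kappa C1 : R,
    [/\ 0 < kappa < 1, 0 < C1 &
      forall u0 : 'rV[R]_n -> R, admissible beta M u0 ->
        let N := L2norm_cylinder omega tau T (heat_flow u0) in
        (N < 1)%E ->
        (L2norm u0 <= (C1 * log_modulus kappa (fine N))%:E)%E].
Proof.
case: n hn omega homega hcompact => // n _ omega _ hcompact.
have [r r0 Hr] := compact_complement_outside hcompact.
pose mu := @lebesgue_rV R n.+1.
(* Positive even when [tau = 0]: smoothing is uniform over the times above [t0], so the number of
   factors can be fixed independently of the time. *)
pose t0 := (tau + T) / 2.
have [t00 tau0 t0T] : [/\ 0 < t0, tau <= t0 & t0 < T] by rewrite /t0; split; lra.
have T0 : 0 < T by lra.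
(* With [k = c * m], the [m]-th root of the [e] of [l2_heat_outside] is at most
   [expR (- 2)]. *)
pose c := (Num.truncn (2 * r ^+ 2 * expR 4 / t0)).+1.
have cr : 2 * r ^+ 2 * expR 4 <= t0 * c%:R.
  have /ltW := truncnS_gt (2 * r ^+ 2 * expR 4 / t0).
  by rewrite -/c ler_pdivrMr// (mulrC t0).
have c0 : 0 < c%:R :> R by rewrite ltr0n.
(* An infimum at most [M] provides a transform of weighted norm below [M + 1], without comparing
   transforms with each other. *)
have M10 : 0 < M + 1 by lra.
pose K := (Num.sqrt (T - t0))^-1.
have K0 : 0 <= K by rewrite invr_ge0 sqrtr_ge0.
have sT0 : 0 < Num.sqrt (T - t0) by rewrite sqrtr_gt0 subr_gt0.
have [kappa [C [k01 C0 HC]]] := log_stability c hbeta M10 K0 T0.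
exists kappa, C; split; [exact: k01|exact: C0|].
move=> u0 [[/isL2P Lu _] hs].
have [g [Fg hW]] : exists g, L2_fourier u0 g /\ (weighted_norm (2 * beta) g < (M + 1)%:E)%E.
  have : (sobolev_norm (2 * beta) u0 < (M + 1)%:E)%E.
    by apply: le_lt_trans hs _; rewrite lte_fin ltrDl.
  by move=> /ereal_inf_lt [_ [g Fg <-] hW]; exists g.
move=> N N1.
have N0 : (0 <= N)%E by rewrite /N /L2norm_cylinder; exact: Lnorm_ge0.
have [x [NE x0 x1]] : exists x : R, [/\ N = x%:E, 0 <= x & x < 1].
  by move: (N) N0 N1 => [x| |]// x0 x1; exists x.
have LE : L2norm u0 = (l2 mu u0)%:E by exact: Lnorm2_l2.
rewrite LE NE lee_fin /=.
pose U := l2 mu u0; pose D := l2 mu (heat T u0).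
have U0 : 0 <= U by exact: l2_ge0.
have UD l : 0 <= l -> U <= expR (T * l) * D + (1 + l) `^ (- beta) * (M + 1).
  move=> l0; apply: (l2_sobolev_le (expR_ge0 _) (powR_ge0 _ _) T0 M10 Lu Fg hW) => y y0.
  exact: frequency_split.
(* Taken with [a = 0] and [b = 1], since the Sobolev weight is at least 1. *)
have UM : U <= M + 1.
  have := @l2_sobolev_le _ _ 0 1 _ T _ u0 g (lexx 0) ler01 T0 M10 Lu Fg hW.
  rewrite mul0r mul1r add0r; apply => y y0.
  rewrite expr0n mul0r add0r expr1n mul1r -[leLHS](@powRr0 _ (1 + y)).
  by apply: ler_powR; [lra|rewrite mulr_ge0// ltW].
have DN m : (0 < m)%N -> D <= (2 ^+ (m * (c * m)) + 1) * K * x +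
    ((1 + expR (- (2 * m%:R))) ^+ (c * m) - 1) * U.
  move=> m0; have cm0 : (0 < c * m)%N by rewrite muln_gt0.
  have m0' : 0 < m%:R :> R by rewrite ltr0n.
  pose b : R := (1 + expR (- (2 * m%:R))) ^+ (c * m) - 1.
  pose Z : R := 2 ^+ (m * (c * m)) + 1.
  have Z0 : 0 < Z by rewrite ltr_wpDl// exprn_ge0.
  rewrite -/b -/Z -lerBlDr.
  (* The norm at time [t] dominates the one at time [T], so [l2_heat_outside] read backwards bounds
     the observation from below, uniformly in [t]. *)
  have lower t : t0 < t -> t < T -> (D - b * U) / Z <= l2 mu (outside r (heat t u0)).
    move=> t1 t2; have tp : 0 < t by exact: lt_trans t1.
    have h1 := heat_l2_antitone tp (ltW t2) Lu.
    have h2 := l2_heat_outside r0 tp m0 cm0 Lu (erefl _).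
    rewrite ler_pdivrMr// lerBlDr mulrC addrC; apply: le_trans h1 (le_trans h2 _).
    rewrite lerD2r ler_wpM2r// lerD2r; apply: lerXn2r; rewrite ?nnegrE ?addr_ge0 ?expR_ge0//.
      by rewrite exprn_ge0// mulr_ge0 ?sqrtr_ge0// mulr_ge0// ltW.
    rewrite lerD2l (_ : - (2 * m%:R) = m%:R * - 2); last by ring.
    rewrite expRM_natl; apply: lerXn2r.
    - by rewrite nnegrE mulr_ge0 ?sqrtr_ge0// mulr_ge0// ltW.
    - by rewrite nnegrE expR_ge0.
    have -> : m%:R / (2 * t * (c * m)%:R) = (2 * t * c%:R)^-1 :> R.
      by rewrite natrM; field; rewrite !gt_eqF.
    rewrite -(@ler_pXn2r _ 2)// ?nnegrE ?expR_ge0//; last first.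
      by rewrite mulr_ge0 ?sqrtr_ge0// mulr_ge0// ltW.
    have tc : 0 < 2 * t * c%:R by rewrite !mulr_gt0.
    rewrite exprMn sqr_sqrtr ?invr_ge0 ?(ltW tc)// ler_pdivrMr//.
    have -> : expR (- 2) ^+ 2 = (expR 4)^-1 :> R.
      by rewrite expr2 -expRD -expRN; congr expR; ring.
    rewrite ler_pdivlMl ?expR_gt0//.
    have := ler_wpM2r (ltW c0) (ltW t1); move: cr; rewrite exprMn.
    set e4 := expR 4; lra.
  (* A nonpositive left-hand side settles the claim; otherwise the lower bound is the nonnegative
     constant that [L2norm_cylinder_ge] asks for. *)
  have [neg|pos] := leP (D - b * U) 0.
    by apply: le_trans neg _; rewrite !mulr_ge0// ltW.
  have q0 : 0 <= (D - b * U) / Z by rewrite divr_ge0// ltW.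
  have := L2norm_cylinder_ge Hr Lu t00 tau0 t0T q0 lower.
  rewrite -/N NE lee_fin -ler_pdivlMr// ler_pdivrMr// => h.
  by apply: le_trans h _; rewrite -/K mulrC -mulrA (mulrC K).
(* If [x = 0], [log_modulus] is 0 and [u0] must have norm 0: the bounds [DN] then hold with every
   positive [y] in place of [x]. *)
rewrite /log_modulus; case: eqVneq => [xz|xn]; last first.
  have xp : 0 < x by rewrite lt_neqAle eq_sym xn.
  exact: HC UM xp x1 DN UD.
rewrite mulr0 -/U.
suff -> : U = 0 by [].
have kp : 0 < kappa by case/andP : k01.
apply: (log_modulus_limit U0 C0 kp) => y /andP[y0 y1].
apply: (HC U D y U0 UM y0 y1 _ UD) => m m0.
apply: le_trans (DN m m0) _; rewrite lerD2r xz mulr0.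
by rewrite !mulr_ge0 ?addr_ge0 ?exprn_ge0// ltW.
Qed.
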